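(* Let $d\ge1$ be an integer and $\frac{d-1}{d}<\gamma\le1$. Let $\boldsymbol{\eta}$ be a real-valued function defined on the set of dyadic cubes of $[0,1]^d$. Suppose there are constants $\kappa\ge0$ and $\varepsilon>0$ such that: (A) for each dyadic cube $K$, $\left|\boldsymbol{\eta}(K)-\sum_{L\text{ child of }K}\boldsymbol{\eta}(L)\right|\le\kappa|K|^{1+\varepsilon}$; (B) for each dyadic cube $K$, $|\boldsymbol{\eta}(K)|\le\kappa|K|^\gamma$. Then there is a unique charge $\boldsymbol{\theta}\in\operatorname{sch}^\gamma([0,1]^d)$ such that, for some constant $C\ge0$, $|\boldsymbol{\eta}(K)-\boldsymbol{\theta}(K)|\le C\kappa|K|^{1+\varepsilon}$ for every dyadic cube $K$.
   Context: $|E|$ denotes Lebesgue measure. For integrable $u:\mathbb{R}^d\to\mathbb{R}$, $\mathbf{V}u=\sup\{\int u\operatorname{div}v: v\in C^1_c(\mathbb{R}^d;\mathbb{R}^d),\ |v(x)|\le 1\ \forall x\}$. The perimeter of a measurable set $A$ is $\|A\|=\mathbf{V}\mathbf{1}_A$; a $BV$-set is a bounded measurable set of finite perimeter. $\mathcal{BV}([0,1]^d)$ is the collection of $BV$-subsets of $[0,1]^d$. A sequence $(B_n)$ in $\mathcal{BV}([0,1]^d)$ $BV$-converges to $B$ if $|B_n\triangle B|\to0$ and $\sup_n\|B_n\|<\infty$. A charge on $[0,1]^d$ is a function $\boldsymbol{\omega}:\mathcal{BV}([0,1]^d)\to\mathbb{R}$ such that $\boldsymbol{\omega}(B_1\cup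 B_2)=\boldsymbol{\omega}(B_1)+\boldsymbol{\omega}(B_2)$ whenever $|B_1\cap B_2|=0$, and $\boldsymbol{\omega}(B_n)\to\boldsymbol{\omega}(B)$ whenever $(B_n)$ $BV$-converges to $B$. A dyadic cube (of generation $n$) is a set $\prod_{i=1}^d[2^{-n}k_i,2^{-n}(k_i+1)]$ with integers $n\ge0$, $0\le k_i\le 2^n-1$; the children of a dyadic cube $K$ of generation $n$ are the $2^d$ dyadic cubes of generation $n+1$ contained in $K$. A charge is $\gamma$-Hölder if $\|\boldsymbol{\omega}\|_\gamma:=\sup\{|\boldsymbol{\omega}(K)|/|K|^\gamma: K\text{ dyadic cube}\}<\infty$; $\operatorname{sch}^\gamma([0,1]^d)$ is the space of $\gamma$-Hölder charges on $[0,1]^d$. *)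

(* Defs.v *)
From HB Require Import structures.
From mathcomp Require Import all_boot all_order all_algebra.
From mathcomp Require Import all_classical all_reals all_analysis.
Set Implicit Arguments.
Unset Strict Implicit.
Unset Printing Implicit Defensive.
Import Order.TTheory GRing.Theory Num.Theory numFieldNormedType.Exports.
Local Open Scope classical_set_scope.
Local Open Scope ring_scope.

(* The library norm on 'rV[R]_d is the sup norm; [eucl_norm] below is the
   Euclidean one. *)

Definition rV_coord (R : realType) (n : nat) (i : 'I_n) (x : 'rV[R]_n) :
  measurableTypeR R := x ord0 i.

(* 'rV[R]_n is given its product sigma-algebra, i.e. the Borel sets. *)
Definition rV_display : measure_display. Proof. exact. Qed.

Section rV_measurable.
Variables (R : realType) (n : nat).
Let rV_set0 : g_sigma_preimage (@rV_coord R n) set0.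
Proof. exact: sigma_algebra0. Qed.
Let rV_setC A :
  g_sigma_preimage (@rV_coord R n) A -> g_sigma_preimage (@rV_coord R n) (~` A).
Proof. exact: sigma_algebraC. Qed.
Let rV_bigcup (F : _^nat) : (forall i, g_sigma_preimage (@rV_coord R n) (F i)) ->
  g_sigma_preimage (@rV_coord R n) (\bigcup_i F i).
Proof. exact: sigma_algebra_bigcup. Qed.
HB.instance Definition _ := @isMeasurable.Build rV_display
  'rV[R]_n (g_sigma_preimage (@rV_coord R n)) rV_set0 rV_setC rV_bigcup.
End rV_measurable.

Section rV_measurable_fun.
Variables (R : realType).

Lemma measurable_rV_coord n (i : 'I_n) : measurable_fun [set: 'rV[R]_n] (rV_coord i).
Proof.
move=> _ Y mY; rewrite setTI; apply: sub_sigma_algebra => /=.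
rewrite -bigcup_seq/=; exists i => /=; first by rewrite mem_index_enum.
by exists Y => //; rewrite setTI.
Qed.

Lemma measurable_fun_rV_coord d (T : measurableType d) n (f : T -> 'rV[R]_n) :
  (forall i, measurable_fun [set: T] (rV_coord i \o f)) ->
  measurable_fun [set: T] f.
Proof.
move=> mf _ A.
rewrite /measurable/= => mA.
have sub : g_sigma_preimage (@rV_coord R n) `<=`
    [set B | measurable (setT `&` f @^-1` B)].
  apply: smallest_sub.
    split.
    - by rewrite /= preimage_set0 setI0; exact: measurable0.
    - move=> B /= mB; rewrite !setTI setTD in mB *.
      by rewrite preimage_setC; exact: measurableC.
    - move=> F mF /=; rewrite preimage_bigcup setI_bigcupr.
      by apply: bigcupT_measurable => k; exact: mF.
  move=> B; rewrite -bigcup_seq => -[i _] [C mC <-] /=.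
  by rewrite setTI; exact: (mf i).
exact: sub.
Qed.

End rV_measurable_fun.

Section rV_lebesgue.
Variable R : realType.

Definition rV_cons (n : nat) (p : measurableTypeR R * 'rV[R]_n) : 'rV[R]_n.+1 :=
  \row_i (if unlift ord0 i is Some j then p.2 ord0 j else p.1).

Definition rV_uncons (n : nat) (x : 'rV[R]_n.+1) :
    measurableTypeR R * 'rV[R]_n :=
  (x ord0 ord0, \row_j x ord0 (lift ord0 j)).

Lemma rV_cons0 n p : @rV_cons n p ord0 ord0 = p.1.
Proof. by rewrite mxE unlift_none. Qed.

Lemma rV_consS n p j : @rV_cons n p ord0 (lift ord0 j) = p.2 ord0 j.
Proof. by rewrite mxE liftK. Qed.

Lemma rV_consK n : cancel (@rV_cons n) (@rV_uncons n).
Proof.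
move=> [a v]; rewrite /rV_uncons rV_cons0; congr (_, _).
by apply/rowP => j; rewrite mxE rV_consS.
Qed.

Lemma rV_unconsK n : cancel (@rV_uncons n) (@rV_cons n).
Proof.
move=> x; apply/rowP => i; have [j ->|->] := unliftP ord0 i.
- by rewrite rV_consS mxE.
- by rewrite rV_cons0.
Qed.

Lemma measurable_rV_cons n : measurable_fun setT (@rV_cons n).
Proof.
apply: measurable_fun_rV_coord => i; have [j ->|->] := unliftP ord0 i.
- rewrite (_ : _ \o _ = rV_coord j \o snd).
    by apply: measurableT_comp => //; exact: measurable_rV_coord.
  by apply/funext => p /=; rewrite /rV_coord rV_consS.
- rewrite (_ : _ \o _ = fst)//.
  by apply/funext => p /=; rewrite /rV_coord rV_cons0.
Qed.

Lemma measurable_rV_uncons n : measurable_fun setT (@rV_uncons n).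
Proof.
apply/measurable_fun_pairP; split.
  exact: measurable_rV_coord.
apply: measurable_fun_rV_coord => i.
rewrite (_ : _ \o _ = rV_coord (lift ord0 i)); first exact: measurable_rV_coord.
by apply/funext => x /=; rewrite /rV_coord mxE.
Qed.

(* The n-fold product of the one-dimensional Lebesgue measure. *)
Fixpoint borel_lebesgue (n : nat) : set 'rV[R]_n -> \bar R :=
  match n with
  | 0 => @dirac _ 'rV[R]_0 0 R
  | m.+1 => pushforward (lebesgue_measure \x @borel_lebesgue m)%E (@rV_cons m)
  end.

Section step.
Variables (n : nat) (mu : {sigma_finite_measure set 'rV[R]_n -> \bar R}).
Let P := (@lebesgue_measure R \x mu)%E.
Let Q := pushforward P (@rV_cons n).

Let mC A : measurable A -> measurable (@rV_cons n @^-1` A).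
Proof.
by move=> mA; rewrite -[X in measurable X]setTI; exact: measurable_rV_cons.
Qed.

Let Q0 : Q set0 = 0%E.
Proof. by rewrite /Q /pushforward preimage_set0 /P measure0. Qed.

Let Q_ge0 A : (0 <= Q A)%E.
Proof. by rewrite /Q /pushforward /P measure_ge0. Qed.

Let Q_add : semi_sigma_additive Q.
Proof.
move=> F mF tF mUF; rewrite /Q /P /pushforward preimage_bigcup.
apply: (@measure_semi_sigma_additive _ _ _ (@lebesgue_measure R \x mu)%E).
- by move=> k; exact: mC.
- apply/trivIsetP => /= i j _ _ ij; rewrite -preimage_setI.
  by move/trivIsetP : tF => /(_ _ _ _ _ ij) ->//; rewrite preimage_set0.
- by rewrite -preimage_bigcup; exact: mC.
Qed.

Let Q_fin : sigma_finite setT Q.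
Proof.
have /sigma_finiteP[F [TF ndF Foo]] := sigma_finiteT (@lebesgue_measure R).
have /sigma_finiteP[G [TG ndG Goo]] := sigma_finiteT mu.
exists (fun k => @rV_uncons n @^-1` (F k `*` G k)).
  rewrite -preimage_bigcup -[LHS](preimage_setT (@rV_uncons n)).
  congr (_ @^-1` _); rewrite -setXTT TF TG predeqE => -[x y]; split.
    move=> [/= [i _ Fix] [k _ Gky]]; exists (maxn i k) => //; split.
    - by move: x Fix; exact/subsetPset/ndF/leq_maxl.
    - by move: y Gky; exact/subsetPset/ndG/leq_maxr.
  by move=> [i _ []/= ? ?]; split; exists i.
move=> k; have [mFk Fk] := Foo k; have [mGk Gk] := Goo k; split.
  rewrite -[X in measurable X]setTI.
  by apply: measurable_rV_uncons => //; exact: measurableX.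
rewrite /Q /pushforward -comp_preimage (_ : _ \o _ = id).
  by rewrite preimage_id /P product_measure1E// lte_mul_pinfty// ge0_fin_numE.
by apply/funext => p /=; rewrite rV_consK.
Qed.

Lemma borel_lebesgue_step : [/\ Q set0 = 0%E, (forall A, 0 <= Q A)%E,
  semi_sigma_additive Q & sigma_finite setT Q].
Proof. by split. Qed.
End step.

Fact borel_lebesgue_measure n : [/\ @borel_lebesgue n set0 = 0%E,
  (forall A, 0 <= @borel_lebesgue n A)%E,
  semi_sigma_additive (@borel_lebesgue n) &
  sigma_finite setT (@borel_lebesgue n)].
Proof.
elim: n => [|n [m0 mge0 madd mfin]].
  split.
  - exact: (measure0 (dirac _)).
  - exact: (measure_ge0 (dirac _)).
  - exact: (@measure_semi_sigma_additive _ _ _ (dirac _)).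
  - exact: (sigma_finiteT (dirac _)).
pose M := isMeasure.Build _ _ _ (@borel_lebesgue n) m0 mge0 madd.
pose mu0 : {measure set _ -> \bar R} := HB.pack (@borel_lebesgue n) M.
pose S := Measure_isSigmaFinite.Build _ _ _ mu0 mfin.
pose mu : {sigma_finite_measure set _ -> \bar R} :=
  HB.pack (@borel_lebesgue n) M S.
exact: (borel_lebesgue_step mu).
Qed.

HB.instance Definition _ n := isMeasure.Build _ _ _ (@borel_lebesgue n)
  (let: And4 h _ _ _ := borel_lebesgue_measure n in h)
  (let: And4 _ h _ _ := borel_lebesgue_measure n in h)
  (let: And4 _ _ h _ := borel_lebesgue_measure n in h).
HB.instance Definition _ n := Measure_isSigmaFinite.Build _ _ _
  (@borel_lebesgue n) (let: And4 _ _ _ h := borel_lebesgue_measure n in h).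

End rV_lebesgue.

Section charges.
Variables (R : realType) (d : nat).
Local Notation rV := 'rV[R]_d.
Implicit Types (A B : set rV) (v : rV -> rV).

(* Completion: defined on all Caratheodory-measurable (= Lebesgue-measurable)
   sets, in the same way as [completed_lebesgue_measure] on R. *)
Definition lebesgue : set _ -> \bar R :=
  @completed_measure_extension _ _ _ (@borel_lebesgue R d).
HB.instance Definition _ := Measure.on lebesgue.

Definition lebesgue_measurable A : Prop :=
  ((@borel_lebesgue R d)^*)%mu.-cara.-measurable A.

Definition eucl_norm (x : rV) : R := Num.sqrt (\sum_i x ord0 i ^+ 2).

Definition C1c v : Prop :=
  [/\ forall x, differentiable v x,
      continuous (fun x => 'J v x) &
      compact (closure [set x | v x != 0])].

(* ('J v x) i j is the partial derivative of v_j along e_i. *)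
Definition divergence v (x : rV) : R := \tr ('J v x).

Definition BV_variation (u : rV -> R) : \bar R :=
  ereal_sup [set (\int[lebesgue]_x (u x * divergence v x)%:E)%E |
    v in [set v | C1c v /\ forall x, eucl_norm (v x) <= 1]].

Definition perimeter A : \bar R := BV_variation \1_A.

Definition BV_set A : Prop :=
  [/\ lebesgue_measurable A, bounded_set A & (perimeter A < +oo)%E].

Definition unit_cube : set rV := [set x | forall i, 0 <= x ord0 i <= 1].

Definition BV_cube A : Prop := BV_set A /\ A `<=` unit_cube.

Definition BV_cvg (B_ : nat -> set rV) B : Prop :=
  (fun n => lebesgue (B_ n `+` B)) @ \oo --> 0%E /\
  (ereal_sup (range (fun n => perimeter (B_ n))) < +oo)%E.

(* A charge is encoded by a total function on sets whose values outside
   [BV_cube] are irrelevant: every clause below only looks at BV-subsets of the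
   unit cube, and charges are to be compared on these sets only
   ([charge_eq]). *)
Definition is_charge (omega : set rV -> R) : Prop :=
  (forall B1 B2, BV_cube B1 -> BV_cube B2 -> lebesgue (B1 `&` B2) = 0%E ->
     omega (B1 `|` B2) = omega B1 + omega B2) /\
  (forall (B_ : nat -> set rV) B, (forall n, BV_cube (B_ n)) -> BV_cube B ->
     BV_cvg B_ B -> (fun n => omega (B_ n)) @ \oo --> omega B).

Definition charge_eq (omega omega' : set rV -> R) : Prop :=
  forall B, BV_cube B -> omega B = omega' B.

Record dyadic_cube := DyadicCube {
  generation : nat;
  corner : {ffun 'I_d -> 'I_(2 ^ generation)}
}.

(* Distinct pairs (n, k) give distinct cubes as soon as 0 < d, so that functions
   on [dyadic_cube] are functions on the set of dyadic cubes. *)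
Definition cube (K : dyadic_cube) : set rV :=
  [set x | forall i, (corner K i)%:R / 2 ^+ generation K <= x ord0 i
                     <= (corner K i).+1%:R / 2 ^+ generation K].

Definition vol (K : dyadic_cube) : R := fine (lebesgue (cube K)).

Definition children_sum (eta : dyadic_cube -> R) (K : dyadic_cube) : R :=
  \sum_(l : {ffun 'I_d -> 'I_(2 ^ (generation K).+1)}
         | `[< cube (DyadicCube l) `<=` cube K >]) eta (DyadicCube l).

Definition holder_norm (gamma : R) (omega : set rV -> R) : \bar R :=
  ereal_sup (range (fun K => (`|omega (cube K)| / vol K `^ gamma)%:E)).

Definition sch (gamma : R) (omega : set rV -> R) : Prop :=
  is_charge omega /\ (holder_norm gamma omega < +oo)%E.

End charges.

(* Main.v *)
(** The approximations theta_n(B) = sum_K eta(K) |B ∩ K| / |K|, K ranging over the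
    dyadic cubes of generation n, are additive in B and, for fixed n, continuous
    for the L^1 distance. Their increments split into a defect part, bounded
    through (A) by kappa |B| 2^(-n d eps), and a refinement part, bounded through
    (B) by 2^(-n d gamma) times the sum over K of the oscillations of |B ∩ L| / |L|,
    L a child of K. Halving K one coordinate at a time, these oscillations become
    differences of the volumes that B has in the two halves of boxes of a grid;
    testing the perimeter against a field built on tent functions bounds their sum
    by C 2^(n (d - 1)) Per B. As gamma > (d - 1) / d, theta_n converges uniformly on
    sets of bounded perimeter, and the limit is a charge. On a dyadic cube the
    refinement part vanishes, whence the estimate |eta - theta| <= C kappa |K|^(1 + eps).

    For uniqueness, the difference of two solutions is additive and
    O(|K|^(1 + eps)) on dyadic cubes, hence zero on unions of them. A BV-set B is a
    BV-limit of such unions: take the cubes K with |B ∩ K| > t |K|, where the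
    threshold t in [1/4, 3/4] is chosen by a discrete coarea argument so that the
    number of faces of the union is controlled by Per B. *)
Require Import Defs.
From HB Require Import structures.
From mathcomp Require Import all_boot all_order all_algebra.
From mathcomp Require Import all_classical all_reals all_analysis.
From mathcomp Require Import measurable_realfun.
From mathcomp Require Import ring lra zify.
Import Order.TTheory GRing.Theory Num.Theory numFieldNormedType.Exports.
Set Implicit Arguments.
Unset Strict Implicit.
Unset Printing Implicit Defensive.
Local Open Scope classical_set_scope.
Local Open Scope ring_scope.

(** * Lebesgue measure of boxes *)

(** The perimeter of [B] is accessible only through test fields, so each estimate on [B] has to come
    from one [C^1] field of norm at most 1. That field must see all the boxes of a grid at once,
    with the signs of the volume differences as coefficients. The boxes may be up to twice as long
    as the grid step: sides up to the step serve the refinement of averages, and a side of twice the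
    step, straddling a face, compares a cell with its neighbour in the coarea argument. Conversely,
    bounding the perimeter of a figure requires a divergence theorem. It is needed on boxes only,
    where Fubini and the fundamental theorem of calculus give it, and fluxes through faces are
    replaced by volume integrals. Keeping the threshold in [1/4, 3/4] makes the selected figure
    quasi-optimal: in each cell its error is at most three times that of any other selection.
    Convergence in volume then follows from the mere density of dyadic figures, without a rate. *)

Section boxes.
Variable R : realType.

Definition box (n : nat) (I : 'I_n -> set R) : set 'rV[R]_n :=
  [set x | forall i, I i (x ord0 i)].

Lemma measurable_box n (I : 'I_n -> set (measurableTypeR R)) :
  (forall i, measurable (I i)) -> measurable (box I).
Proof.
move=> mI; rewrite (_ : box I = \big[setI/setT]_(i < n) (rV_coord i @^-1` I i)).
  apply: bigsetI_measurable => i _; rewrite -[X in measurable X]setTI.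
  exact: measurable_rV_coord.
rewrite -bigcap_seq.
apply/seteqP; split=> [x Ix i _|x Ix i]; first exact: Ix.
by apply: (Ix i); rewrite /= mem_index_enum.
Qed.

Lemma borel_lebesgue_box n (I : 'I_n -> set (measurableTypeR R)) (l : 'I_n -> R) :
  (forall i, measurable (I i)) -> (forall i, lebesgue_measure (I i) = (l i)%:E) ->
  borel_lebesgue (box I) = (\prod_(i < n) l i)%:E.
Proof.
elim: n I l => [|n IH] I l mI lI.
  rewrite big_ord0 /= diracE mem_set// => -[]//.
rewrite /= /pushforward (_ : _ @^-1` _ =
    I ord0 `*` box (fun j => I (lift ord0 j))).
  rewrite product_measure1E//; last exact: measurable_box.
  rewrite big_ord_recl EFinM; congr (_ * _)%E; first exact: lI.
  by apply: (IH _ (fun j => l (lift ord0 j))) => j; [exact: mI|exact: lI].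
apply/seteqP; split=> [[a v] /= Iav|[a v] [/= Ia Iv] i].
  split=> [|j] /=; first by have := Iav ord0; rewrite rV_cons0.
  by have := Iav (lift ord0 j); rewrite rV_consS.
by have [j ->|->] := unliftP ord0 i; rewrite ?rV_consS ?rV_cons0 //=; apply: Iv.
Qed.

Variable n : nat.

Lemma borel_lebesgue_measurable (A : set 'rV[R]_n) :
  measurable A -> lebesgue_measurable A.
Proof. exact: caratheodory_measurable_mu_ext. Qed.

Lemma lebesgueE (A : set 'rV[R]_n) :
  measurable A -> lebesgue A = borel_lebesgue A.
Proof. exact: measurable_mu_extE. Qed.

Lemma lebesgue_box (I : 'I_n -> set (measurableTypeR R)) (l : 'I_n -> R) :
  (forall i, measurable (I i)) -> (forall i, lebesgue_measure (I i) = (l i)%:E) ->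
  lebesgue (box I) = (\prod_(i < n) l i)%:E.
Proof.
by move=> mI lI; rewrite lebesgueE ?(borel_lebesgue_box _ lI)//; exact: measurable_box.
Qed.

Lemma lebesgue_box_itv (b1 b2 : bool) (a b : 'I_n -> R) :
  (forall i, a i <= b i) ->
  lebesgue (box (fun i => [set` Interval (BSide b1 (a i)) (BSide b2 (b i))])) =
  (\prod_(i < n) (b i - a i))%:E.
Proof.
move=> ab; apply: lebesgue_box => i; first exact: measurable_itv.
rewrite lebesgue_measure_itv/= lte_fin; case: ltP => //= ba.
by rewrite (@le_anti _ _ (a i) (b i)) ?ab ?ba ?subrr.
Qed.

End boxes.

(** * Real-valued volume of sets of finite measure *)

Section finite_measure.
Variables (R : realType) (d : nat).
Local Notation rV := 'rV[R]_d.
Local Notation mu := (@lebesgue R d).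
Implicit Types A B C : set rV.

Definition fin_meas A := lebesgue_measurable A /\ (mu A < +oo)%E.
(** [fine] sends an infinite measure to 0, so the value is meaningful on [fin_meas] sets only. *)
Definition volume A : R := fine (mu A).

Lemma lmeasI A B : lebesgue_measurable A -> lebesgue_measurable B ->
  lebesgue_measurable (A `&` B).
Proof. exact: measurableI. Qed.
Lemma lmeasD A B : lebesgue_measurable A -> lebesgue_measurable B ->
  lebesgue_measurable (A `\` B).
Proof. exact: measurableD. Qed.
Lemma lmeasU A B : lebesgue_measurable A -> lebesgue_measurable B ->
  lebesgue_measurable (A `|` B).
Proof. exact: measurableU. Qed.
Lemma lmeas0 : lebesgue_measurable (@set0 rV).
Proof. exact: measurable0. Qed.

Lemma lmeas_bigU (I : Type) (r : seq I) (P : pred I) (F : I -> set rV) :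
  (forall i, P i -> lebesgue_measurable (F i)) ->
  lebesgue_measurable (\big[setU/set0]_(i <- r | P i) F i).
Proof. by move=> mF; rewrite /lebesgue_measurable; apply: bigsetU_measurable. Qed.

Lemma le_lebesgue A B : A `<=` B -> (mu A <= mu B)%E.
Proof. exact: le_outer_measure. Qed.

Lemma fin_measS A B : lebesgue_measurable A -> A `<=` B -> fin_meas B -> fin_meas A.
Proof. by move=> mA AB [mB fB]; split=> //; exact: le_lt_trans (le_lebesgue AB) fB. Qed.

Lemma fin_measI A B : fin_meas A -> lebesgue_measurable B -> fin_meas (A `&` B).
Proof. by move=> fA mB; apply: (fin_measS _ _ fA); [apply: lmeasI => //; exact: fA.1|exact: subIsetl]. Qed.

Lemma fin_measD A B : fin_meas A -> lebesgue_measurable B -> fin_meas (A `\` B).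
Proof. by move=> fA mB; apply: (fin_measS _ _ fA); [apply: lmeasD => //; exact: fA.1|exact: subDsetl]. Qed.

Lemma volumeE A : fin_meas A -> mu A = (volume A)%:E.
Proof. by move=> [mA fA]; rewrite fineK// ge0_fin_numE// outer_measure_ge0. Qed.

Lemma volume_ge0 A : 0 <= volume A.
Proof. by rewrite fine_ge0// outer_measure_ge0. Qed.

Lemma volume_le A B : lebesgue_measurable A -> A `<=` B -> fin_meas B ->
  volume A <= volume B.
Proof.
move=> mA AB fB; rewrite -lee_fin -!volumeE//; first exact: le_lebesgue.
exact: fin_measS fB.
Qed.

Lemma fin_measU A B : fin_meas A -> fin_meas B -> fin_meas (A `|` B).
Proof.
move=> fA fB; split; first by apply: lmeasU; [exact: fA.1|exact: fB.1].
by rewrite (le_lt_trans (outer_measureU2 _ _ _))//= lte_add_pinfty//; [exact: fA.2|exact: fB.2].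
Qed.

Lemma volume_split A B : fin_meas A -> lebesgue_measurable B ->
  volume A = volume (A `&` B) + volume (A `\` B).
Proof.
move=> fA mB; apply/EFin_inj; rewrite EFinD -!volumeE//; last 2 first.
- exact: fin_measD.
- exact: fin_measI.
by rewrite addeC; apply: measureDI => //; exact: fA.1.
Qed.

Lemma volumeU A B : fin_meas A -> fin_meas B -> A `&` B = set0 ->
  volume (A `|` B) = volume A + volume B.
Proof.
move=> fA fB AB0; rewrite (volume_split (fin_measU fA fB) fA.1); congr (volume _ + volume _).
  by apply/seteqP; split=> [x []//|x Ax]; split=> //; left.
apply/seteqP; split=> [x [[]//]|x Bx]; split; first by right.
by move=> Ax; have : (A `&` B) x by []; rewrite AB0.
Qed.

Lemma volume0 : volume set0 = 0.
Proof. by rewrite /volume [mu _](measure0 (@lebesgue R d)). Qed.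

Lemma volume_bigU (I : finType) (P : pred I) (F : I -> set rV) A :
  fin_meas A -> (forall i, lebesgue_measurable (F i)) ->
  (forall i j, i != j -> F i `&` F j = set0) ->
  volume (A `&` \big[setU/set0]_(i | P i) F i) = \sum_(i | P i) volume (A `&` F i).
Proof.
move=> fA mF tF; suff : forall r : seq I, uniq r ->
  volume (A `&` \big[setU/set0]_(i <- r | P i) F i) = \sum_(i <- r | P i) volume (A `&` F i).
  by apply; exact: index_enum_uniq.
elim=> [_|a r IH /= /andP[ar /IH {}IH]]; first by rewrite !big_nil setI0 volume0.
rewrite !big_cons; case: ifP => // Pa; rewrite setIUr volumeU ?IH//.
- exact: fin_measI.
- by apply: fin_measI => //; exact: lmeas_bigU.
- apply/seteqP; split=> // x [[_ Fax] [_]].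
  rewrite -bigcup_seq_cond => -[j /= /andP[jr _] Fjx].
  have aj : a != j by apply: contraNneq ar => ->.
  have : (F a `&` F j) x by [].
  by rewrite tF.
Qed.

Lemma volume_eq A B N : fin_meas A -> fin_meas B -> fin_meas N -> volume N = 0 ->
  A `<=` B `|` N -> B `<=` A `|` N -> volume A = volume B.
Proof.
move=> fA fB fN N0 AB BA; have aux C D : fin_meas C -> fin_meas D -> C `<=` D `|` N ->
    volume C <= volume D.
  move=> fC fD CD; rewrite (volume_split fC fD.1) -[leRHS]addr0; apply: lerD.
    by apply: volume_le => //; apply: lmeasI; [exact: fC.1|exact: fD.1].
  rewrite -N0; apply: volume_le => //; first by apply: lmeasD; [exact: fC.1|exact: fD.1].
  by move=> x [/CD[]].
by apply/eqP; rewrite eq_le !aux.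
Qed.

End finite_measure.

Lemma continuous_addf (R : realType) (T : topologicalType) (f g : T -> R) :
  continuous f -> continuous g -> continuous (fun x => f x + g x).
Proof. by move=> cf cg x; apply: cvgD; [exact: cf|exact: cg]. Qed.

Lemma continuous_mulf (R : realType) (T : topologicalType) (f g : T -> R) :
  continuous f -> continuous g -> continuous (fun x => f x * g x).
Proof. by move=> cf cg x; apply: cvgM; [exact: cf|exact: cg]. Qed.

(** * C^1 fields parallel to a coordinate axis *)

Section C1.
Variables (R : realType) (d : nat).
Local Notation rV := 'rV[R]_d.

Definition basis_vec (m : 'I_d) : rV := delta_mx ord0 m.

(** The test fields built below are of the form [f x *: basis_vec i], so a scalar notion suffices.
    Continuity of the derivatives along the axes is what [C1c] asks of the Jacobian. *)
Definition C1_fun (f : rV -> R) :=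
  (forall x, differentiable f x) /\
  forall m, continuous (fun x => 'D_(basis_vec m) f x).

Lemma C1_cst (c : R) : C1_fun (cst c).
Proof.
split=> [x|m]; first exact: differentiable_cst.
have -> : 'D_(basis_vec m) (cst c) = cst 0 :> (rV -> R).
  by apply/funext => x; rewrite derive_cst.
exact: cst_continuous.
Qed.

Lemma C1_derivable f x m : C1_fun f -> derivable f x (basis_vec m).
Proof. by case=> df _; exact: diff_derivable. Qed.

Lemma C1_continuous f : C1_fun f -> continuous f.
Proof. by case=> df _ x; exact: differentiable_continuous. Qed.

Lemma C1_add f g : C1_fun f -> C1_fun g -> C1_fun (fun x => f x + g x).
Proof.
move=> Cf Cg; split=> [x|m]; first by apply: differentiableD; [exact: Cf.1|exact: Cg.1].
have -> : 'D_(basis_vec m) (fun x => f x + g x) =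
    (fun x => 'D_(basis_vec m) f x + 'D_(basis_vec m) g x).
  by apply/funext => x; rewrite deriveD//; exact: C1_derivable.
exact: (@continuous_addf R rV _ _ (Cf.2 m) (Cg.2 m)).
Qed.

Lemma C1_mul f g : C1_fun f -> C1_fun g -> C1_fun (fun x => f x * g x).
Proof.
move=> Cf Cg; split=> [x|m]; first by apply: differentiableM; [exact: Cf.1|exact: Cg.1].
have -> : 'D_(basis_vec m) (fun x => f x * g x) =
    (fun x => f x * 'D_(basis_vec m) g x + g x * 'D_(basis_vec m) f x).
  by apply/funext => x; rewrite deriveM//; exact: C1_derivable.
exact: (@continuous_addf R rV _ _
    (@continuous_mulf R rV _ _ (C1_continuous Cf) (Cg.2 m))
    (@continuous_mulf R rV _ _ (C1_continuous Cg) (Cf.2 m))).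
Qed.

Lemma C1_sum (I : Type) (r : seq I) (P : pred I) (F : I -> rV -> R) :
  (forall i, P i -> C1_fun (F i)) -> C1_fun (fun x => \sum_(i <- r | P i) F i x).
Proof.
move=> CF; elim: r => [|a r IH].
  under [X in C1_fun X]eq_fun do rewrite big_nil; exact: C1_cst.
under [X in C1_fun X]eq_fun do rewrite big_cons.
by case: (boolP (P a)) => Pa //; apply: C1_add => //; exact: CF.
Qed.

Lemma derive_sum_seq (I : Type) (r : seq I) (P : pred I) (F : I -> rV -> R) x m :
  (forall i, P i -> C1_fun (F i)) ->
  'D_(basis_vec m) (fun x => \sum_(i <- r | P i) F i x) x =
  \sum_(i <- r | P i) 'D_(basis_vec m) (F i) x.
Proof.
move=> CF; elim: r => [|a r IH].
  by under eq_fun do rewrite big_nil; rewrite big_nil derive_cst.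
under eq_fun do rewrite big_cons.
rewrite big_cons; case: (boolP (P a)) => Pa //.
rewrite -IH -deriveD//; apply: C1_derivable; [exact: CF|exact: C1_sum].
Qed.

Lemma C1_prod (I : Type) (r : seq I) (P : pred I) (F : I -> rV -> R) :
  (forall i, P i -> C1_fun (F i)) -> C1_fun (fun x => \prod_(i <- r | P i) F i x).
Proof.
move=> CF; elim: r => [|a r IH].
  under [X in C1_fun X]eq_fun do rewrite big_nil; exact: C1_cst.
under [X in C1_fun X]eq_fun do rewrite big_cons.
by case: (boolP (P a)) => Pa //; apply: C1_mul => //; exact: CF.
Qed.

(** Meant for a product of factors that do not depend on the [m]-th coordinate: it behaves as a
    constant under the derivative. *)
Lemma derive_prod_eq0 (I : Type) (r : seq I) (P : pred I) (F : I -> rV -> R) x m :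
  (forall i, P i -> C1_fun (F i)) ->
  (forall i, P i -> 'D_(basis_vec m) (F i) x = 0) ->
  'D_(basis_vec m) (fun x => \prod_(i <- r | P i) F i x) x = 0.
Proof.
move=> CF F0; elim: r => [|a r IH].
  by under eq_fun do rewrite big_nil; rewrite derive_cst.
under eq_fun do rewrite big_cons.
case: (boolP (P a)) => Pa //.
rewrite deriveM/=; [|exact/C1_derivable/CF|exact/C1_derivable/C1_prod].
by rewrite IH F0// !scaler0 addr0.
Qed.

Section coord.
Variables (g dg : R -> R) (i : 'I_d).
Hypothesis gdg : forall t : R, is_derive t (1 : R) g (dg t).
Hypothesis cdg : continuous dg.

Let dcoord (x : rV) : is_diff x (fun y : rV => y ord0 i) (fun y : rV => y ord0 i).
Proof.
(* The coordinate as a bundled linear map, which is its own differential. *)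
have @f : {linear rV -> R}.
  by exists (fun N : rV => N ord0 i); do 2![eexists]; do ?[constructor];
     rewrite ?mxE// => ? *; rewrite ?mxE//; move=> ?; rewrite !mxE.
split; first exact: differentiable_coord.
by rewrite (_ : (fun y : rV => y ord0 i) = f) ?diff_lin//; exact: coord_continuous.
Qed.

Lemma derive_coord (x : rV) m :
  'D_(basis_vec m) (fun y : rV => g (y ord0 i)) x = (i == m)%:R * dg (x ord0 i).
Proof.
have dg1 : differentiable g (x ord0 i) by apply/derivable1_diffP.
rewrite deriveE; last exact: differentiable_comp (differentiable_coord _ _ _) dg1.
rewrite diff_comp//; last exact: differentiable_coord.
rewrite /= (diff_val (is_diff_def := dcoord x)) /= deriv1E; last exact/derivable1_diffP.
by rewrite derive1E (derive_val (is_derive := gdg _)) /basis_vec mxE eqxx.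
Qed.

Lemma C1_coord : C1_fun (fun x : rV => g (x ord0 i)).
Proof.
split=> [x|m].
  apply: differentiable_comp; first exact: differentiable_coord.
  by apply/derivable1_diffP.
under [X in continuous X]eq_fun do rewrite derive_coord.
apply: (@continuous_mulf R rV); first exact: cst_continuous.
move=> x.
apply: (@continuous_comp _ _ _ (fun x : rV => x ord0 i) dg); first exact: coord_continuous.
exact: cdg.
Qed.

End coord.

Lemma continuous_entries (T : topologicalType) m n (M : T -> 'M[R]_(m, n)) :
  (forall i j, continuous (fun x => M x i j)) -> continuous M.
Proof.
move=> cM x; apply/cvg_ballP => e e0.
suff : \forall y \near x, forall i j, ball (M x i j) e (M y i j).
  by apply: filterS => y My; split.
apply: filter_forall => i; apply: filter_forall => j.
move: (cM i j x) => /cvg_ballP/(_ e e0); exact.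
Qed.

Lemma jacobian_entry (v : rV -> rV) x a b : differentiable v x ->
  'J v x a b = ('D_(basis_vec a) v x) ord0 b.
Proof. move=> dv; rewrite deriveEjacobian//. by rewrite /basis_vec -rowE [RHS]mxE. Qed.

Lemma derive_scale_basis f x i m : C1_fun f ->
  'D_(basis_vec m) (fun x => f x *: basis_vec i) x =
  'D_(basis_vec m) f x *: basis_vec i.
Proof.
move=> Cf; rewrite deriveE; last exact/differentiableZl/Cf.1.
by rewrite diffZl; [rewrite deriveE//; exact: Cf.1|exact: Cf.1].
Qed.

Lemma divergence_scale_basis f i x : C1_fun f ->
  divergence (fun x => f x *: basis_vec i) x = 'D_(basis_vec i) f x.
Proof.
move=> Cf; rewrite /divergence /mxtrace (bigD1 i)//= big1 ?addr0.
  rewrite jacobian_entry; last exact/differentiableZl/Cf.1.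
  by rewrite derive_scale_basis// !mxE !eqxx mulr1.
move=> j ji; rewrite jacobian_entry; last exact/differentiableZl/Cf.1.
by rewrite derive_scale_basis// !mxE (negbTE ji) andbF mulr0.
Qed.

Lemma C1c_scale_basis f i (M : R) : C1_fun f ->
  (forall x : rV, M < `|x| -> f x = 0) -> C1c (fun x => f x *: basis_vec i).
Proof.
move=> Cf f0; split=> [x||]; first exact/differentiableZl/Cf.1.
- apply: continuous_entries => a b.
  rewrite (_ : (fun x => _) =
      (fun x => 'D_(basis_vec a) f x * basis_vec i ord0 b)).
    by apply: (@continuous_mulf R rV); [exact: Cf.2|exact: cst_continuous].
  apply/funext => x; rewrite jacobian_entry; last exact/differentiableZl/Cf.1.
  by rewrite derive_scale_basis// mxE.
- apply: bounded_closed_compact; last exact: closed_closure.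
  exists M; split; first exact: num_real.
  move=> N MN; suff : closure [set x | f x *: basis_vec i != 0] `<=` [set x | `|x| <= M].
    by move=> h x /h /= xM; exact: le_trans xM (ltW MN).
  have cM : closed [set x : rV | `|x| <= M].
    rewrite (_ : [set _ | _] = (fun x : rV => `|x|) @^-1` [set t | t <= M])//.
    by apply: closed_comp; [move=> x _; exact: norm_continuous|exact: closed_le].
  rewrite [X in _ `<=` X](closure_id _).1//.
  apply: closure_subset => x /=; apply: contraNT; rewrite -ltNge => /f0 ->.
  by rewrite scale0r.
Qed.

Lemma eucl_norm_scale_basis (c : R) i : eucl_norm (c *: basis_vec i) = `|c|.
Proof.
rewrite /eucl_norm (bigD1 i)//= big1 ?addr0; first by rewrite !mxE !eqxx mulr1 sqrtr_sqr.
by move=> j ji; rewrite !mxE (negbTE ji) andbF mulr0 expr0n.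
Qed.

End C1.

(** * Rounded ramps, bumps and tents on the line *)

Section one_variable.
Variable R : realType.
Implicit Types (f g df dg : R -> R) (t u e : R).

(** A first-order expansion whose quadratic error is uniform in [t]. It yields the derivative and
    its continuity, and it is stable under sums, scalings and affine substitutions. Piecewise
    quadratic functions are thus handled by arithmetic, without one-sided derivatives at the
    corners. *)
Definition quad_diff f df :=
  exists2 C : R, 0 <= C & forall t h : R, `|f (t + h) - f t - h * df t| <= C * h ^+ 2.

Lemma quad_diff_is_derive f df t : quad_diff f df -> is_derive t (1 : R) f (df t).
Proof.
move=> [C C0 fC].
have cv : (fun h => h^-1 *: ((f \o shift t) (h *: (1 : R)) - f t)) @ 0^' --> df t.
  apply/cvgrPdist_le => eps eps0; near=> h.
  have h0 : h != 0 by near: h; exact: nbhs_dnbhs_neq.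
  rewrite /= [h *: 1]mulr1 [h + t]addrC.
  have -> : df t - h^-1 *: (f (t + h) - f t) = - (h^-1 * (f (t + h) - f t - h * df t)).
    by rewrite -[h^-1 *: _]/(h^-1 * _); field.
  rewrite normrN normrM normfV ler_pdivrMl ?normr_gt0//.
  rewrite (le_trans (fC _ _))// -real_normK ?num_real// expr2 mulrA mulrC.
  rewrite ler_wpM2l//.
  have : `|h| <= eps / (C + 1).
    near: h; apply: dnbhs0_le.
    by rewrite divr_gt0// ltr_wpDl.
  rewrite ler_pdivlMr ?ltr_wpDl// => /(le_trans _); apply.
  by have := normr_ge0 h; nra.
apply: DeriveDef; first by apply/cvg_ex; exists (df t).
by apply/cvg_lim.
Unshelve. all: by end_near. Qed.

(** Adding the expansions from [t] to [u] and from [u] to [t] cancels the values of [f] and shows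
    that [df] is [2 C]-Lipschitz. *)
Lemma quad_diff_continuous f df : quad_diff f df -> continuous df.
Proof.
move=> [C C0 fC] t; apply/cvgrPdist_le => eps eps0; near=> u.
have lip : `|df t - df u| <= 2 * C * `|u - t|.
  have [->|ut] := eqVneq u t; first by rewrite !subrr normr0 mulr0.
  have h1 := fC t (u - t); have h2 := fC u (t - u).
  rewrite subrKC in h1; rewrite subrKC in h2.
  rewrite -(ler_pM2r (_ : 0 < `|u - t|)) ?normr_gt0 ?subr_eq0// -normrM.
  have -> : (df t - df u) * (u - t) =
    - (f u - f t - (u - t) * df t + (f t - f u - (t - u) * df u)) by ring.
  rewrite normrN (le_trans (ler_normD _ _))// (le_trans (lerD h1 h2))//.
  rewrite -[leRHS]mulrA -[`|u - t| * _]expr2 real_normK ?num_real//; nra.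
rewrite (le_trans lip)//.
have : `|t - u| <= eps / (2 * C + 1).
  near: u; apply: (@cvgr_dist_le _ _ _ _ _ id) => //.
  by rewrite divr_gt0// ltr_wpDl// mulr_ge0.
rewrite distrC ler_pdivlMr ?ltr_wpDl ?mulr_ge0// => /(le_trans _); apply.
by have := normr_ge0 (u - t); nra.
Unshelve. all: by end_near. Qed.

Lemma quad_diffD f df g dg : quad_diff f df -> quad_diff g dg ->
  quad_diff (fun t => f t + g t) (fun t => df t + dg t).
Proof.
move=> [C C0 fC] [D D0 gD]; exists (C + D); first exact: addr_ge0.
move=> t h; rewrite mulrDl.
have -> : f (t + h) + g (t + h) - (f t + g t) - h * (df t + dg t) =
  (f (t + h) - f t - h * df t) + (g (t + h) - g t - h * dg t) by ring.
by rewrite (le_trans (ler_normD _ _))// lerD.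
Qed.

Lemma quad_diffZ (c : R) f df : quad_diff f df ->
  quad_diff (fun t => c * f t) (fun t => c * df t).
Proof.
move=> [C C0 fC]; exists (`|c| * C); first exact: mulr_ge0.
move=> t h.
have -> : c * f (t + h) - c * f t - h * (c * df t) = c * (f (t + h) - f t - h * df t) by ring.
by rewrite normrM -mulrA ler_wpM2l.
Qed.

Lemma quad_diff_affine (a b : R) f df : quad_diff f df ->
  quad_diff (fun t => f (a * t + b)) (fun t => a * df (a * t + b)).
Proof.
move=> [C C0 fC]; exists (C * a ^+ 2); first by rewrite mulr_ge0// sqr_ge0.
move=> t h; have := fC (a * t + b) (a * h).
have -> : a * t + b + a * h = a * (t + h) + b by ring.
by rewrite exprMn !mulrA [h * a]mulrC.
Qed.

Lemma quad_diff_shift (b : R) f df : quad_diff f df ->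
  quad_diff (fun t => f (t + b)) (fun t => df (t + b)).
Proof.
move=> [C C0 fC]; exists C => // t h.
by rewrite (addrAC t h b); exact: fC.
Qed.

Definition pos_part u : R := Num.max u 0.
Definition pos_sq u : R := pos_part u ^+ 2.

Lemma pos_partP u : (u <= 0 /\ pos_part u = 0) \/ (0 <= u /\ pos_part u = u).
Proof.
have [u0|u0] := leP u 0.
  by left; split=> //; rewrite /pos_part; apply/max_idPr.
by right; split; [exact: ltW|rewrite /pos_part; apply/max_idPl/ltW].
Qed.

Lemma pos_part_le0 u : u <= 0 -> pos_part u = 0.
Proof. by move=> u0; apply/max_idPr. Qed.

Lemma pos_part_ge0 u : 0 <= u -> pos_part u = u.
Proof. by move=> u0; apply/max_idPl. Qed.

Lemma quad_diff_pos_sq : quad_diff pos_sq (fun u => 2 * pos_part u).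
Proof.
exists 1 => // t h; rewrite mul1r /pos_sq ler_norml.
case: (pos_partP (t + h)) => [[? ->]|[? ->]]; case: (pos_partP t) => [[? ->]|[? ->]];
  by apply/andP; split; nra.
Qed.

(* A C^1 ramp: the positive part with its corner at [0] rounded off on [0, e]. *)
Definition ramp e u : R := (2 * e)^-1 * (pos_sq u + -1 * pos_sq (u - e)).
Definition dramp e u : R := (2 * e)^-1 * (2 * pos_part u + -1 * (2 * pos_part (u - e))).

Lemma quad_diff_ramp e : quad_diff (ramp e) (dramp e).
Proof.
exact: (quad_diffZ (2 * e)^-1 (quad_diffD quad_diff_pos_sq
  (quad_diffZ (-1) (quad_diff_shift (- e) quad_diff_pos_sq)))).
Qed.

Lemma ramp_le0 e u : 0 < e -> u <= 0 -> ramp e u = 0.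
Proof.
move=> e0 u0; rewrite /ramp /pos_sq !pos_part_le0 ?expr0n//=; last lra.
by rewrite mulr0 addr0 mulr0.
Qed.

Lemma ramp_ge e u : 0 < e -> e <= u -> ramp e u = u - e / 2.
Proof.
move=> e0 u0; rewrite /ramp /pos_sq !pos_part_ge0; [|lra..].
by field; rewrite gt_eqF.
Qed.

Lemma ramp_itv e u : 0 < e -> 0 <= ramp e u <= pos_part u.
Proof.
move=> e0; have [u0|u0] := leP u 0.
  by rewrite ramp_le0// lexx /pos_part le_max lexx orbT.
have [ue|ue] := leP e u.
  rewrite ramp_ge//; case: (pos_partP u) => [[? ->]|[? ->]]; first lra.
  by apply/andP; split; lra.
rewrite /ramp /pos_sq; case: (pos_partP u) => [[? ->]|[? ->]]; first lra.
case: (pos_partP (u - e)) => [[? ->]|[? ->]]; last lra.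
rewrite expr0n /= mulr0 addr0; apply/andP; split.
  by rewrite mulr_ge0 ?sqr_ge0// invr_ge0; lra.
by rewrite ler_pdivrMl; [nra|lra].
Qed.

Lemma ramp_step e u : 0 < e -> 0 <= ramp e u - ramp e (u - e) <= e.
Proof.
move=> e0; rewrite /ramp -mulrBr.
rewrite ler_pdivlMl ?ler_pdivrMl ?mulr_gt0// mulr0 /pos_sq.
case: (pos_partP u) => [[? ->]|[? ->]]; case: (pos_partP (u - e)) => [[? ->]|[? ->]];
 case: (pos_partP (u - e - e)) => [[? ->]|[? ->]]; apply/andP; split; nra.
Qed.

Lemma dramp_itv e u : 0 < e -> 0 <= dramp e u <= 1.
Proof.
move=> e0; rewrite /dramp ler_pdivlMl ?ler_pdivrMl ?mulr_gt0//.
by case: (pos_partP u) => [[? ->]|[? ->]]; case: (pos_partP (u - e)) => [[? ->]|[? ->]];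
  apply/andP; split; lra.
Qed.

Lemma dramp_le0 e u : 0 < e -> u <= 0 -> dramp e u = 0.
Proof.
move=> e0 u0; rewrite /dramp !pos_part_le0//; last lra.
by rewrite !mulr0 addr0 mulr0.
Qed.

Lemma dramp_ge e u : 0 < e -> e <= u -> dramp e u = 1.
Proof.
move=> e0 u0; rewrite /dramp !pos_part_ge0; [|lra..].
by field; rewrite gt_eqF.
Qed.

(** A difference quotient of the ramp, hence a [C^1] rise from 0 to 1 over [0, 2e]. The form [-1 *]
    is what [quad_diffZ] produces, so the derivative facts apply without rewriting. *)
Definition step e u : R := e^-1 * (ramp e u + -1 * ramp e (u - e)).
Definition dstep e u : R := e^-1 * (dramp e u + -1 * dramp e (u - e)).

Lemma step_itv e u : 0 < e -> 0 <= step e u <= 1.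
Proof.
move=> e0; rewrite /step mulN1r ler_pdivlMl ?ler_pdivrMl// mulr0 mulr1.
exact: ramp_step.
Qed.

Lemma step_le0 e u : 0 < e -> u <= 0 -> step e u = 0.
Proof. by move=> e0 u0; rewrite /step !ramp_le0//; [ring|lra]. Qed.

Lemma step_ge e u : 0 < e -> 2 * e <= u -> step e u = 1.
Proof. by move=> e0 u0; rewrite /step !ramp_ge//; [field; rewrite gt_eqF|lra|lra]. Qed.

(* C^1 approximations, supported in [0, 1], of the indicator of [0, 1] and of
   the tent function, whose derivative is 1 then -1. *)
Definition bump e t : R := step e t + -1 * step e (t + (2 * e - 1)).
Definition dbump e t : R := dstep e t + -1 * dstep e (t + (2 * e - 1)).
Definition tent e t : R := ramp e t + -1 * ramp e (t - 2^-1) +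
  -1 * ramp e (t + (e - 2^-1)) + ramp e (t + (e - 1)).
Definition dtent e t : R := dramp e t + -1 * dramp e (t - 2^-1) +
  -1 * dramp e (t + (e - 2^-1)) + dramp e (t + (e - 1)).

Lemma quad_diff_bump e : quad_diff (bump e) (dbump e).
Proof.
have qs : quad_diff (step e) (dstep e).
  exact: (quad_diffZ e^-1 (quad_diffD (quad_diff_ramp e)
    (quad_diffZ (-1) (quad_diff_shift (- e) (quad_diff_ramp e))))).
exact: (quad_diffD qs (quad_diffZ (-1) (quad_diff_shift (2 * e - 1) qs))).
Qed.

Lemma quad_diff_tent e : quad_diff (tent e) (dtent e).
Proof.
have qr := quad_diff_ramp e; have qs b := quad_diff_shift b qr.
exact: (quad_diffD (quad_diffD (quad_diffD qr (quad_diffZ (-1) (qs (- 2^-1))))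
  (quad_diffZ (-1) (qs (e - 2^-1)))) (qs (e - 1))).
Qed.

Lemma bump_norm_le1 e t : 0 < e -> `|bump e t| <= 1.
Proof.
move=> e0; have /andP[? ?] := step_itv t e0.
have /andP[? ?] := step_itv (t + (2 * e - 1)) e0.
by rewrite /bump ler_norml; apply/andP; split; lra.
Qed.

Lemma bump_out e t : 0 < e -> ~~ (0 < t < 1) -> 2 * e <= 1 -> bump e t = 0.
Proof.
rewrite negb_and -!leNgt => e0 /orP[t0|t1] e1; rewrite /bump.
  by rewrite !step_le0//; [ring|lra].
by rewrite !step_ge//; [ring|lra|lra].
Qed.

Lemma bump_in e t : 0 < e -> 2 * e <= t -> 2 * e <= 1 - t -> bump e t = 1.
Proof. by move=> e0 h1 h2; rewrite /bump step_ge// step_le0//; [ring|lra]. Qed.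

Lemma tent_out e t : 0 < e -> ~~ (0 < t < 1) -> 2 * e <= 1 -> tent e t = 0.
Proof.
rewrite negb_and -!leNgt => e0 /orP[t0|t1] e1; rewrite /tent.
  by rewrite !ramp_le0//; [ring|lra..].
(* Beyond 1 the four ramps are affine, and their shifts are chosen so that slopes and constants
   cancel exactly. *)
by rewrite !ramp_ge//; [lra..].
Qed.

Lemma tent_norm_le2 e t : 0 < e -> 2 * e <= 1 -> `|tent e t| <= 2.
Proof.
move=> e0 e1; have [/andP[t0 t1]|tout] := boolP (0 < t < 1); last first.
  by rewrite tent_out// normr0.
have aux u : u <= 1 -> 0 <= ramp e u <= 1.
  move=> u1; have /andP[-> /le_trans->//] := ramp_itv u e0.
  by rewrite /pos_part ge_max u1 ler01.
have /andP[? ?] : 0 <= ramp e t <= 1 by apply: aux; lra.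
have /andP[? ?] : 0 <= ramp e (t - 2^-1) <= 1 by apply: aux; lra.
have /andP[? ?] : 0 <= ramp e (t + (e - 2^-1)) <= 1 by apply: aux; lra.
have /andP[? ?] : 0 <= ramp e (t + (e - 1)) <= 1 by apply: aux; lra.
by rewrite /tent ler_norml; apply/andP; split; lra.
Qed.

Lemma dtent_norm_le2 e t : 0 < e -> `|dtent e t| <= 2.
Proof.
move=> e0; have aux u := dramp_itv u e0.
have /andP[? ?] := aux t; have /andP[? ?] := aux (t - 2^-1).
have /andP[? ?] := aux (t + (e - 2^-1)); have /andP[? ?] := aux (t + (e - 1)).
by rewrite /dtent ler_norml; apply/andP; split; lra.
Qed.

Lemma dtent_out e t : 0 < e -> ~~ (0 < t < 1) -> 2 * e <= 1 -> dtent e t = 0.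
Proof.
rewrite negb_and -!leNgt => e0 /orP[t0|t1] e1; rewrite /dtent.
  by rewrite !dramp_le0//; [ring|lra..].
by rewrite !dramp_ge//; [lra..].
Qed.

Lemma dtent_left e t : 0 < e -> e <= t -> e <= 2^-1 - t -> dtent e t = 1.
Proof.
move=> e0 h1 h2; rewrite /dtent dramp_ge// !dramp_le0//; [ring|lra..].
Qed.

Lemma dtent_right e t : 0 < e -> e <= t - 2^-1 -> e <= 1 - t -> dtent e t = -1.
Proof.
move=> e0 h1 h2.
rewrite /dtent (@dramp_ge e t)// ?(@dramp_ge e (t - 2^-1))//; last lra.
rewrite (@dramp_ge e (t + (e - 2^-1)))// ?dramp_le0//; [ring|lra..].
Qed.

(** The two roundings at the apex, over [1/2 - e, 1/2] and [1/2, 1/2 + e], meet at 1/2, so the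
    derivative vanishes there for every [e]. *)
Lemma dtent_mid e : 0 < e -> 2 * e <= 1 -> dtent e 2^-1 = 0.
Proof.
move=> e0 h1; rewrite /dtent subrr (@dramp_le0 e 0)//.
rewrite (@dramp_ge e 2^-1)//; last lra.
rewrite (@dramp_ge e (2^-1 + (e - 2^-1)))//; last lra.
by rewrite dramp_le0//; [ring|lra].
Qed.

End one_variable.

(** * Borel measurability of continuous functions *)

Section continuous_measurable.
Variables (R : realType) (d : nat).
Local Notation rV := 'rV[R]_d.

(** An open set is the union, over all [n], of the half-open cubes it contains with side
    [1 / (n + 1)] and corners in the grid of that step. These cubes are countably many, and those of
    side less than [e] fit in the sup-norm ball of radius [e] around any of their points. *)
Lemma open_rV_measurable (U : set rV) : open U -> measurable U.
Proof.
move=> oU.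
have close (a w u v e : R) : w < e -> a <= u < a + w -> a <= v < a + w -> `|u - v| < e.
  move=> we /andP[? ?] /andP[? ?].
  by rewrite ltr_norml; apply/andP; split; lra.
pose cell (p : nat * {ffun 'I_d -> int}) : set rV :=
  box (fun j => `[(p.2 j)%:~R / p.1.+1%:R, ((p.2 j)%:~R + 1) / p.1.+1%:R[%classic).
have -> : U = \bigcup_p (if `[< cell p `<=` U >] then cell p else set0).
  apply/seteqP; split=> [x Ux|x [p _]]; last by case: ifP => [/asboolP|//]; exact.
  have /nbhs_ballP[e /= e0 eU] := open_nbhs_nbhs (conj oU Ux).
  have [n ne] : exists n, n.+1%:R^-1 < e.
    by have [n _ /(_ _ (leqnn n))] := near_infty_natSinv_lt (PosNum e0); exists n.
  pose z := [ffun j => Num.floor (x ord0 j * n.+1%:R)].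
  have cx : cell (n, z) x.
    move=> j /=; rewrite in_itv/= /z ffunE ler_pdivrMr// ltr_pdivlMr//.
    by rewrite floor_le_tmp//= -[1]/(1%:~R) -intrD lt_succ_floor.
  exists (n, z) => //; rewrite asboolT// => y cy; apply: eU; split=> // i j.
  have -> : i = ord0 by exact: ord1.
  rewrite /ball/=; move: (cx j) (cy j) => /=; rewrite !in_itv/=.
  rewrite mulrDl mul1r.
  by move=> h1 h2; apply: (close _ _ _ _ _ ne h1 h2).
apply: countable_bigcupT_measurable; first exact: countableP.
move=> p; case: ifP => // _; apply: measurable_box => j; exact: measurable_itv.
Qed.

Lemma continuous_rV_measurable (f : rV -> R) : continuous f ->
  measurable_fun [set: rV] (f : rV -> measurableTypeR R).
Proof.
move=> cf; apply: (measurability _ (RGenOpens.measurableE R)).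
move=> _ [_ [a [b ->]] <-]; rewrite setTI; apply: open_rV_measurable.
by move/continuousP : cf; apply; exact: interval_open.
Qed.

End continuous_measurable.

(** * Integration against the completed Lebesgue measure *)

Section lebesgue_integral.
Variables (R : realType) (d : nat).
Local Notation rV := 'rV[R]_d.
Local Notation mu := (@lebesgue R d).
Local Notation T := (caratheodory_type ((@borel_lebesgue R d)^*)%mu).

(** [rV] carries the Borel sigma-algebra; the type [T] is the same space with the completed one,
    over which integrals against [lebesgue] are taken. *)
Definition lmeas_fun (f : rV -> R) := measurable_fun [set: T] (f : T -> measurableTypeR R).

Lemma continuous_lmeas_fun (f : rV -> R) : continuous f -> lmeas_fun f.
Proof.
move=> cf _ Y mY; rewrite setTI; apply: borel_lebesgue_measurable.
by rewrite -[X in measurable X]setTI; exact: continuous_rV_measurable.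
Qed.

Lemma bounded_integrable (f : rV -> R) (B : set rV) (M : R) : fin_meas B ->
  lmeas_fun f -> (forall x, B x -> `|f x| <= M) -> mu.-integrable B (EFin \o f).
Proof.
move=> [mB fB] mf fM; apply: measurable_bounded_integrable => //.
  exact: measurable_funS mf.
exists M; split; first exact: num_real.
by move=> N MN x Bx; exact: le_trans (fM _ Bx) (ltW MN).
Qed.

(** Dominated convergence, used to pass from smooth test fields to a discontinuous limit. The
    constant [M] is integrable because [B] has finite measure. *)
Lemma bounded_limit_integral_le (f_ : nat -> rV -> R) (f : rV -> R) (B : set rV) (M c : R) :
  fin_meas B -> (forall n, lmeas_fun (f_ n)) -> lmeas_fun f ->
  (forall n x, B x -> `|f_ n x| <= M) ->
  (forall x, B x -> f_ ^~ x @ \oo --> f x) ->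
  (forall n, \int[mu]_(x in B) (f_ n x)%:E <= c%:E)%E ->
  (\int[mu]_(x in B) (f x)%:E <= c%:E)%E.
Proof.
move=> fB mf_ mf fM cvf intc.
have mf1 n : measurable_fun (B : set T) (fun x => (f_ n x)%:E).
  by apply/measurable_EFinP; apply: measurable_funS (mf_ n).
have mf2 : measurable_fun (B : set T) (fun x => (f x)%:E).
  by apply/measurable_EFinP; apply: measurable_funS mf.
have cvf1 x : B x -> (fun n => (f_ n x)%:E) @ \oo --> (f x)%:E.
  by move=> Bx; apply: cvg_EFin; [exact: nearW|exact: cvf].
have intM : mu.-integrable B (EFin \o cst M).
  by apply: (@bounded_integrable (cst M) _ `|M|) => //; exact: measurable_cst.
have fM1 x n : B x -> (`|(f_ n x)%:E| <= (M%:E : \bar R))%E.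
  by move=> Bx; rewrite lee_fin; exact: fM.
have [_ _ cv] := @dominated_convergence _ _ _ mu B fB.1 _ _ _ mf1 mf2
  (aeW mu cvf1) intM (aeW mu fM1).
apply: cvge_to_le cv _.
by apply: nearW => n; exact: intc.
Qed.

End lebesgue_integral.

(** * Volumes in the two halves of the boxes of a grid *)

Section overlap.
Variable R : realType.

Lemma sum_indic_eq_le1 (M m : nat) : \sum_(k < M) (val k == m)%:R <= 1 :> R.
Proof.
have [mM|Mm] := ltnP m M.
  rewrite (bigD1 (Ordinal mM))//= eqxx big1 ?addr0// => k.
  by rewrite -val_eqE /= => /negbTE ->.
by rewrite big1// => k _; case: eqP => // km; move: (ltn_ord k); rewrite km ltnNge Mm.
Qed.

(** Every nonzero term sits at the least such index [k1] or at [k1.+1]. *)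
Lemma sum_le_double (M : nat) (F : 'I_M -> R) (C : R) : 0 <= C ->
  (forall k, 0 <= F k <= C) ->
  (forall k k' : 'I_M, F k != 0 -> F k' != 0 -> (k' <= k.+1)%N) ->
  \sum_(k < M) F k <= 2 * C.
Proof.
move=> C0 FC FF; have [[k0 Fk0]|F0] := pselect (exists k0, F k0 != 0); last first.
  rewrite big1 ?mulr_ge0// => k _; apply/eqP; apply/negPn/negP => Fk.
  by apply: F0; exists k.
pose k1 := [arg min_(k < k0 | F k != 0) val k].
have [Fk1 k1min] : F k1 != 0 /\ forall k, F k != 0 -> (k1 <= k)%N.
  by rewrite /k1; case: arg_minnP.
rewrite (@le_trans _ _ (\sum_(k < M) (C * (val k == k1)%:R + C * (val k == k1.+1)%:R)))//.
  apply: ler_sum => k _; have /andP[_ FkC] := FC k.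
  have [->|Fk] := eqVneq (F k) 0; first by rewrite addr_ge0 ?mulr_ge0.
  have := FF _ _ Fk1 Fk; rewrite leq_eqVlt ltnS => /orP[/eqP kk|kk].
    by rewrite [val k]kk eqxx mulr1 ler_wpDl// mulr_ge0.
  have -> : val k == k1 by rewrite eqn_leq kk k1min.
  by rewrite mulr1 ler_wpDr// mulr_ge0.
rewrite big_split/= -!mulr_sumr.
have := sum_indic_eq_le1 M k1; have := sum_indic_eq_le1 M k1.+1; nra.
Qed.

(** The [k]-th term is supported in an interval of length [l <= 2 * h] starting at [c + k h].
    Intervals whose indices differ by 2 or more are disjoint, so at most two terms, each at most 2,
    survive at a given [t]. *)
Lemma overlap_sum_le (M : nat) (g : R -> R) (c h l t : R) : 0 < l -> l <= 2 * h ->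
  (forall t, `|g t| <= 2) -> (forall t, ~~ (0 < t < 1) -> g t = 0) ->
  \sum_(k < M) `|g ((t - (c + k%:R * h)) / l)| <= 4.
Proof.
move=> l0 lh g2 g0; rewrite (_ : 4 = 2 * 2); last by rewrite -natrM.
apply: sum_le_double => // [k|k k' gk gk']; first by rewrite normr_ge0 g2.
have aux (m : nat) : `|g ((t - (c + m%:R * h)) / l)| != 0 ->
    c + m%:R * h < t /\ t < c + m%:R * h + l.
  move=> gm; have : 0 < (t - (c + m%:R * h)) / l < 1.
    by apply: contraNT gm => /g0 ->; rewrite normr0.
  rewrite ltr_pdivrMr// ltr_pdivlMr// mul0r mul1r => /andP[? ?]; split; lra.
have [? ?] := aux _ gk; have [? ?] := aux _ gk'.
rewrite leqNgt; apply/negP => kk.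
have : k.+2%:R <= k'%:R :> R by rewrite ler_nat.
by rewrite -addn2 natrD; nra.
Qed.

(** The shift by 2 gives [2 * mesh n <= 1] for every [n], as required for bumps and tents to vanish
    outside (0, 1). *)
Definition mesh (n : nat) : R := n.+2%:R^-1.

Lemma mesh_gt0 n : 0 < mesh n.
Proof. by rewrite invr_gt0. Qed.

Lemma mesh_le n : 2 * mesh n <= 1.
Proof. by rewrite ler_pdivrMr// mul1r ler_nat. Qed.

Lemma near_mesh (r : R) : 0 < r -> \forall n \near \oo, mesh n <= r.
Proof.
move=> r0; near=> n; have : n.+1%:R^-1 < r.
  by near: n; exact: (near_infty_natSinv_lt (PosNum r0)).
by move/ltW; apply: le_trans; rewrite /mesh lef_pV2 ?posrE// ler_nat.
Unshelve. all: by end_near. Qed.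

Lemma near_bump (t : R) : \forall n \near \oo, bump (mesh n) t = (0 < t < 1)%R%:R.
Proof.
have [/andP[t0 t1]|t01] := boolP (0 < t < 1); last first.
  by near=> n; rewrite bump_out ?mesh_gt0 ?mesh_le.
near=> n; have h1 : mesh n <= t / 2 by near: n; apply: near_mesh; lra.
have h2 : mesh n <= (1 - t) / 2 by near: n; apply: near_mesh; lra.
by rewrite bump_in ?mesh_gt0//; lra.
Unshelve. all: by end_near. Qed.

(** Equality holds eventually at every point, breakpoints included: at 0, 1/2 and 1 the derivative
    of the tent is exactly 0. *)
Lemma near_dtent (t : R) : \forall n \near \oo,
  dtent (mesh n) t = (0 < t < 2^-1)%R%:R - (2^-1 < t < 1)%R%:R.
Proof.
have [t01|t01] := boolP (0 < t < 1); last first.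
  near=> n; rewrite dtent_out ?mesh_gt0 ?mesh_le//.
  case: (boolP (0 < t < 2^-1)) => [/andP[t0 t1]|_].
    by exfalso; move/negP : t01; apply; rewrite t0/=; lra.
  case: (boolP (2^-1 < t < 1)) => [/andP[t0 t1]|_].
    by exfalso; move/negP : t01; apply; rewrite t1 andbT; lra.
  by rewrite subrr.
move/andP : t01 => [t0 t1]; rewrite t0 t1 andbT /=.
have [th|th|->] := ltgtP t 2^-1.
- rewrite subr0; near=> n.
  have h1 : mesh n <= t by near: n; exact: near_mesh.
  have h2 : mesh n <= 2^-1 - t by near: n; apply: near_mesh; rewrite subr_gt0.
  by rewrite dtent_left ?mesh_gt0.
- rewrite sub0r; near=> n.
  have h1 : mesh n <= t - 2^-1 by near: n; apply: near_mesh; rewrite subr_gt0.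
  have h2 : mesh n <= 1 - t by near: n; apply: near_mesh; rewrite subr_gt0.
  by rewrite dtent_right ?mesh_gt0.
- by rewrite subrr; near=> n; rewrite dtent_mid ?mesh_gt0 ?mesh_le.
Unshelve. all: by end_near. Qed.

Lemma indic_box d (I : 'I_d -> set R) (x : 'rV[R]_d) :
  \1_(box I) x = \prod_j \1_(I j) (x ord0 j) :> R.
Proof.
rewrite indicE; have [bx|nbx] := boolP (x \in box I).
  by move/set_mem : bx => bx; rewrite big1// => j _; rewrite indicE mem_set.
have [j nj] : exists j, ~ I j (x ord0 j).
  by apply/existsNP => h; move/negP : nbx; apply; apply/mem_set.
by rewrite (bigD1 j)//= indicE memNset// mul0r.
Qed.

Lemma rV_norm_le d (x : 'rV[R]_d) (b : R) : 0 <= b ->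
  (forall j, `|x ord0 j| <= b) -> `|x| <= b.
Proof.
move=> b0 xb; rewrite -[`|x|]/(mx_norm x) mx_normrE; apply: bigmax_le => // -[i j] _ /=.
by rewrite (ord1 i); exact: xb.
Qed.

End overlap.

Section indic_integral.
Variables (R : realType) (d : nat) (B : set 'rV[R]_d).
Local Notation rV := 'rV[R]_d.
Local Notation mu := (@lebesgue R d).
Local Notation T := (caratheodory_type ((@borel_lebesgue R d)^*)%mu).
Hypothesis fB : fin_meas B.

Lemma indic_lmeas_fun (A : set rV) : lebesgue_measurable A -> lmeas_fun (\1_A).
Proof. by move=> mA; exact: (@measurable_indic _ T R setT A mA). Qed.

Lemma integral_indic_volume (A : set rV) : lebesgue_measurable A ->
  (\int[mu]_(x in B) (\1_A x)%:E = (volume (B `&` A))%:E)%E.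
Proof.
move=> mA; rewrite setIC -volumeE; first exact: (@integral_indic _ T R mu B fB.1 A mA).
by rewrite setIC; exact: fin_measI.
Qed.

Lemma integrable_indic_fin (A : set rV) : lebesgue_measurable A ->
  mu.-integrable B (EFin \o \1_A).
Proof.
move=> mA; apply: (@bounded_integrable _ _ _ _ 1) => //; first exact: indic_lmeas_fun.
by move=> x _; rewrite indicE; case: (_ \in _); rewrite ?normr1 ?normr0.
Qed.

Lemma integral_sum_indicB (I : finType) (b : I -> R) (L Q : I -> set rV) :
  (forall k, lebesgue_measurable (L k)) -> (forall k, lebesgue_measurable (Q k)) ->
  (\int[mu]_(x in B) (\sum_k b k * (\1_(L k) x - \1_(Q k) x))%:E =
  (\sum_k b k * (volume (B `&` L k) - volume (B `&` Q k)))%:E)%E.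
Proof.
move=> mL mQ; have mB := fB.1.
have iLQ k : mu.-integrable B (fun x => (\1_(L k) x)%:E - (\1_(Q k) x)%:E)%E.
  by apply: integrableB => //; exact: integrable_indic_fin.
under eq_integral do rewrite -sumEFin.
rewrite (@integral_sum _ T R mu B mB _ (fun k x => (b k * (\1_(L k) x - \1_(Q k) x))%:E)).
  rewrite -sumEFin; apply: eq_bigr => k _.
  under eq_integral do rewrite EFinM EFinB.
  rewrite integralZl//; rewrite integralB_EFin//; [|exact: integrable_indic_fin..].
  by rewrite EFinM EFinB !integral_indic_volume.
move=> k; under [X in integrable _ _ X]eq_fun do rewrite EFinM EFinB.
exact: integrableZl.
Qed.

Lemma sum_indicB_lmeas_fun (I : finType) (b : I -> R) (L Q : I -> set rV) :
  (forall k, lebesgue_measurable (L k)) -> (forall k, lebesgue_measurable (Q k)) ->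
  lmeas_fun (fun x => \sum_k b k * (\1_(L k) x - \1_(Q k) x)).
Proof.
move=> mL mQ; apply: (@measurable_sum _ T R setT _ _ (fun k (x : T) => b k * (\1_(L k) x - \1_(Q k) x))) => k.
by apply: measurable_funM => //; apply: measurable_funB; exact: indic_lmeas_fun.
Qed.

End indic_integral.

Section grid_estimate.
Variables (R : realType) (d : nat) (B : set 'rV[R]_d) (P : R).
Local Notation rV := 'rV[R]_d.
Local Notation mu := (@lebesgue R d).
Hypothesis fB : fin_meas B.
Hypothesis PB : (perimeter B <= P%:E)%E.

Lemma perimeter_test (w : rV -> R) i (b : R) : C1_fun w ->
  (forall x : rV, b < `|x| -> w x = 0) -> (forall x, `|w x| <= 1) ->
  (\int[mu]_(x in B) ('D_(basis_vec R i) w x)%:E <= P%:E)%E.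
Proof.
move=> Cw w0 w1; apply: le_trans PB; apply: ereal_sup_ubound.
exists (fun x => w x *: basis_vec R i).
  split; first exact: C1c_scale_basis w0.
  by move=> x; rewrite eucl_norm_scale_basis.
rewrite [RHS]integral_mkcond; apply: eq_integral => x _.
rewrite divergence_scale_basis// /patch indicE.
by case: (x \in B); rewrite ?mul1r ?mul0r.
Qed.

Variables (M : nat) (h : R) (c l : 'I_d -> R) (i : 'I_d).
Hypothesis l_gt0 : forall j, 0 < l j.
Hypothesis l_le : forall j, l j <= 2 * h.
Local Notation idx := {ffun 'I_d -> 'I_M}.

(** The corners form a grid of step [h], but the side lengths [l j] are free up to [2 * h], so the
    boxes may leave gaps or overlap. *)
Definition grid_lo (k : idx) j := c j + (k j)%:R * h.
Definition left_box (k : idx) : set rV := box (fun j =>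
  if j == i then `]grid_lo k j, (grid_lo k j + l j / 2)[%classic
  else `]grid_lo k j, (grid_lo k j + l j)[%classic).
Definition right_box (k : idx) : set rV := box (fun j =>
  if j == i then `](grid_lo k j + l j / 2), (grid_lo k j + l j)[%classic
  else `]grid_lo k j, (grid_lo k j + l j)[%classic).

Let factor (e : R) (k : idx) j (t : R) : R :=
  (if j == i then tent e else bump e) ((t - grid_lo k j) / l j).
Let dfactor (e : R) (k : idx) j (t : R) : R :=
  (if j == i then dtent e else dbump e) ((t - grid_lo k j) / l j) / l j.

Let dfactorP e k j : quad_diff (factor e k j) (dfactor e k j).
Proof.
have E t : (t - grid_lo k j) / l j = (l j)^-1 * t + - (grid_lo k j / l j) by ring.
rewrite /factor /dfactor.
under [X in quad_diff X _]eq_fun do rewrite E.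
under [X in quad_diff _ X]eq_fun do rewrite E mulrC.
apply: quad_diff_affine.
by case: (j == i); [exact: quad_diff_tent|exact: quad_diff_bump].
Qed.

(* In the limit [e -> 0], the derivative of this test field along the [i]-th axis is
   [a k / l i] on the left half of the box [k] and [- a k / l i] on its right half. *)
Let field (a : idx -> R) e (x : rV) : R :=
  \sum_k a k * \prod_j factor e k j (x ord0 j).

Let C1_factor e k j : C1_fun (fun x : rV => factor e k j (x ord0 j)).
Proof.
apply: C1_coord; first by move=> t; exact: quad_diff_is_derive.
exact: quad_diff_continuous (dfactorP e k j).
Qed.

Let C1_field a e : C1_fun (field a e).
Proof.
apply: C1_sum => k _; apply: C1_mul; first exact: C1_cst.
by apply: C1_prod => j _; exact: C1_factor.
Qed.

Let dfield a e x : 'D_(basis_vec R i) (field a e) x =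
  \sum_k a k * (dfactor e k i (x ord0 i) * \prod_(j | j != i) factor e k j (x ord0 j)).
Proof.
rewrite derive_sum_seq; last first.
  move=> k _; apply: C1_mul; first exact: C1_cst.
  by apply: C1_prod => j _; exact: C1_factor.
apply: eq_bigr => k _.
have Cp (Q : pred 'I_d) : C1_fun (fun x : rV => \prod_(j | Q j) factor e k j (x ord0 j)).
  by apply: C1_prod => j _; exact: C1_factor.
rewrite (deriveM (f := cst (a k)) (C1_derivable (C1_cst d (a k))) (C1_derivable (Cp xpredT))).
rewrite derive_cst scaler0 addr0; congr (_ * _); under eq_fun do rewrite (bigD1 i)//=.
rewrite deriveM; [|exact/C1_derivable/C1_factor|exact/C1_derivable/Cp].
rewrite derive_prod_eq0; first last.
- by move=> j ji; rewrite (derive_coord _ (fun t => quad_diff_is_derive t (dfactorP e k j)))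
    (negbTE ji) mul0r.
- by move=> j _; exact: C1_factor.
rewrite scaler0 add0r (derive_coord _ (fun t => quad_diff_is_derive t (dfactorP e k i))).
by rewrite eqxx mul1r [RHS]mulrC.
Qed.

Let field_le a e x : 0 < e -> 2 * e <= 1 -> (forall k, `|a k| <= (4 ^+ d)^-1) ->
  `|field a e x| <= 1.
Proof.
move=> e0 e1 a1; rewrite /field (le_trans (ler_norm_sum _ _ _))//.
rewrite (@le_trans _ _ (\sum_(k : idx) (4 ^+ d)^-1 * \prod_j `|factor e k j (x ord0 j)|))//.
  apply: ler_sum => k _; rewrite normrM normr_prod ler_wpM2r//.
  by apply: prodr_ge0.
rewrite -mulr_sumr ler_pdivrMl ?exprn_gt0// mulr1.
pose F j (m : 'I_M) := `|(if j == i then tent e else bump e)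
  ((x ord0 j - (c j + (m : nat)%:R * h)) / l j)|.
(* A sum over all multi-indices of a product over coordinates is the product of the one-dimensional
   sums, each at most 4 by the overlap count. This is the origin of [4 ^+ d]. *)
rewrite -(bigA_distr_bigA F) -[leRHS](_ : \prod_(j < d) 4 = _); last first.
  by rewrite prodr_const card_ord.
apply: ler_prod => j _; apply/andP; split.
  by apply: sumr_ge0 => m _; exact: normr_ge0.
rewrite /F; apply: (@overlap_sum_le R M (if j == i then tent e else bump e)) => // t.
  case: (j == i); first exact: tent_norm_le2.
  by rewrite (le_trans (bump_norm_le1 _ _))// ler1n.
by case: (j == i) => t01; [rewrite tent_out|rewrite bump_out].
Qed.

Let field_out a e (x : rV) : 0 < e -> 2 * e <= 1 ->
  \sum_j (`|c j| + M%:R * h + l j) < `|x| -> field a e x = 0.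
Proof.
move=> e0 e1 xb; rewrite /field big1// => k _.
suff [j fj0] : exists j, factor e k j (x ord0 j) = 0.
  by rewrite (bigD1 j)//= fj0 mul0r mulr0.
apply: contrapT => /forallNP fn0; move: xb; apply/negP; rewrite -leNgt.
have h0 : 0 <= h by have := l_gt0 i; have := l_le i; lra.
have pos j : 0 <= `|c j| + M%:R * h + l j.
  by rewrite !addr_ge0// ?mulr_ge0// ltW.
apply: rV_norm_le => [|j]; first exact: sumr_ge0.
rewrite (bigD1 j)//=; apply: ler_wpDr; first exact: sumr_ge0.
have : 0 < (x ord0 j - grid_lo k j) / l j < 1.
  apply: contrapT => /negP t01; apply: (fn0 j); rewrite /factor.
  by case: (j == i); [rewrite tent_out|rewrite bump_out].
rewrite ltr_pdivrMr// ltr_pdivlMr// mul0r mul1r /grid_lo => /andP[x1 x2].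
have k1 : 0 <= (k j)%:R * h by rewrite mulr_ge0.
have k2 : (k j)%:R * h <= M%:R * h by rewrite ler_wpM2r// ler_nat ltnW.
have := ler_norm (c j); have := ler_norm (- c j); rewrite normrN => c1 c2.
by rewrite ler_norml; apply/andP; split; lra.
Qed.

(** A crude bound whose merit is to be uniform in [e] and [x]: it is the dominating constant of the
    limit [e -> 0]. *)
Let dfield_le a e x : 0 < e -> (forall k, `|a k| <= (4 ^+ d)^-1) ->
  `|'D_(basis_vec R i) (field a e) x| <= \sum_(k : idx) 2 / l i.
Proof.
move=> e0 a1; rewrite dfield (le_trans (ler_norm_sum _ _ _))//.
apply: ler_sum => k _; rewrite !normrM normr_prod -[leRHS]mul1r.
apply: ler_pM => //.
  by rewrite mulr_ge0// prodr_ge0.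
  rewrite (le_trans (a1 k))// invf_le1 ?exprn_gt0//.
  by rewrite exprn_ege1// ler1n.
rewrite -[leRHS]mulr1; apply: ler_pM => //; first exact: prodr_ge0.
  rewrite eqxx normfV (gtr0_norm (l_gt0 i)) ler_wpM2r ?invr_ge0 ?(ltW (l_gt0 i))//.
  exact: dtent_norm_le2.
rewrite -[leRHS](_ : \prod_(j | j != i) 1 = _ :> R); last by rewrite big1.
apply: ler_prod => j ji; rewrite normr_ge0/= /factor (negbTE ji).
exact: bump_norm_le1.
Qed.

Let dfield_cvg a x : (fun n => 'D_(basis_vec R i) (field a (mesh R n)) x) @ \oo -->
  \sum_k a k / l i * (\1_(left_box k) x - \1_(right_box k) x).
Proof.
apply: cvg_near_cst.
have nb : \forall n \near \oo, forall (k : idx) j,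
    bump (mesh R n) ((x ord0 j - grid_lo k j) / l j) =
    (0 < (x ord0 j - grid_lo k j) / l j < 1)%R%:R.
  by apply: filter_forall => k; apply: filter_forall => j; exact: near_bump.
have nt : \forall n \near \oo, forall k : idx,
    let s := (x ord0 i - grid_lo k i) / l i in
    dtent (mesh R n) s = (0 < s < 2^-1)%R%:R - (2^-1 < s < 1)%R%:R.
  by apply: filter_forall => k; exact: near_dtent.
near=> n; rewrite dfield; apply: eq_bigr => k _.
rewrite -mulrA; congr (_ * _).
rewrite /dfactor eqxx (near nt n _ k)// [_ / l i]mulrC -mulrA; congr (_ * _).
pose rest := \prod_(j | j != i) \1_(`]grid_lo k j, (grid_lo k j + l j)[%classic) (x ord0 j) : R.
have -> : \1_(left_box k) x =
    \1_(`]grid_lo k i, (grid_lo k i + l i / 2)[%classic) (x ord0 i) * rest.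
  rewrite indic_box (bigD1 i)//= eqxx; congr (_ * _).
  by apply: eq_bigr => j /negbTE ->.
have -> : \1_(right_box k) x =
    \1_(`](grid_lo k i + l i / 2), (grid_lo k i + l i)[%classic) (x ord0 i) * rest.
  rewrite indic_box (bigD1 i)//= eqxx; congr (_ * _).
  by apply: eq_bigr => j /negbTE ->.
have -> : \prod_(j | j != i) factor (mesh R n) k j (x ord0 j) = rest.
  apply: eq_bigr => j ji; rewrite /factor (negbTE ji) (near nb n _ k j)//.
  rewrite indicE; congr (nat_of_bool _)%:R; apply/idP/idP;
    by rewrite inE/= in_itv/= ltr_pdivrMr// ltr_pdivlMr// => /andP[? ?]; apply/andP; split; lra.
rewrite -mulrBl; congr (_ * _); rewrite !indicE; congr (_%:R - _%:R); congr nat_of_bool.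
- apply/idP/idP; rewrite inE/= in_itv/= ltr_pdivrMr// ltr_pdivlMr// => /andP[? ?]; apply/andP; split; lra.
- apply/idP/idP; rewrite inE/= in_itv/= ltr_pdivrMr// ltr_pdivlMr// => /andP[? ?]; apply/andP; split; lra.
Unshelve. all: by end_near. Qed.

Lemma left_box_lmeas k : lebesgue_measurable (left_box k).
Proof.
apply: borel_lebesgue_measurable; apply: measurable_box => j.
by case: ifP => _; exact: measurable_itv.
Qed.

Lemma right_box_lmeas k : lebesgue_measurable (right_box k).
Proof.
apply: borel_lebesgue_measurable; apply: measurable_box => j.
by case: ifP => _; exact: measurable_itv.
Qed.

(** The coefficients are the signs of the differences, scaled by [4^(-d)] to keep the field of norm
    at most 1. In the limit, testing the perimeter gives the sum of [|D k| / (4^d l_i)] as a lower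
    bound for [P]. *)
Lemma grid_estimate :
  \sum_(k : idx) `|volume (B `&` left_box k) - volume (B `&` right_box k)| <=
  4 ^+ d * l i * P.
Proof.
pose D k := volume (B `&` left_box k) - volume (B `&` right_box k).
pose a (k : idx) := (4 ^+ d)^-1 * Num.sg (D k).
have a1 k : `|a k| <= (4 ^+ d)^-1.
  rewrite normrM normfV normrX (ger0_norm (ler0n _ _)) ler_piMr ?invr_ge0 ?exprn_ge0//.
  by rewrite normr_sg; case: (_ != _).
have : (\int[mu]_(x in B)
    (\sum_k a k / l i * (\1_(left_box k) x - \1_(right_box k) x))%:E <= P%:E)%E.
  apply: (bounded_limit_integral_le
    (f_ := fun n => 'D_(basis_vec R i) (field a (mesh R n))) (M := \sum_(k : idx) 2 / l i) fB).
  - by move=> n; apply: continuous_lmeas_fun; exact: (C1_field _ _).2.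
  - by apply: sum_indicB_lmeas_fun => k; [exact: left_box_lmeas|exact: right_box_lmeas].
  - by move=> n x _; apply: dfield_le => //; exact: mesh_gt0.
  - by move=> x _; exact: dfield_cvg.
  - move=> n; apply: (@perimeter_test _ _ (\sum_j (`|c j| + M%:R * h + l j))) => //.
      by move=> x xb; apply: field_out xb; [exact: mesh_gt0|exact: mesh_le].
    by move=> x; apply: field_le => //; [exact: mesh_gt0|exact: mesh_le].
rewrite integral_sum_indicB//; [|exact: left_box_lmeas|exact: right_box_lmeas].
rewrite lee_fin -(@ler_pM2l _ (4 ^+ d * l i)) ?mulr_gt0 ?exprn_gt0//.
apply: le_trans; rewrite mulr_sumr; apply: ler_sum => k _.
rewrite /a -/(D k) normrEsg le_eqVlt; apply/orP; left; apply/eqP.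
have l0 : l i != 0 by rewrite gt_eqF.
have d0 : 4 ^+ d != 0 :> R by rewrite expf_neq0.
by field; rewrite d0 l0.
Qed.

End grid_estimate.

(** * Closed and open boxes, equal up to null sets *)

Section closed_open_boxes.
Variables (R : realType) (d : nat).
Local Notation rV := 'rV[R]_d.
Implicit Types (a b : 'I_d -> R) (A B : set rV).

Definition cbox a b : set rV := box (fun j => `[a j, b j]%classic).
Definition obox a b : set rV := box (fun j => `]a j, b j[%classic).

Lemma cboxP a b (x : rV) : cbox a b x <-> forall j, a j <= x ord0 j <= b j.
Proof. by split=> h j; have := h j; rewrite /= in_itv. Qed.

Lemma oboxP a b (x : rV) : obox a b x <-> forall j, a j < x ord0 j < b j.
Proof. by split=> h j; have := h j; rewrite /= in_itv. Qed.

Lemma obox_sub a b : obox a b `<=` cbox a b.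
Proof. by move=> x /oboxP h; apply/cboxP => j; have /andP[/ltW-> /ltW->] := h j. Qed.

Lemma lmeas_cbox a b : lebesgue_measurable (cbox a b).
Proof.
by apply: borel_lebesgue_measurable; apply: measurable_box => j; exact: measurable_itv.
Qed.

Lemma lmeas_obox a b : lebesgue_measurable (obox a b).
Proof.
by apply: borel_lebesgue_measurable; apply: measurable_box => j; exact: measurable_itv.
Qed.

Lemma fin_meas_cbox a b : (forall j, a j <= b j) -> fin_meas (cbox a b).
Proof.
by move=> ab; split; [exact: lmeas_cbox|rewrite /cbox lebesgue_box_itv// ltry].
Qed.

Lemma volume_cbox a b : (forall j, a j <= b j) -> volume (cbox a b) = \prod_j (b j - a j).
Proof. by move=> ab; rewrite /volume /cbox lebesgue_box_itv. Qed.

Lemma volume_obox a b : (forall j, a j <= b j) -> volume (obox a b) = \prod_j (b j - a j).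
Proof. by move=> ab; rewrite /volume /obox lebesgue_box_itv. Qed.

Lemma volume_bnd_box a b : (forall j, a j <= b j) -> volume (cbox a b `\` obox a b) = 0.
Proof.
move=> ab; have := volume_split (fin_meas_cbox ab) (lmeas_obox a b).
rewrite setIidr; last exact: obox_sub.
by rewrite volume_cbox// volume_obox//; lra.
Qed.

Lemma volumeI_box a b B : fin_meas B -> (forall j, a j <= b j) ->
  volume (B `&` obox a b) = volume (B `&` cbox a b).
Proof.
move=> fB ab; apply: (@volume_eq _ _ _ _ (cbox a b `\` obox a b)).
- by apply: fin_measI => //; exact: lmeas_obox.
- by apply: fin_measI => //; exact: lmeas_cbox.
- by apply: fin_measD; [exact: fin_meas_cbox|exact: lmeas_obox].
- exact: volume_bnd_box.
- by move=> x [Bx /obox_sub cx]; left.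
- move=> x [Bx cx]; have [ox|nox] := pselect (obox a b x); first by left.
  by right.
Qed.

Lemma volumeU_null A B : fin_meas A -> fin_meas B -> volume (A `&` B) = 0 ->
  volume (A `|` B) = volume A + volume B.
Proof.
move=> fA fB AB0; rewrite (volume_split (fin_measU fA fB) fA.1); congr (_ + _).
  by congr volume; apply/seteqP; split=> [x []//|x Ax]; split=> //; left.
rewrite (volume_split fB fA.1) setIC AB0 add0r; congr volume.
by apply/seteqP; split=> [x [[]//]|x [Bx nAx]]; split=> //; right.
Qed.

Definition upd a (i : 'I_d) (m : R) : 'I_d -> R := fun j => if j == i then m else a j.

(** The two closed parts share only the section at [m], contained in a box with one side of length
    0. *)
Lemma volume_cbox_split a b i m B : fin_meas B -> (forall j, a j <= b j) -> a i <= m <= b i ->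
  volume (B `&` cbox a b) =
  volume (B `&` cbox a (upd b i m)) + volume (B `&` cbox (upd a i m) b).
Proof.
move=> fB ab /andP[am mb]; have -> : B `&` cbox a b =
    (B `&` cbox a (upd b i m)) `|` (B `&` cbox (upd a i m) b).
  rewrite -setIUr; congr (_ `&` _); apply/seteqP; split=> x.
    move=> /cboxP h; have [xm|mx] := leP (x ord0 i) m; [left|right];
      apply/cboxP => j; rewrite /upd; have := h j; case: eqP => // -> /andP[h1 h2];
      by rewrite ?xm ?h1 ?h2 ?(ltW mx).
  by case=> /cboxP h; apply/cboxP => j; have := h j; rewrite /upd; case: eqP => [->|//] /andP[h1 h2];
    rewrite ?h1 ?h2 ?(le_trans am h1) ?(le_trans h2 mb).
apply: volumeU_null; do ?by apply: fin_measI => //; exact: lmeas_cbox.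
apply/eqP; rewrite eq_le volume_ge0 andbT.
have ab' j : upd a i m j <= upd b i m j by rewrite /upd; case: eqP.
rewrite (_ : 0 = volume (cbox (upd a i m) (upd b i m))).
  apply: volume_le; last exact: fin_meas_cbox.
    by apply: lmeasI; apply: lmeasI; do ?[exact: fB.1|exact: lmeas_cbox].
  move=> x [[_ /cboxP h1] [_ /cboxP h2]]; apply/cboxP => j.
  by have /andP[-> _] := h2 j; have /andP[_ ->] := h1 j.
by rewrite volume_cbox// (bigD1 i)//= /upd eqxx subrr mul0r.
Qed.

End closed_open_boxes.

(** * Dyadic cubes and figures *)

Section dyadic.
Variables (R : realType) (d : nat).
Local Notation rV := 'rV[R]_d.
Local Notation index n := {ffun 'I_d -> 'I_(2 ^ n)}.

Definition dcube n (k : index n) : set rV := cube (DyadicCube k).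
Definition ocube n (k : index n) : set rV :=
  obox (fun j => (k j)%:R / 2 ^+ n) (fun j => (k j).+1%:R / 2 ^+ n).

Lemma dcubeE n (k : index n) :
  dcube k = cbox (fun j => (k j)%:R / 2 ^+ n) (fun j => (k j).+1%:R / 2 ^+ n).
Proof. by apply/seteqP; split=> x; [move=> h; apply/cboxP|move/cboxP]. Qed.

Lemma dyadic_le (m n : nat) : m%:R / 2 ^+ n <= m.+1%:R / 2 ^+ n :> R.
Proof. by rewrite ler_wpM2r ?invr_ge0 ?exprn_ge0// ler_nat. Qed.

Lemma lmeas_dcube n (k : index n) : lebesgue_measurable (dcube k).
Proof. by rewrite dcubeE; exact: lmeas_cbox. Qed.

Lemma lmeas_ocube n (k : index n) : lebesgue_measurable (ocube k).
Proof. exact: lmeas_obox. Qed.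

Lemma fin_meas_dcube n (k : index n) : fin_meas (dcube k).
Proof. by rewrite dcubeE; apply: fin_meas_cbox => j; exact: dyadic_le. Qed.

Lemma volume_dcube n (k : index n) : volume (dcube k) = (2 ^+ n)^-1 ^+ d.
Proof.
rewrite dcubeE volume_cbox; last by move=> j; exact: dyadic_le.
rewrite (eq_bigr (fun=> (2 ^+ n)^-1)) ?prodr_const ?card_ord// => j _.
by rewrite -mulrBl -natrB// subSnn mul1r.
Qed.

Lemma vol_dcube n (k : index n) : vol R (DyadicCube k) = (2 ^+ n)^-1 ^+ d.
Proof. exact: volume_dcube. Qed.

Lemma volumeI_ocube n (k : index n) B : fin_meas B ->
  volume (B `&` ocube k) = volume (B `&` dcube k).
Proof. by move=> fB; rewrite dcubeE; apply: volumeI_box => // j; exact: dyadic_le. Qed.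

Lemma ocube_disjoint n (k k' : index n) : k != k' -> ocube k `&` ocube k' = set0.
Proof.
move=> kk; apply/seteqP; split=> // x [/oboxP h /oboxP h'] /=.
move/eqP : kk; apply; apply/ffunP => j; apply/val_inj/eqP; rewrite eqn_leq.
have p0 : 0 < 2 ^+ n :> R by rewrite exprn_gt0.
have /andP[h1 h2] := h j; have /andP[h3 h4] := h' j.
have := lt_trans h1 h4; have := lt_trans h3 h2.
by rewrite !ltr_pM2r ?invr_gt0// !ltr_nat !ltnS => -> ->.
Qed.

Lemma unit_cubeE : @unit_cube R d = cbox (fun=> 0) (fun=> 1).
Proof. by apply/seteqP; split=> x; [move=> h; apply/cboxP|move/cboxP]. Qed.

Lemma fin_meas_unit_cube : fin_meas (@unit_cube R d).
Proof. by rewrite unit_cubeE; exact: fin_meas_cbox. Qed.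

Lemma volume_unit_cube : volume (@unit_cube R d) = 1.
Proof. by rewrite unit_cubeE volume_cbox// big1// => j _; rewrite subr0. Qed.

Lemma dcube_sub_unit n (k : index n) : dcube k `<=` @unit_cube R d.
Proof.
move=> x kx j; have /andP[h1 h2] := kx j.
rewrite (le_trans _ h1) ?divr_ge0 ?exprn_ge0//= (le_trans h2)//.
by rewrite ler_pdivrMr ?exprn_gt0// mul1r -natrX ler_nat; exact: ltn_ord.
Qed.

Lemma card_index n : #|{: index n}| = ((2 ^ n) ^ d)%N.
Proof. by rewrite card_ffun !card_ord. Qed.

Lemma exp2n_neq0 n : 2 ^+ n != 0 :> R.
Proof. by rewrite expf_neq0. Qed.

(** By counting: the [2^(n d)] open cells are disjoint, lie in the unit cube and have volume
    [2^(-n d)] each, so they exhaust its volume 1. *)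
Lemma volume_cover_cells n A : fin_meas A -> A `<=` @unit_cube R d ->
  volume (A `\` \big[setU/set0]_(k : index n) ocube k) = 0.
Proof.
move=> fA AU; apply/eqP; rewrite eq_le volume_ge0 andbT.
have mU : lebesgue_measurable (\big[setU/set0]_(k : index n) ocube k).
  by apply: lmeas_bigU => k _; exact: lmeas_ocube.
have := volume_split fin_meas_unit_cube mU.
rewrite volume_bigU; [|exact: fin_meas_unit_cube|exact: lmeas_ocube|exact: ocube_disjoint].
rewrite (eq_bigr (fun=> (2 ^+ n)^-1 ^+ d)); last first.
  move=> k _; rewrite volumeI_ocube; last exact: fin_meas_unit_cube.
  by rewrite setIidr ?volume_dcube//; exact: dcube_sub_unit.
have E : (2 ^+ n)^-1 ^+ d *+ ((2 ^ n) ^ d) = 1 :> R.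
  by rewrite -[LHS]mulr_natr !natrX -exprMn mulVf ?exp2n_neq0// expr1n.
rewrite sumr_const card_index volume_unit_cube [X in _ = X + _]E => /eqP.
rewrite addrC -subr_eq subrr => /eqP ->.
apply: volume_le; first by apply: lmeasD => //; exact: fA.1.
  by move=> x [/AU].
by apply: fin_measD => //; exact: fin_meas_unit_cube.
Qed.

Lemma sum_volume_cells n A : fin_meas A -> A `<=` @unit_cube R d ->
  \sum_(k : index n) volume (A `&` dcube k) = volume A.
Proof.
move=> fA AU; have mU : lebesgue_measurable (\big[setU/set0]_(k : index n) ocube k).
  by apply: lmeas_bigU => k _; exact: lmeas_ocube.
rewrite (volume_split fA mU) volume_cover_cells// addr0 volume_bigU//; last 2 first.
- exact: lmeas_ocube.
- exact: ocube_disjoint.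
by apply: eq_bigr => k _; rewrite volumeI_ocube.
Qed.

Definition figure n (S : pred (index n)) : set rV := \big[setU/set0]_(k | S k) dcube k.

Lemma figureP n (S : pred (index n)) x : figure S x <-> exists2 k, S k & dcube k x.
Proof.
rewrite /figure -bigcup_seq_cond; split=> [[k /= /andP[_ Sk] kx]|[k Sk kx]].
  by exists k.
by exists k => //=; rewrite mem_index_enum.
Qed.

Lemma lmeas_figure n (S : pred (index n)) : lebesgue_measurable (figure S).
Proof. by apply: lmeas_bigU => k _; exact: lmeas_dcube. Qed.

Lemma figure_sub_unit n (S : pred (index n)) : figure S `<=` @unit_cube R d.
Proof. by move=> x /figureP[k _]; exact: dcube_sub_unit. Qed.

Lemma fin_meas_figure n (S : pred (index n)) : fin_meas (figure S).
Proof.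
by apply: fin_measS fin_meas_unit_cube; [exact: lmeas_figure|exact: figure_sub_unit].
Qed.

(** An open cell meets a closed cube of the same generation only when the indices agree. Restricting
    to open cells thus removes the overlaps of closed cubes. *)
Lemma figureI_ocube n (S : pred (index n)) k : figure S `&` ocube k =
  if S k then ocube k else set0.
Proof.
apply/seteqP; split=> x; last first.
  case: ifP => // Sk kx; split=> //; apply/figureP; exists k => //.
  by rewrite dcubeE; exact: obox_sub.
move=> [/figureP[k' Sk' kx'] /oboxP kx].
suff kk : k = k' by rewrite kk Sk' -kk; exact/oboxP.
apply/ffunP => j; apply/val_inj/eqP; rewrite eqn_leq.
have p0 : 0 < 2 ^+ n :> R by rewrite exprn_gt0.
have /andP[h1 h2] := kx j; have /andP[h3 h4] := kx' j.
have := lt_le_trans h1 h4; have := le_lt_trans h3 h2.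
by rewrite !ltr_pM2r ?invr_gt0// !ltr_nat !ltnS => -> ->.
Qed.

Lemma volumeI_figure n (S : pred (index n)) k A : fin_meas A ->
  volume (A `&` figure S `&` dcube k) = if S k then volume (A `&` dcube k) else 0.
Proof.
move=> fA; rewrite -volumeI_ocube; last by apply: fin_measI => //; exact: lmeas_figure.
rewrite -setIA figureI_ocube; case: ifP => _; first exact: volumeI_ocube.
by rewrite setI0 volume0.
Qed.

End dyadic.

(** * Children of dyadic cubes and oscillation of averages *)

Section refinement.
Variables (R : realType) (d : nat).
Local Notation rV := 'rV[R]_d.
Local Notation index n := {ffun 'I_d -> 'I_(2 ^ n)}.
Local Notation side n := ((2 ^+ n)^-1 : R).

Lemma child_subproof n (k : 'I_(2 ^ n)) (a : bool) : (k.*2 + a < 2 ^ n.+1)%N.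
Proof. by have := ltn_ord k; rewrite expnS; case: a; lia. Qed.

Definition child n (k : index n) (a : {ffun 'I_d -> bool}) : index n.+1 :=
  [ffun j => Ordinal (child_subproof (k j) (a j))].

Lemma parent_subproof n (l : 'I_(2 ^ n.+1)) : (l./2 < 2 ^ n)%N.
Proof. by case: l => l /=; rewrite expnS; lia. Qed.

Definition parent n (l : index n.+1) : index n := [ffun j => Ordinal (parent_subproof (l j))].
Definition parity n (l : index n.+1) : {ffun 'I_d -> bool} := [ffun j => odd (l j)].

Lemma childK n (k : index n) a : parent (child k a) = k.
Proof. by apply/ffunP => j; apply/val_inj; rewrite !ffunE /=; case: (a j); lia. Qed.

Lemma child_parity n (k : index n) a : parity (child k a) = a.
Proof. by apply/ffunP => j; rewrite !ffunE /= oddD odd_double; case: (a j). Qed.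

Lemma parentK n (l : index n.+1) : child (parent l) (parity l) = l.
Proof. by apply/ffunP => j; apply/val_inj; rewrite !ffunE /= addnC odd_double_half. Qed.

Lemma sum_children n (k : index n) (F : index n.+1 -> R) :
  \sum_(l | parent l == k) F l = \sum_a F (child k a).
Proof.
rewrite (reindex_onto (child k) (@parity n)) => [|l /eqP <-]; last exact: parentK.
by apply: eq_bigl => a; rewrite childK child_parity !eqxx.
Qed.

Lemma sum_refine n (F : index n.+1 -> R) :
  \sum_l F l = \sum_(k : index n) \sum_a F (child k a).
Proof.
rewrite (partition_big (@parent n) xpredT)//=.
by apply: eq_bigr => k _; rewrite sum_children.
Qed.

Lemma sideS n : side n.+1 = side n / 2.
Proof. by rewrite exprS invfM mulrC. Qed.

Lemma side_gt0 n : 0 < side n.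
Proof. by rewrite invr_gt0 exprn_gt0. Qed.

Lemma child_lo n (k : index n) a j :
  (child k a j)%:R / 2 ^+ n.+1 = (k j)%:R / 2 ^+ n + (a j)%:R * (side n / 2) :> R.
Proof.
have := exp2n_neq0 R n.
rewrite ffunE /= natrD -muln2 natrM exprS; set x := 2 ^+ n => x0.
by field; rewrite x0.
Qed.

Lemma natr_side (m n : nat) : m.+1%:R / 2 ^+ n = m%:R / 2 ^+ n + side n :> R.
Proof. by rewrite -addn1 natrD mulrDl mul1r. Qed.

Lemma child_sub n (k : index n) a : @dcube R d _ (child k a) `<=` dcube k.
Proof.
rewrite !dcubeE => x /cboxP h; apply/cboxP => j; have := h j.
rewrite !natr_side child_lo sideS; have := side_gt0 n.
by case: (a j); rewrite ?mul1r ?mul0r => s0 /andP[h1 h2]; apply/andP; split; lra.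
Qed.

Lemma dcube_sub_parent n (k : index n) (l : index n.+1) :
  @dcube R d _ l `<=` dcube k -> parent l = k.
Proof.
(* The centre of [l]. Its offset of half a side makes the inequalities strict on integers, so that
   it belongs to a single cube of generation [n]. *)
pose x : rV := \row_j ((l j)%:R / 2 ^+ n.+1 + side n.+1 / 2).
have s0 := side_gt0 n.+1.
have lx : dcube l x.
  rewrite dcubeE; apply/cboxP => j; rewrite mxE natr_side; apply/andP; split; lra.
move=> /(_ _ lx); rewrite dcubeE => /cboxP kx; apply/ffunP => j; apply/val_inj.
rewrite ffunE /=; have := kx j.
rewrite mxE natr_side.
have E : (k j)%:R / 2 ^+ n = (k j).*2%:R / 2 ^+ n.+1 :> R.
  have := exp2n_neq0 R n; rewrite -muln2 natrM exprS; set y := 2 ^+ n => y0.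
  by field; rewrite y0.
have E' : side n = 2 * side n.+1 by rewrite sideS; lra.
rewrite E E'; set s := side n.+1; rewrite -/s in s0.
move=> /andP[h1 h2].
have aux1 (p q : nat) : p%:R * s <= q%:R * s + s / 2 -> (p < q.+1)%N.
  by move=> h; rewrite -(ltr_nat R) -natr1 -(ltr_pM2r s0); lra.
have aux2 (p q : nat) : q%:R * s + s / 2 <= p%:R * s + 2 * s -> (q < p.+2)%N.
  by move=> h; rewrite -(ltr_nat R) -addn2 natrD -(ltr_pM2r s0); lra.
by have := aux1 _ _ h1; have := aux2 _ _ h2; lia.
Qed.

(** The inclusion that selects the children amounts to [parent l = k], and the children of [k] are
    indexed by bit vectors. *)
Lemma children_sumE (eta : dyadic_cube d -> R) n (k : index n) :
  children_sum eta (DyadicCube k) = \sum_a eta (DyadicCube (child k a)).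
Proof.
rewrite /children_sum /= -(sum_children k (fun l => eta (DyadicCube l))).
apply: eq_bigl => l; apply/asboolP/eqP; first exact: dcube_sub_parent.
by move=> <-; rewrite -{1}(parentK l); exact: child_sub.
Qed.

Definition avg n (k : index n) (B : set rV) : R := volume (B `&` dcube k) / side n ^+ d.

Lemma avg_ge0 n (k : index n) B : 0 <= avg k B.
Proof. by rewrite divr_ge0 ?volume_ge0// exprn_ge0// ltW// side_gt0. Qed.

Section avg_diff.
Variables (B : set rV) (P : R).
Hypothesis fB : fin_meas B.
Hypothesis PB : (perimeter B <= P%:E)%E.
Variables (n : nat) (a : {ffun 'I_d -> bool}).

(* The box whose first [i] sides are those of the child [a] of the cube [k] and
   whose other sides are those of [k]. *)
Let len (i : nat) (j : 'I_d) : R := if (j < i)%N then side n / 2 else side n.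
Let off (i : nat) (j : 'I_d) : R := if (j < i)%N then (a j)%:R * (side n / 2) else 0.
Let lo (i : nat) (k : index n) (j : 'I_d) : R := off i j + (k j)%:R * side n.
Let mixed (i : nat) (k : index n) : R :=
  volume (B `&` cbox (lo i k) (fun j => lo i k j + len i j)) / \prod_j len i j.

Let len_gt0 i j : 0 < len i j.
Proof. by rewrite /len; case: ifP => _; rewrite ?divr_gt0 ?side_gt0. Qed.

Let mixed0 k : mixed 0 k = avg k B.
Proof.
rewrite /mixed /avg dcubeE prodr_const card_ord; congr (volume (_ `&` _) / _).
congr cbox; apply/funext => j; rewrite /lo /off /len/= ?add0r//.
by rewrite natr_side.
Qed.

Let mixedd k : mixed d k = avg (child k a) B.
Proof.
rewrite /mixed /avg dcubeE; congr (volume (_ `&` _) / _).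
  congr cbox; apply/funext => j; rewrite /lo /off /len/= ltn_ord.
    by rewrite child_lo addrC.
  by rewrite natr_side child_lo sideS; ring.
rewrite (eq_bigr (fun=> side n / 2)) => [|j _]; last by rewrite /len ltn_ord.
by rewrite prodr_const card_ord sideS.
Qed.

Let prod_len_ge i : (side n / 2) ^+ d <= \prod_j len i j.
Proof.
rewrite -[in leLHS](card_ord d) -prodr_const; apply: ler_prod => j _.
have := side_gt0 n; rewrite /len => s0.
by case: ifP => _; apply/andP; split; lra.
Qed.

(** If a box of volume [V] is cut into halves carrying volumes [wl] and [wr] of [B], the average
    over a half differs from that over the box by [|wl - wr| / V]. Bounding [V] below by
    [(side n / 2) ^+ d] makes the constant independent of [i]. *)
Let mixed_step (i : 'I_d) (k : index n) :
  `|mixed i.+1 k - mixed i k| <=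
  `|volume (B `&` left_box (side n) (off i) (len i) i k) -
    volume (B `&` right_box (side n) (off i) (len i) i k)| / (side n / 2) ^+ d.
Proof.
have s0 := side_gt0 n.
have leni : len i i = side n by rewrite /len ltnn.
have El : left_box (side n) (off i) (len i) i k =
    obox (lo i k) (upd (fun j => lo i k j + len i j) i (lo i k i + side n / 2)).
  by congr box; apply/funext => j; rewrite /upd; case: eqP => // ->; rewrite leni.
have Er : right_box (side n) (off i) (len i) i k =
    obox (upd (lo i k) i (lo i k i + side n / 2)) (fun j => lo i k j + len i j).
  by congr box; apply/funext => j; rewrite /upd; case: eqP => // ->; rewrite leni.
have lol j : lo i k j <= lo i k j + len i j by rewrite lerDl ltW.
rewrite El Er !volumeI_box//; last 2 first.
- by move=> j; rewrite /upd; case: eqP => [->|//]; rewrite leni; lra.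
- by move=> j; rewrite /upd; case: eqP => [->|//]; lra.
have V0 : 0 < \prod_j len i j by apply: prodr_gt0 => j _; exact: len_gt0.
have Vs : \prod_j len i.+1 j = (\prod_j len i j) / 2.
  rewrite (bigD1 i)//= [in RHS](bigD1 i)//= leni /len ltnSn mulrAC; congr (_ * _ / _).
  apply: eq_bigr => j ji; rewrite ltnS leq_eqVlt -[(j : nat) == i]/(val j == val i) val_eqE (negbTE ji).
  by [].
set wl := volume _; set wr := volume (_ `&` cbox (upd _ _ _) _).
have sp : volume (B `&` cbox (lo i k) (fun j => lo i k j + len i j)) = wl + wr.
  by apply: volume_cbox_split => //; rewrite leni; apply/andP; split; lra.
have Ei1 : volume (B `&` cbox (lo i.+1 k) (fun j => lo i.+1 k j + len i.+1 j)) =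
    if a i then wr else wl.
  rewrite /wl /wr; case: ifP => ai; congr (volume (_ `&` cbox _ _)); apply/funext => j;
    rewrite /upd /lo /off /len ltnS leq_eqVlt -[(j : nat) == i]/(val j == val i) val_eqE;
    case: eqP => [->|]//=; rewrite ?ltnn ?ai /=; lra.
rewrite /mixed Ei1 sp Vs.
have -> : `|(if a i then wr else wl) / (\prod_j len i j / 2) - (wl + wr) / \prod_j len i j| =
    `|wl - wr| / \prod_j len i j.
  rewrite -[in RHS](gtr0_norm V0) -normfV -normrM.
  by case: (a i); [rewrite -[RHS]normrN|]; congr `|_|; field; rewrite gt_eqF.
rewrite ler_wpM2l// lef_pV2 ?posrE// exprn_gt0//; lra.
Qed.

(** One application of [grid_estimate] per halved coordinate. The constant [8 ^+ d] is [4 ^+ d] from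
    that estimate times [2 ^+ d] from the lower bound on the volumes of the intermediate boxes. *)
Lemma sum_avg_child_le :
  \sum_(k : index n) `|avg (child k a) B - avg k B| <=
  d%:R * (8 ^+ d * (side n * P) / side n ^+ d).
Proof.
have s0 := side_gt0 n.
rewrite (@le_trans _ _ (\sum_(k : index n) \sum_(i < d) `|mixed i.+1 k - mixed i k|))//.
  apply: ler_sum => k _; rewrite -mixedd -mixed0.
  rewrite -(telescope_sumr (fun i => mixed i k))// big_mkord.
  exact: ler_norm_sum.
rewrite exchange_big/=.
have -> : d%:R * (8 ^+ d * (side n * P) / side n ^+ d) =
    \sum_(i < d) (8 ^+ d * (side n * P) / side n ^+ d).
  by rewrite sumr_const card_ord mulr_natl.
apply: ler_sum => i _; rewrite (le_trans (ler_sum _ (fun k _ => mixed_step i k)))//.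
rewrite -mulr_suml.
have E (s : R) : s != 0 -> 8 ^+ d * (s * P) / s ^+ d = (4 ^+ d * s * P) / (s / 2) ^+ d.
  move=> sn0; have -> : 8 = 4 * 2 :> R by rewrite -natrM.
  rewrite !exprMn exprVn.
  have t0 : 2 ^+ d != 0 :> R by exact: exp2n_neq0.
  have sd0 : s ^+ d != 0 by rewrite expf_neq0.
  move: (4 ^+ d) (2 ^+ d) (s ^+ d) t0 sd0 => x y z y0 z0.
  by field; rewrite y0 z0.
rewrite E ?gt_eqF//.
rewrite ler_wpM2r ?invr_ge0 ?exprn_ge0 ?divr_ge0 ?(ltW s0)//.
have := @grid_estimate R d B P fB PB (2 ^ n) (side n) (off i) (len i) i.
have -> : len i i = side n by rewrite /len ltnn.
apply => // j.
by rewrite /len; case: ifP => _; lra.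
Qed.

End avg_diff.

End refinement.

(** * Existence *)

Section geometric.
Variable R : realType.

Lemma geometric_cvg (u : nat -> R) (C r : R) (m : nat) : 0 <= C -> 0 <= r -> r < 1 ->
  (forall n, (m <= n)%N -> `|u n.+1 - u n| <= C * r ^+ n) ->
  cvgn u /\ forall n, (m <= n)%N -> `|limn u - u n| <= C * r ^+ n / (1 - r).
Proof.
move=> C0 r0 r1 uC; have r10 : 0 < 1 - r by lra.
(* Keeping the factor [1 - r ^+ p] of the partial geometric sum is what lets the induction on [p]
   close. *)
have step n p : (m <= n)%N -> `|u (n + p)%N - u n| <= C * r ^+ n * (1 - r ^+ p) / (1 - r).
  move=> mn; elim: p => [|p IH].
    by rewrite addn0 subrr normr0 expr0 subrr mulr0 mul0r.
  rewrite addnS; have -> : u (n + p).+1 - u n = (u (n + p).+1 - u (n + p)%N) + (u (n + p)%N - u n).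
    by ring.
  rewrite (le_trans (ler_normD _ _))//.
  rewrite (le_trans (lerD (uC _ (leq_trans mn (leq_addr _ _))) IH))//.
  rewrite le_eqVlt; apply/orP; left; apply/eqP; rewrite exprD exprS.
  by field; rewrite gt_eqF.
have step' n p : (m <= n)%N -> `|u (n + p)%N - u n| <= C * r ^+ n / (1 - r).
  move=> mn; rewrite (le_trans (step n p mn))// ler_pM2r ?invr_gt0//.
  rewrite ler_piMr ?mulr_ge0 ?exprn_ge0//.
  by rewrite gerBl exprn_ge0.
have r_cvg : (fun n => C * r ^+ n / (1 - r)) @ \oo --> 0.
  rewrite (_ : 0 = 0 / (1 - r)); last by rewrite mul0r.
  apply: cvgMl; apply: cvg_geometric; by rewrite ger0_norm.
have cu : cvgn u.
  apply/cauchy_cvgP/cauchy_exP => e e0.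
  have /cvgrPdist_lt/(_ _ e0)[N _ hN] := r_cvg.
  pose n := maxn N m; exists (u n); exists n => // p /= np.
  rewrite /ball /= distrC -(subnKC np) (le_lt_trans (step' _ _ (leq_maxr _ _)))//.
  have := hN n (leq_maxl _ _); rewrite /= sub0r normrN; apply: le_lt_trans.
  exact: ler_norm.
split=> // n mn.
have cn : (fun p => `|u (n + p)%N - u n|) @ \oo --> `|limn u - u n|.
  apply: cvg_norm; apply: cvgB; last exact: cvg_cst.
  under [X in X @ _]eq_fun do rewrite addnC.
  by apply: (cvg_comp _ _ (cvg_addnr n)).
by apply: cvgr_to_le cn _; apply: nearW => p; exact: step'.
Qed.

End geometric.

Section ratios.
Variables (R : realType) (d : nat).
Hypothesis d1 : (1 <= d)%N.

(** The volume ratio of a child to its parent: a cube of generation [n] has volume [cratio ^+ n]. *)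
Definition cratio : R := (2 ^+ d)^-1.

Lemma cratio_gt0 : 0 < cratio.
Proof. by rewrite invr_gt0 exprn_gt0. Qed.

Lemma cratio_lt1 : cratio < 1.
Proof. by rewrite invf_lt1 ?exprn_gt0// exprn_egt1 -?lt0n// ltr1n. Qed.

Lemma side_expE n : (2 ^+ n)^-1 ^+ d = cratio ^+ n.
Proof. by rewrite /cratio !exprVn -!exprM mulnC. Qed.

Lemma powR_expn (b s : R) n : 0 <= b -> (b ^+ n) `^ s = (b `^ s) ^+ n.
Proof. by move=> b0; rewrite -powR_mulrn// powRAC powR_mulrn// powR_ge0. Qed.

Lemma powR_lt1_anti (b s t : R) : 0 < b < 1 -> s < t -> b `^ t < b `^ s.
Proof.
move=> /andP[b0 b1] st; have -> : t = s + (t - s) by ring.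
rewrite powRD; last by rewrite (gt_eqF b0) implybT.
rewrite gtr_pMr ?powR_gt0//.
have /gt0_ltr_powR : 0 < t - s by lra.
move=> /(_ b 1); rewrite powR1; by apply => //; rewrite nnegrE ltW.
Qed.

Lemma powR_cratio_lt1 s : 0 < s -> cratio `^ s < 1.
Proof.
move=> s0; rewrite -(powRr0 cratio); apply: powR_lt1_anti => //.
by rewrite cratio_gt0 cratio_lt1.
Qed.

(** At the critical exponent, [cratio] to the power [(d - 1) / d] is [2^(1 - d) = 2 * cratio]; a
    larger exponent gives a strictly smaller power. This makes the refinement parts decay. *)
Lemma powR_cratio_lt (gamma : R) : (d%:R - 1) / d%:R < gamma ->
  cratio `^ gamma < 2 * cratio.
Proof.
move=> dg; apply: lt_le_trans (_ : cratio `^ ((d%:R - 1) / d%:R) <= _).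
  by apply: powR_lt1_anti => //; rewrite cratio_gt0 cratio_lt1.
have dn0 : d%:R != 0 :> R by rewrite pnatr_eq0 -lt0n.
have -> : cratio = 2 `^ (- d%:R) by rewrite powR_invn.
have E : - d%:R * ((d%:R - 1) / d%:R) = 1 - d%:R :> R by field.
rewrite -powRrM E.
rewrite powRD; last by rewrite pnatr_eq0 implybT.
by rewrite powRr1.
Qed.

End ratios.

Section BV_cube_facts.
Variables (R : realType) (d : nat).
Implicit Types A B K : set 'rV[R]_d.

Lemma BV_cube_fin B : BV_cube B -> fin_meas B.
Proof. by move=> [[mB _ _] BU]; exact: fin_measS mB BU (fin_meas_unit_cube R d). Qed.

Lemma lt_pinfty_bound (x : \bar R) : (x < +oo)%E -> exists2 P : R, 0 <= P & (x <= P%:E)%E.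
Proof.
case: x => [r _|//|_]; last by exists 0 => //; rewrite leNye.
by exists `|r| => //; rewrite lee_fin ler_norm.
Qed.

Lemma fin_meas_symdiff A B : fin_meas A -> fin_meas B -> fin_meas (A `+` B).
Proof. by move=> fA fB; apply: fin_measU; apply: fin_measD => //; [exact: fB.1|exact: fA.1]. Qed.

Lemma volumeI_symdiff A B K : fin_meas A -> fin_meas B -> lebesgue_measurable K ->
  `|volume (A `&` K) - volume (B `&` K)| <= volume (A `+` B).
Proof.
have aux C D : fin_meas C -> fin_meas D -> lebesgue_measurable K ->
    volume (C `&` K) <= volume (D `&` K) + volume (C `+` D).
  move=> fC fD mK; rewrite (volume_split (fin_measI fC mK) fD.1); apply: lerD.
    apply: volume_le; last exact: fin_measI.
      by do !apply: lmeasI => //; [exact: fC.1|exact: fD.1].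
    by move=> x [[]].
  apply: volume_le; last exact: fin_meas_symdiff.
    by apply: lmeasD; [apply: lmeasI => //; exact: fC.1|exact: fD.1].
  by move=> x [[Cx _] nDx]; left.
move=> fA fB mK; have h1 := aux _ _ fA fB mK; have h2 := aux _ _ fB fA mK.
rewrite setYC in h2.
by rewrite ler_norml; apply/andP; split; lra.
Qed.

End BV_cube_facts.

Section existence.
Variables (R : realType) (d : nat) (gamma : R).
Variables (eta : dyadic_cube d -> R) (kappa eps : R).
Local Notation rV := 'rV[R]_d.
Local Notation index n := {ffun 'I_d -> 'I_(2 ^ n)}.
Hypothesis d1 : (1 <= d)%N.
Hypothesis gamma_gt : (d%:R - 1) / d%:R < gamma.
Hypothesis gamma_le1 : gamma <= 1.
Hypothesis kappa_ge0 : 0 <= kappa.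
Hypothesis eps_gt0 : 0 < eps.
Hypothesis eta_add : forall K,
  `|eta K - children_sum eta K| <= kappa * vol R K `^ (1 + eps).
Hypothesis eta_le : forall K, `|eta K| <= kappa * vol R K `^ gamma.

Local Notation cr := (cratio R d).

Definition approx n (B : set rV) : R :=
  \sum_(k : index n) eta (DyadicCube k) * avg k B.

(** A total function: [limn] has some default value where the sequence diverges. Convergence is
    established for sets of finite perimeter in the unit cube, the only ones a charge is tested
    on. *)
Definition theta (B : set rV) : R := limn (fun n => approx n B).

Let q : R := cr `^ eps.
(** This is [2^(d - 1 - d gamma)]: per generation, the bound on [eta] is multiplied by [cr^gamma]
    and the bound on the sum of oscillations by [2^(d - 1) = 1 / (2 cr)]. In [C1], the number
    [2 ^+ d] of children multiplies the constant of [sum_avg_child_le]. *)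
Let r : R := cr `^ gamma / (2 * cr).
Let C1 : R := 2 ^+ d * (d%:R * 8 ^+ d).

Let cr0 : 0 < cr. Proof. exact: cratio_gt0. Qed.
Let gamma_ge0 : 0 <= gamma.
Proof.
apply: ltW; apply: le_lt_trans gamma_gt.
by rewrite divr_ge0// subr_ge0 ler1n.
Qed.
Let q0 : 0 <= q. Proof. exact: powR_ge0. Qed.
Let q1 : q < 1. Proof. exact: powR_cratio_lt1. Qed.
Let r0 : 0 <= r.
Proof. by rewrite divr_ge0 ?powR_ge0// mulr_ge0// ltW. Qed.
Let r1 : r < 1.
Proof. by rewrite ltr_pdivrMr ?mulr_gt0// mul1r; exact: powR_cratio_lt. Qed.
Let C10 : 0 <= C1.
Proof. by rewrite !mulr_ge0 ?exprn_ge0. Qed.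

Let volE n (k : index n) : vol R (DyadicCube k) = cr ^+ n.
Proof. by rewrite vol_dcube side_expE. Qed.

Let refine_part n B : R := \sum_(k : index n) \sum_a
  eta (DyadicCube (child k a)) * (avg (child k a) B - avg k B).
Let defect_part n B : R := \sum_(k : index n)
  (children_sum eta (DyadicCube k) - eta (DyadicCube k)) * avg k B.

Let approxS n B : approx n.+1 B - approx n B = refine_part n B + defect_part n B.
Proof.
rewrite /approx sum_refine -sumrB -big_split/=; apply: eq_bigr => k _.
rewrite children_sumE mulrBl mulr_suml addrA; congr (_ - _).
by rewrite -big_split/=; apply: eq_bigr => a _; ring.
Qed.

Let avgE n (k : index n) B : cr ^+ n * avg k B = volume (B `&` dcube k).
Proof.
rewrite /avg side_expE mulrC divfK// expf_neq0// gt_eqF//.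
Qed.

(** [|K|^(1 + eps)] times the average over [K] is [|K|^eps |B ∩ K|], and the volumes [|B ∩ K|] add
    up to that of [B]. *)
Let defect_le n B : fin_meas B -> B `<=` @unit_cube R d ->
  `|defect_part n B| <= kappa * volume B * q ^+ n.
Proof.
move=> fB BU; rewrite /defect_part (le_trans (ler_norm_sum _ _ _))//.
rewrite -(sum_volume_cells n fB BU) mulr_sumr mulr_suml; apply: ler_sum => k _.
rewrite normrM distrC (ger0_norm (avg_ge0 _ _)).
rewrite (le_trans (ler_wpM2r (avg_ge0 _ _) (eta_add _)))// volE.
rewrite powRD; last by rewrite expf_neq0 ?implybT// gt_eqF.
rewrite powRr1 ?exprn_ge0 ?(ltW cr0)// powR_expn ?(ltW cr0)// -avgE -/q.
by rewrite le_eqVlt; apply/orP; left; apply/eqP; ring.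
Qed.

(** The bound (B) for a child is weakened to that of its parent, which makes it a common factor. For
    each fixed position [a] of the child, the oscillations are then summed over all cubes by
    [sum_avg_child_le]. *)
Let refine_le n B P : fin_meas B -> (perimeter B <= P%:E)%E ->
  `|refine_part n B| <= kappa * C1 * P * r ^+ n.
Proof.
move=> fB PB; rewrite /refine_part (le_trans (ler_norm_sum _ _ _))//.
have crn : 0 < cr ^+ n by rewrite exprn_gt0.
rewrite (@le_trans _ _ (\sum_(k : index n) \sum_a
    (kappa * (cr `^ gamma) ^+ n) * `|avg (child k a) B - avg k B|))//.
  apply: ler_sum => k _; rewrite (le_trans (ler_norm_sum _ _ _))//.
  apply: ler_sum => a _; rewrite normrM ler_wpM2r//.
  rewrite (le_trans (eta_le _))// volE ler_wpM2l// -powR_expn ?(ltW cr0)//.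
  apply: ge0_ler_powR => //; rewrite ?nnegrE ?exprn_ge0 ?(ltW cr0)//.
  by rewrite exprS ler_piMl ?(ltW cr0)// ltW// cratio_lt1.
rewrite exchange_big/=.
rewrite (@le_trans _ _ (\sum_(a : {ffun 'I_d -> bool}) (kappa * (cr `^ gamma) ^+ n) *
    (d%:R * (8 ^+ d * ((2 ^+ n)^-1 * P) / (2 ^+ n)^-1 ^+ d))))//.
  apply: ler_sum => a _; rewrite -mulr_sumr ler_wpM2l ?mulr_ge0 ?exprn_ge0 ?powR_ge0//.
  exact: sum_avg_child_le.
rewrite sumr_const card_ffun card_bool card_ord -[leLHS]mulr_natl natrX side_expE /r /C1.
rewrite le_eqVlt; apply/orP; left; apply/eqP.
rewrite expr_div_n exprMn; move: (cr `^ gamma) => g.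
have p2 := exp2n_neq0 R n; move: p2 crn.
move: (2 ^+ n) (cr ^+ n) (g ^+ n) => x y z x0 y0.
by field; rewrite x0 gt_eqF.
Qed.

Lemma approx_step B P n : fin_meas B -> B `<=` @unit_cube R d -> 0 <= P ->
  (perimeter B <= P%:E)%E ->
  `|approx n.+1 B - approx n B| <= kappa * (C1 * P + 1) * Num.max r q ^+ n.
Proof.
move=> fB BU P0 PB; rewrite approxS (le_trans (ler_normD _ _))//.
rewrite (le_trans (lerD (refine_le n fB PB) (defect_le n fB BU)))//.
have v1 : volume B <= 1.
  rewrite -(volume_unit_cube R d); apply: volume_le => //; first exact: fB.1.
  exact: fin_meas_unit_cube.
have hr : r ^+ n <= Num.max r q ^+ n by rewrite lerXn2r ?nnegrE ?le_max ?r0 ?lexx.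
have hq : q ^+ n <= Num.max r q ^+ n by rewrite lerXn2r ?nnegrE ?le_max ?q0 ?lexx ?orbT.
have -> : kappa * (C1 * P + 1) * Num.max r q ^+ n =
    kappa * C1 * P * Num.max r q ^+ n + kappa * 1 * Num.max r q ^+ n by ring.
apply: lerD; first by rewrite ler_wpM2l ?mulr_ge0.
by apply: ler_pM; rewrite ?mulr_ge0 ?exprn_ge0 ?volume_ge0// ler_wpM2l.
Qed.

Let rho : R := Num.max r q.
Let rho0 : 0 <= rho. Proof. by rewrite /rho le_max r0. Qed.
Let rho1 : rho < 1. Proof. by rewrite /rho gt_max r1 q1. Qed.

Lemma approx_cvg B P : fin_meas B -> B `<=` @unit_cube R d -> 0 <= P ->
  (perimeter B <= P%:E)%E ->
  cvgn (fun n => approx n B) /\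
  forall n, `|theta B - approx n B| <= kappa * (C1 * P + 1) * rho ^+ n / (1 - rho).
Proof.
move=> fB BU P0 PB.
have C0 : 0 <= kappa * (C1 * P + 1) by rewrite mulr_ge0// addr_ge0// mulr_ge0.
have [cv bd] := @geometric_cvg R (fun n => approx n B) (kappa * (C1 * P + 1)) rho 0
  C0 rho0 rho1 (fun n _ => approx_step n fB BU P0 PB).
by split=> // n; exact: bd.
Qed.

Section on_cubes.
Variables (m : nat) (k0 : index m).
Let K0 : set rV := dcube k0.

Let dichotomy n (k : index n) : (m <= n)%N ->
  dcube k `<=` K0 \/ K0 `&` ocube k = set0.
Proof.
move=> mn; have En : 2 ^+ n = 2 ^+ m * 2 ^+ (n - m) :> R by rewrite -exprD subnKC.
have pm : 0 < 2 ^+ m :> R by rewrite exprn_gt0.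
have pp : 0 < 2 ^+ (n - m) :> R by rewrite exprn_gt0.
have sc (x : nat) : x%:R / 2 ^+ m = (x * 2 ^ (n - m))%N%:R / 2 ^+ n :> R.
  rewrite natrM natrX En; move: (2 ^+ m) (2 ^+ (n - m)) pm pp => y z y0 z0.
  by field; rewrite !gt_eqF.
have p0 : 0 < (2 ^+ n)^-1 :> R by rewrite invr_gt0 exprn_gt0.
have [h|h] := pselect (forall j, (k0 j * 2 ^ (n - m) <= k j < (k0 j).+1 * 2 ^ (n - m))%N).
  left; rewrite /K0 !dcubeE => x /cboxP xk; apply/cboxP => j.
  have /andP[h1 h2] := h j; have /andP[x1 x2] := xk j.
  rewrite !sc (le_trans _ x1) ?ler_pM2r ?ler_nat//= (le_trans x2)//.
  by rewrite ler_pM2r// ler_nat.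
right; move/existsNP : h => [j hj]; apply/seteqP; split=> // x [].
rewrite /K0 dcubeE => /cboxP/(_ j)/andP[x1 x2] /oboxP/(_ j)/andP[x3 x4].
apply: hj; move: (le_lt_trans x1 x4) (lt_le_trans x3 x2).
by rewrite !sc !ltr_pM2r// !ltr_nat ltnS => -> ->.
Qed.

Let avg_sub n (k : index n) : dcube k `<=` K0 -> avg k K0 = 1.
Proof.
by move=> kK; rewrite /avg setIidr// volume_dcube divff// expf_neq0// invr_neq0.
Qed.

Let avg_disj n (k : index n) : K0 `&` ocube k = set0 -> avg k K0 = 0.
Proof.
move=> kK; rewrite /avg -volumeI_ocube; last exact: fin_meas_dcube.
by rewrite kK volume0 mul0r.
Qed.

(** From generation [m] on, the averages of [K0] are 0 or 1, and a child has the same one as its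
    parent. *)
Let refine0 n : (m <= n)%N -> refine_part n K0 = 0.
Proof.
move=> mn; rewrite /refine_part big1// => k _; rewrite big1// => a _.
have [kK|kK] := dichotomy k mn.
  by rewrite !avg_sub ?subrr ?mulr0//; apply: subset_trans kK; exact: child_sub.
have [lK|lK] := dichotomy (child k a) (leqW mn); last first.
  by rewrite !avg_disj// subrr mulr0.
have : @ocube R d _ (child k a) `<=` ocube k.
  move=> x xl; apply/oboxP => j; have /oboxP/(_ j) := xl.
  rewrite !natr_side child_lo sideS; have := side_gt0 R n.
  by case: (a j); rewrite ?mul1r ?mul0r => s0 /andP[h1 h2]; apply/andP; split; lra.
have [x xo] : @ocube R d _ (child k a) !=set0.
  exists (\row_j ((child k a j)%:R / 2 ^+ n.+1 + (2 ^+ n.+1)^-1 / 2)).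
  apply/oboxP => j; rewrite mxE natr_side; have := side_gt0 R n.+1 => s0.
  by apply/andP; split; lra.
move=> /(_ x xo) xk; exfalso; have : (K0 `&` ocube k) x.
  by split=> //; apply: lK; rewrite dcubeE; exact: obox_sub.
by rewrite kK.
Qed.

Let approx_base : approx m K0 = eta (DyadicCube k0).
Proof.
rewrite /approx (bigD1 k0)//= avg_sub// mulr1 big1 ?addr0// => k kk.
rewrite avg_disj ?mulr0// /K0; have := ocube_disjoint R kk.
have [kK|//] := dichotomy k (leqnn m).
move=> _; exfalso.
pose x : rV := \row_j ((k j)%:R / 2 ^+ m + (2 ^+ m)^-1 / 2).
have s0 := side_gt0 R m.
have xo : ocube k x.
  by apply/oboxP => j; rewrite mxE natr_side; apply/andP; split; lra.
have : (figure (pred1 k0) `&` ocube k) x.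
  split=> //; apply/figureP; exists k0 => //=; apply: kK.
  by rewrite dcubeE; exact: obox_sub.
by rewrite figureI_ocube /= (negbTE kk).
Qed.

(** At generation [m] the approximation equals [eta] on the cube, and later increments are pure
    defects. Their geometric tail is [kappa |K| q^m / (1 - q)], where [q^m = |K|^eps]. *)
Lemma theta_cube_close : `|eta (DyadicCube k0) - theta K0| <=
  (1 - q)^-1 * kappa * vol R (DyadicCube k0) `^ (1 + eps).
Proof.
have step n : (m <= n)%N -> `|approx n.+1 K0 - approx n K0| <=
    kappa * vol R (DyadicCube k0) * q ^+ n.
  move=> mn; rewrite approxS refine0// add0r.
  by apply: defect_le; [exact: fin_meas_dcube|exact: dcube_sub_unit].
have v0 : 0 <= vol R (DyadicCube k0) by rewrite volE exprn_ge0// ltW.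
have [_ /(_ m (leqnn m))] := geometric_cvg (mulr_ge0 kappa_ge0 v0) q0 q1 step.
rewrite approx_base distrC => /le_trans; apply.
rewrite volE powRD; last by rewrite expf_neq0 ?implybT// gt_eqF.
rewrite powRr1 ?exprn_ge0 ?(ltW cr0)// powR_expn ?(ltW cr0)// -/q.
by rewrite le_eqVlt; apply/orP; left; apply/eqP; ring.
Qed.

End on_cubes.

Let avg_add n (k : index n) (B1 B2 : set rV) : fin_meas B1 -> fin_meas B2 ->
  lebesgue (B1 `&` B2) = 0%E -> avg k (B1 `|` B2) = avg k B1 + avg k B2.
Proof.
move=> f1 f2 B12; have mk := @lmeas_dcube R d n k.
rewrite /avg -mulrDl setIUl volumeU_null//; try exact: fin_measI.
apply/eqP; rewrite eq_le volume_ge0 andbT.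
have <- : volume (B1 `&` B2) = 0 by rewrite /volume B12.
apply: volume_le; last by apply: fin_measI => //; exact: f2.1.
  by do !apply: lmeasI => //; [exact: f1.1|exact: f2.1].
by move=> x [[? _] [? _]].
Qed.

Let theta_add (B1 B2 : set rV) : BV_cube B1 -> BV_cube B2 -> lebesgue (B1 `&` B2) = 0%E ->
  theta (B1 `|` B2) = theta B1 + theta B2.
Proof.
move=> h1 h2 B12.
have [P1 P10 hP1] := lt_pinfty_bound (let: And3 _ _ h := h1.1 in h).
have [P2 P20 hP2] := lt_pinfty_bound (let: And3 _ _ h := h2.1 in h).
have [cv1 _] := approx_cvg (BV_cube_fin h1) h1.2 P10 hP1.
have [cv2 _] := approx_cvg (BV_cube_fin h2) h2.2 P20 hP2.
have E : (fun n => approx n (B1 `|` B2)) = (fun n => approx n B1 + approx n B2).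
  apply/funext => n; rewrite /approx -big_split/=; apply: eq_bigr => k _.
  by rewrite avg_add ?mulrDr//; exact: BV_cube_fin.
by rewrite /theta E; exact: limD.
Qed.

Let theta_continuous (B_ : nat -> set rV) (B : set rV) : (forall n, BV_cube (B_ n)) -> BV_cube B ->
  BV_cvg B_ B -> (fun n => theta (B_ n)) @ \oo --> theta B.
Proof.
move=> hB_ hB [symB /lt_pinfty_bound[P P0 hP]].
have [P' P'0 hP'] := lt_pinfty_bound (let: And3 _ _ h := hB.1 in h).
(* One constant for the whole sequence and its limit, since all these perimeters are at most
   [P + P']. The convergence of the approximations is thus uniform, and the limits in [n] and in [m]
   can be exchanged. *)
pose D := kappa * (C1 * (P + P') + 1) / (1 - rho).
have near_ B0 : fin_meas B0 -> B0 `<=` @unit_cube R d ->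
    (perimeter B0 <= (P + P')%:E)%E -> forall n, `|theta B0 - approx n B0| <= D * rho ^+ n.
  move=> f0 U0 p0 n; have [_ /(_ n)] := approx_cvg f0 U0 (addr_ge0 P0 P'0) p0.
  by rewrite /D mulrAC.
have nB := near_ _ (BV_cube_fin hB) hB.2 (le_trans hP' _).
have {}nB n : `|theta B - approx n B| <= D * rho ^+ n by apply: nB; rewrite lee_fin lerDr.
have nB_ m n : `|theta (B_ m) - approx n (B_ m)| <= D * rho ^+ n.
  apply: near_; [exact: BV_cube_fin|exact: (hB_ m).2|].
  apply: (@le_trans _ _ P%:E); last by rewrite lee_fin lerDl.
  by apply: le_trans hP; apply: ereal_sup_ubound; exists m.
have cv_vol : (fun m => volume (B_ m `+` B)) @ \oo --> 0.
  exact: (fine_cvg symB).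
have cv_approx n : (fun m => approx n (B_ m)) @ \oo --> approx n B.
  apply: cvg_big => [|k _]; first exact: add_continuous.
  apply: cvgMr; apply: cvgMl.
  apply/cvgrPdist_le => e e0.
  have /cvgrPdist_le/(_ e e0) := cv_vol; apply: filterS => m.
  rewrite sub0r normrN (ger0_norm (volume_ge0 _)) distrC; apply: le_trans.
  by apply: volumeI_symdiff; [exact: BV_cube_fin|exact: BV_cube_fin|exact: lmeas_dcube].
have rho_cvg : (fun n => D * rho ^+ n) @ \oo --> 0.
  by apply: cvg_geometric; rewrite ger0_norm.
apply/cvgrPdist_le => e e0; have e3 : 0 < e / 3 by lra.
have /cvgrPdist_le/(_ _ e3)[n _ /(_ n (leqnn n))] := rho_cvg.
rewrite /= sub0r normrN => /(le_trans (ler_norm _)) hn.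
have /cvgrPdist_le/(_ _ e3) := cv_approx n; apply: filterS => m hm.
have h1 := le_trans (nB n) hn; have h2 := le_trans (nB_ m n) hn.
have -> : theta B - theta (B_ m) = (theta B - approx n B) +
    (approx n B - approx n (B_ m)) - (theta (B_ m) - approx n (B_ m)) by ring.
rewrite (le_trans (ler_normB _ _))// (le_trans (lerD (ler_normD _ _) (lexx _)))//; lra.
Qed.

Lemma theta_sch : sch gamma theta.
Proof.
split; first by split; [exact: theta_add|exact: theta_continuous].
pose M : R := kappa + (1 - q)^-1 * kappa.
apply: (@le_lt_trans _ _ M%:E); last exact: ltry.
apply: ge_ereal_sup => _ [[m k0] _ <-]; rewrite lee_fin.
have v0 : 0 < vol R (DyadicCube k0) by rewrite volE exprn_gt0.
rewrite ler_pdivrMr ?powR_gt0// mulrDl.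
have -> : theta (cube (DyadicCube k0)) = eta (DyadicCube k0) -
    (eta (DyadicCube k0) - theta (dcube k0)) by rewrite opprB addrC subrK.
rewrite (le_trans (ler_normB _ _))// lerD//.
rewrite (le_trans (theta_cube_close k0))// ler_wpM2l//.
  by rewrite mulr_ge0// invr_ge0 subr_ge0 ltW.
have v1 : vol R (DyadicCube k0) <= 1.
  by rewrite volE exprn_ile1// ltW// cratio_lt1.
(* As [|K| <= 1] and [gamma <= 1 <= 1 + eps], the error [|K|^(1 + eps)] is absorbed by
   [|K|^gamma]. *)
by apply: ger_powR; [rewrite v0 v1|rewrite (le_trans gamma_le1)// lerDl ltW].
Qed.

End existence.

(** * Perimeter of dyadic figures *)

Section product_bound.
Local Open Scope ereal_scope.
Context d1 d2 (X : measurableType d1) (Y : measurableType d2) (R : realType).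
Variables (m1 : {sigma_finite_measure set X -> \bar R}).
Variables (m2 : {sigma_finite_measure set Y -> \bar R}).
Variables (A : set X) (D : set Y) (f : X * Y -> \bar R).
Hypotheses (mA : measurable A) (mD : measurable D).
Hypothesis intf : (m1 \x m2).-integrable (A `*` D) f.
Variable C : R.
Hypothesis C0 : (0 <= C)%R.

Let g := f \_ (A `*` D).
Let intg : (m1 \x m2).-integrable setT g.
Proof.
by apply/integrable_restrict => //; rewrite ?setTI//; exact: measurableX.
Qed.

Let g_l x : A x -> (fun y => g (x, y)) = (fun y => f (x, y)) \_ D.
Proof.
move=> Ax; apply/funext => y; rewrite /g /patch; have -> // : ((x, y) \in A `*` D) = (y \in D).
by apply/idP/idP; rewrite !inE => // -[].
Qed.

Let g_r y : D y -> (fun x => g (x, y)) = (fun x => f (x, y)) \_ A.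
Proof.
move=> Dy; apply/funext => x; rewrite /g /patch; have -> // : ((x, y) \in A `*` D) = (x \in A).
by apply/idP/idP; rewrite !inE => // -[].
Qed.

Let g_out x y : ~ (A x /\ D y) -> g (x, y) = 0.
Proof. by move=> AD; rewrite /g /patch memNset. Qed.

(** The two orders of integration serve the two cases of the flux bound: here the inner integral is
    over the remaining coordinates, in the companion lemma it is over the first one. *)
Lemma abse_integral12_le : (forall x, A x -> `|\int[m2]_(y in D) f (x, y)| <= C%:E) ->
  `|\int[m1 \x m2]_(z in A `*` D) f z| <= C%:E * m1 A.
Proof.
move=> fC; rewrite integral_mkcond -/g -integral12_prod_meas1//.
have mF := measurable_fubini_F intg.
apply: le_trans (le_abse_integral m1 measurableT mF) _.
rewrite [X in X <= _](_ : _ = \int[m1]_(x in A) `|\int[m2]_y g (x, y)|).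
  apply: integral_le_bound => //; first exact: measurable_funS mF.
  apply: aeW => x Ax; rewrite g_l// -integral_mkcond; exact: fC.
rewrite [RHS]integral_mkcond; apply: eq_integral => x _.
rewrite /patch; case: ifPn => // /negP; rewrite inE => nA.
by rewrite /fubini_F integral0_eq ?abse0// => y _; apply: g_out => -[].
Qed.

Lemma abse_integral21_le : (forall y, D y -> `|\int[m1]_(x in A) f (x, y)| <= C%:E) ->
  `|\int[m1 \x m2]_(z in A `*` D) f z| <= C%:E * m2 D.
Proof.
move=> fC; rewrite integral_mkcond -/g -integral21_prod_meas1//.
have mG := measurable_fubini_G intg.
apply: le_trans (le_abse_integral m2 measurableT mG) _.
rewrite [X in X <= _](_ : _ = \int[m2]_(y in D) `|\int[m1]_x g (x, y)|).
  apply: integral_le_bound => //; first exact: measurable_funS mG.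
  apply: aeW => y Dy; rewrite g_r// -integral_mkcond; exact: fC.
rewrite [RHS]integral_mkcond; apply: eq_integral => y _.
rewrite /patch; case: ifPn => // /negP; rewrite inE => nD.
by rewrite /fubini_G integral0_eq ?abse0// => x _; apply: g_out => -[].
Qed.

End product_bound.

Section flux.
Variable R : realType.

Lemma compact_cbox n (a b : 'I_n -> R) : compact (cbox a b).
Proof. by apply: (@rV_compact _ _ (fun j => `[a j, b j]%classic)) => j; exact: segment_compact. Qed.

Lemma continuous_cbox_bounded n (g : 'rV[R]_n -> R) a b : continuous g ->
  exists2 M, 0 <= M & forall x, cbox a b x -> `|g x| <= M.
Proof.
move=> cg; have : bounded_set (g @` cbox a b).
  apply: compact_bounded; apply: continuous_compact; last exact: compact_cbox.
  exact: continuous_subspaceT.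
move=> [M [_ hM]]; exists (`|M| + 1) => // x cx; apply: hM; last by exists x.
by rewrite (le_lt_trans (ler_norm M))// ltrDl.
Qed.

Lemma rV_cons_addl n (s h : R) (y : 'rV[R]_n) :
  rV_cons (h + s, y) = h *: basis_vec R ord0 + rV_cons (s, y).
Proof.
apply/rowP => i; rewrite !mxE; have [j ->|->] := unliftP ord0 i.
  by rewrite [lift _ _ == _]eq_sym (negbTE (neq_lift _ _)) andbF mulr0 add0r.
by rewrite !eqxx mulr1.
Qed.

Lemma rV_cons_addr n (s h : R) (y : 'rV[R]_n) j :
  rV_cons (s, h *: basis_vec R j + y) = h *: basis_vec R (lift ord0 j) + rV_cons (s, y).
Proof.
apply/rowP => i; rewrite !mxE; have [k ->|->] := unliftP ord0 i.
  by rewrite !mxE (inj_eq (@lift_inj _ ord0)).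
by rewrite (negbTE (neq_lift _ _)) andbF mulr0 add0r.
Qed.

Lemma continuous_rV_consr n (s : R) : continuous (fun y : 'rV[R]_n => rV_cons (s, y)).
Proof.
apply: continuous_entries => i j; rewrite (ord1 i).
have [k ->|->] := unliftP ord0 j.
  under [X in continuous X]eq_fun do rewrite rV_consS /=.
  exact: coord_continuous.
under [X in continuous X]eq_fun do rewrite rV_cons0 /=.
exact: cst_continuous.
Qed.

Lemma continuous_rV_consl n (y : 'rV[R]_n) : continuous (fun s : R => rV_cons (s, y)).
Proof.
apply: continuous_entries => i j; rewrite (ord1 i).
have [k ->|->] := unliftP ord0 j.
  under [X in continuous X]eq_fun do rewrite rV_consS /=.
  exact: cst_continuous.
by under [X in continuous X]eq_fun do rewrite rV_cons0 /=.
Qed.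

End flux.

Section flux_lemma.
Variable R : realType.

Lemma finite_bounded_integrable d (T : measurableType d) (mu : {measure set T -> \bar R})
    (D : set T) (f : T -> R) (M : R) : measurable D -> (mu D < +oo)%E ->
  measurable_fun setT f -> (forall x, D x -> `|f x| <= M) -> mu.-integrable D (EFin \o f).
Proof.
move=> mD fD mf fM; apply: measurable_bounded_integrable => //.
  exact: measurable_funS mf.
exists M; split; first exact: num_real.
by move=> N MN x Dx; exact: le_trans (fM _ Dx) (ltW MN).
Qed.

Lemma measurable_cbox n (a b : 'I_n -> R) : measurable (cbox a b).
Proof. by apply: measurable_box => j; exact: measurable_itv. Qed.

Lemma borel_lebesgue_cbox n (a b : 'I_n -> R) : (forall j, a j <= b j) ->
  borel_lebesgue (cbox a b) = (\prod_j (b j - a j))%:E.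
Proof. by move=> ab; rewrite -lebesgueE ?lebesgue_box_itv//; exact: measurable_cbox. Qed.

Lemma cbox_cons n (a b : 'I_n.+1 -> R) : @rV_cons R n @^-1` cbox a b =
  `[a ord0, b ord0]%classic `*` cbox (fun j => a (lift ord0 j)) (fun j => b (lift ord0 j)).
Proof.
apply/seteqP; split=> [[s y] /= h|[s y] [/= hs hy] i].
  split=> [|j] /=; first by have := h ord0; rewrite rV_cons0.
  by have := h (lift ord0 j); rewrite rV_consS.
by have [j ->|->] := unliftP ord0 i; rewrite ?rV_consS ?rV_cons0 //=; apply: hy.
Qed.

Lemma integral_cbox_cons n (a b : 'I_n.+1 -> R) (g : 'rV[R]_n.+1 -> R) :
  (forall j, a j <= b j) -> continuous g ->
  let A := `[a ord0, b ord0]%classic in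
  let D := cbox (fun j => a (lift ord0 j)) (fun j => b (lift ord0 j)) in
  let mu := (@lebesgue_measure R \x @borel_lebesgue R n)%E in
  mu.-integrable (A `*` D) (fun z => (g (rV_cons z))%:E) /\
  (\int[@borel_lebesgue R n.+1]_(x in cbox a b) (g x)%:E =
   \int[mu]_(z in A `*` D) (g (rV_cons z))%:E)%E.
Proof.
move=> ab cg A D mu.
have [M M0 gM] := continuous_cbox_bounded a b cg.
have mg := continuous_rV_measurable cg.
have intg : mu.-integrable (A `*` D) (fun z => (g (rV_cons z))%:E).
  apply: (@finite_bounded_integrable _ _ mu (A `*` D) (g \o @rV_cons R n) M).
  - by apply: measurableX; [exact: measurable_itv|exact: measurable_cbox].
  - rewrite [X in (X < _)%E](_ : _ = (lebesgue_measure A * borel_lebesgue D)%E); last first.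
      by apply: product_measure1E; [exact: measurable_itv|exact: measurable_cbox].
    rewrite borel_lebesgue_cbox// lebesgue_measure_itv/=.
    by case: ifP => _; rewrite -?EFinB -?EFinM ltry.
  - by apply: measurableT_comp => //; exact: measurable_rV_cons.
  - move=> z; rewrite -cbox_cons => zAD; exact: gM.
split=> //; rewrite -cbox_cons in intg *.
rewrite -(integral_pushforward (measurable_rV_cons (n := n)) (f := fun x => (g x)%:E) _ intg).
- by apply: eq_measure_integral => [|mf A' mA' A'D]; [exact: measurable_rV_cons|].
- by apply/measurable_EFinP.
- exact: measurable_cbox.
Qed.

(** Two opposite faces, each crossed by a flux at most its area since [|phi| <= 1]. The induction
    peels off the first coordinate: if [i] is a later one, the bound holds on each slice; if [i] is
    the first, the fundamental theorem of calculus applies on each line. *)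
Lemma flux_le n (i : 'I_n) (phi g : 'rV[R]_n -> R) (a b : 'I_n -> R) :
  (forall j, a j <= b j) -> continuous g ->
  (forall x, is_derive x (basis_vec R i) phi (g x)) -> (forall x, `|phi x| <= 1) ->
  (`|\int[@borel_lebesgue R n]_(x in cbox a b) (g x)%:E| <=
   (2 * \prod_(j | j != i) (b j - a j))%:E)%E.
Proof.
elim: n i phi g a b => [[]//|n IH] i phi g a b ab cg dg phi1.
have [intg ->] := integral_cbox_cons ab cg.
pose A : set (measurableTypeR R) := `[a ord0, b ord0]%classic.
pose D := cbox (fun j => a (lift ord0 j)) (fun j => b (lift ord0 j)).
rewrite -/A -/D in intg *.
have mA : measurable A.
  exact: measurable_itv.
have mD := measurable_cbox (fun j => a (lift ord0 j)) (fun j => b (lift ord0 j)).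
have pr0 : 0 <= \prod_(j | j != i) (b j - a j).
  by apply: prodr_ge0 => j _; rewrite subr_ge0.
have [j|] := unliftP ord0 i.
  move=> ij; pose C := 2 * \prod_(k | k != j) (b (lift ord0 k) - a (lift ord0 k)).
  have C0 : 0 <= C.
    by rewrite mulr_ge0//; apply: prodr_ge0 => k _; rewrite subr_ge0.
  have := abse_integral12_le mA mD intg C0; move=> h.
  have {h}/le_trans : (`|\int[lebesgue_measure \x @borel_lebesgue R n]_(z in A `*` D) (g (rV_cons z))%:E| <=
      C%:E * lebesgue_measure A)%E.
    apply: h => s _; apply: (IH j (fun y => phi (rV_cons (s, y))) (fun y => g (rV_cons (s, y)))).
    - by move=> k.
    - by move=> y; apply: continuous_comp; [exact: continuous_rV_consr|exact: cg].
    - move=> y; have [dphi Dphi] := dg (rV_cons (s, y)).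
      have E : (fun h => h^-1 *: (((fun y => phi (rV_cons (s, y))) \o shift y) (h *: basis_vec R j) -
          phi (rV_cons (s, y)))) =
        (fun h => h^-1 *: ((phi \o shift (rV_cons (s, y))) (h *: basis_vec R i) - phi (rV_cons (s, y)))).
        by apply/funext => h /=; rewrite rV_cons_addr ij.
      split; first by rewrite /derivable E.
      by rewrite /derive E.
    - by move=> y.
  apply; rewrite /A lebesgue_measure_itv/= lte_fin.
  have -> : (if (a ord0 < b ord0)%R then (b ord0)%:E - (a ord0)%:E else 0)%E = (b ord0 - a ord0)%:E.
    by case: ltP => // ba; rewrite (@le_anti _ _ (a ord0) (b ord0)) ?ab ?ba// subrr.
  rewrite -EFinM lee_fin /C -mulrA; apply: ler_wpM2l => //.
  rewrite (bigD1 ord0 (P := fun k => k != i))/=; last by rewrite ij neq_lift.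
  rewrite mulrC ler_wpM2l ?subr_ge0// le_eqVlt; apply/orP; left; apply/eqP.
  rewrite big_mkcond [RHS]big_mkcond [RHS]big_ord_recl /= andbF mul1r.
  by apply: eq_bigr => k _; rewrite ij (inj_eq (@lift_inj _ ord0)) andbT.
move=> i0.
have := abse_integral21_le mA mD intg (ler0n R 2); move=> h.
have {h}/le_trans : (`|\int[lebesgue_measure \x @borel_lebesgue R n]_(z in A `*` D) (g (rV_cons z))%:E| <=
    2%:E * borel_lebesgue D)%E.
  apply: h => y _.
  (* The fundamental theorem of calculus is stated for a nondegenerate interval; a single point is
     treated apart. *)
  rewrite /A; have [a0b0|b0a0] := ltP (a ord0) (b ord0); last first.
    rewrite (@le_anti _ _ (a ord0) (b ord0)) ?ab ?b0a0//.
    by rewrite set_itv1 integral_set1 abse0 lee_fin.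
  pose G s := phi (rV_cons (s, y)).
  have dG (s : R) : is_derive s (1 : R) G (g (rV_cons (s, y))).
    have [dphi Dphi] := dg (rV_cons (s, y)).
    have E : (fun h => h^-1 *: ((G \o shift s) (h *: (1 : R)) - G s)) =
      (fun h => h^-1 *: ((phi \o shift (rV_cons (s, y))) (h *: basis_vec R i) - phi (rV_cons (s, y)))).
      by apply/funext => h /=; rewrite /G [h *: 1]mulr1 rV_cons_addl i0.
    split; first by rewrite /derivable E.
    by rewrite /derive E.
  have cG : continuous G.
    by move=> s; apply: differentiable_continuous; apply/derivable1_diffP; have [] := dG s.
  rewrite (continuous_FTC2 (F := G) a0b0).
  - rewrite -EFinB lee_fin (le_trans (ler_normB _ _))// (_ : 2 = 1 + 1)//.
    by rewrite lerD// /G.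
  - apply: continuous_subspaceT => s; apply: continuous_comp; last exact: cg.
    exact: continuous_rV_consl.
  - split; first by move=> s _; have [] := dG s.
      by apply: cvg_at_right_filter; exact: cG.
    by apply: cvg_at_left_filter; exact: cG.
  - by move=> s _; rewrite derive1E (derive_val (is_derive := dG s)).
apply; rewrite /D borel_lebesgue_cbox// -EFinM lee_fin ler_wpM2l//.
rewrite [in leRHS]big_mkcond [in leRHS]big_ord_recl /= i0 eqxx mul1r le_eqVlt; apply/orP; left; apply/eqP.
by apply: eq_bigr => k _.
Qed.

End flux_lemma.

(** * Integrals of a continuous function as a set function *)

Section set_integral.
Variables (R : realType) (d : nat) (g : 'rV[R]_d -> R).
Local Notation rV := 'rV[R]_d.
Local Notation mu := (@lebesgue R d).
Local Notation T := (caratheodory_type ((@borel_lebesgue R d)^*)%mu).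
Hypothesis cg : continuous g.

(** Large enough for the unit cube and the extra layer of cells around it, of thickness at most 1; a
    continuous function is bounded on it. *)
Definition window : set rV := cbox (fun=> 0) (fun=> 2).

Lemma fin_meas_window A : lebesgue_measurable A -> A `<=` window -> fin_meas A.
Proof. by move=> mA AW; apply: (fin_measS mA AW); exact: fin_meas_cbox. Qed.

Lemma window_integrable A : lebesgue_measurable A -> A `<=` window ->
  mu.-integrable A (EFin \o g).
Proof.
move=> mA AW; have [M _ gM] := continuous_cbox_bounded (fun=> 0) (fun=> 2) cg.
apply: (@bounded_integrable _ _ _ _ M); first exact: fin_meas_window.
  exact: continuous_lmeas_fun.
by move=> x Ax; apply: gM; exact: AW.
Qed.

Definition set_int (A : set rV) : R := fine (\int[mu]_(x in A) (g x)%:E)%E.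

Lemma set_intE A : lebesgue_measurable A -> A `<=` window ->
  (\int[mu]_(x in A) (g x)%:E = (set_int A)%:E)%E.
Proof.
move=> mA AW; rewrite /set_int fineK//.
exact: (integrable_fin_num mA (window_integrable mA AW)).
Qed.

Lemma set_int_null A B : lebesgue_measurable A -> lebesgue_measurable B ->
  A `<=` window -> B `<=` A -> volume (A `\` B) = 0 -> set_int A = set_int B.
Proof.
move=> mA mB AW BA AB0; rewrite /set_int; congr fine.
have fAB : fin_meas (A `\` B) by apply: fin_measD => //; exact: fin_meas_window.
rewrite (@negligible_integral _ T R mu A (A `\` B) _ fAB.1 mA (window_integrable mA AW)).
  by rewrite setDD setIidr.
by have := volumeE fAB; rewrite AB0.
Qed.

Lemma set_int_bigU (I : finType) (P : pred I) (F : I -> set rV) :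
  (forall i, lebesgue_measurable (F i)) -> (forall i, P i -> F i `<=` window) ->
  (forall i j, i != j -> F i `&` F j = set0) ->
  set_int (\big[setU/set0]_(i | P i) F i) = \sum_(i | P i) set_int (F i).
Proof.
move=> mF FW tF; have UW : \big[setU/set0]_(i | P i) F i `<=` window.
  by rewrite -bigcup_seq_cond => x [i /= /andP[_ Pi] Fx]; exact: FW Fx.
apply/EFin_inj; rewrite -set_intE//; last by apply: lmeas_bigU.
rewrite -sumEFin -big_filter -[RHS]big_filter.
rewrite (@integral_bigsetU_EFin _ T R mu _ F g) //.
- apply: eq_big_seq => i; rewrite mem_filter => /andP[Pi _].
  by rewrite set_intE//; exact: FW.
- by rewrite filter_uniq// index_enum_uniq.
- by move=> i j _ _ [x Fx]; apply/eqP; apply: contraPT Fx => /tF ->.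
- apply/measurable_EFinP; apply: measurable_funS (continuous_lmeas_fun cg) => //.
Qed.

Lemma set_int_flux (i : 'I_d) (phi : rV -> R) (a b : 'I_d -> R) :
  (forall j, a j <= b j) -> cbox a b `<=` window ->
  (forall x, is_derive x (basis_vec R i) phi (g x)) -> (forall x, `|phi x| <= 1) ->
  `|set_int (cbox a b)| <= 2 * \prod_(j | j != i) (b j - a j).
Proof.
move=> ab abW dphi phi1; rewrite -lee_fin -abse_EFin -set_intE//; last exact: lmeas_cbox.
apply: le_trans (flux_le ab cg dphi phi1).
(* Pushed forward by the identity to the Borel sets, the completed measure becomes [borel_lebesgue],
   for which the flux bound is stated. *)
have mid : measurable_fun [set: T] (id : T -> rV).
  by move=> _ Y mY; rewrite setTI; exact: borel_lebesgue_measurable.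
rewrite -(integral_pushforward mid (f := fun x => (g x)%:E) (D := cbox a b)).
- rewrite le_eqVlt; apply/orP; left; apply/eqP; congr (`| _ |)%E.
  apply: eq_measure_integral => A mA _; exact: lebesgueE.
- by apply/measurable_EFinP; exact: continuous_rV_measurable.
- by apply: window_integrable => //; exact: lmeas_cbox.
- exact: measurable_cbox.
Qed.

Lemma set_int_split (a b : 'I_d -> R) i m : (forall j, a j <= b j) -> a i <= m <= b i ->
  cbox a b `<=` window ->
  set_int (cbox a b) = set_int (cbox a (upd b i m)) + set_int (cbox (upd a i m) b).
Proof.
move=> ab aimb abW; have /andP[am mb] := aimb.
have le1 j : a j <= upd b i m j by rewrite /upd; case: eqP => [->|].
have le2 j : upd a i m j <= b j by rewrite /upd; case: eqP => [->|].
have s1 : cbox a (upd b i m) `<=` cbox a b.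
  move=> x /cboxP h; apply/cboxP => j; have /andP[h1 h2] := h j; rewrite h1 /=.
  by move: h2; rewrite /upd; case: eqP => [->|//] /le_trans; apply.
have s2 : cbox (upd a i m) b `<=` cbox a b.
  move=> x /cboxP h; apply/cboxP => j; have /andP[h1 h2] := h j; rewrite h2 andbT.
  by move: h1; rewrite /upd; case: eqP => [->|//] /(le_trans am).
pose o1 := obox a (upd b i m); pose o2 := obox (upd a i m) b.
have e1 : set_int (cbox a (upd b i m)) = set_int o1.
  apply: set_int_null; [exact: lmeas_cbox|exact: lmeas_obox|exact: subset_trans abW|exact: obox_sub|].
  exact: volume_bnd_box.
have e2 : set_int (cbox (upd a i m) b) = set_int o2.
  apply: set_int_null; [exact: lmeas_cbox|exact: lmeas_obox|exact: subset_trans abW|exact: obox_sub|].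
  exact: volume_bnd_box.
pose F (c : bool) := if c then o1 else o2.
have FE : \big[setU/set0]_(c : bool) F c = o1 `|` o2 by rewrite big_bool.
have mF c : lebesgue_measurable (F c) by case: c; exact: lmeas_obox.
have sF c : F c `<=` cbox a b.
  by case: c => x /obox_sub; [exact: s1|exact: s2].
have tF c c' : c != c' -> F c `&` F c' = set0.
  have o12 : o1 `&` o2 = set0.
    apply/seteqP; split=> // x [/oboxP/(_ i)/andP[_ h1] /oboxP/(_ i)/andP[h2 _]].
    by move: h1 h2; rewrite /upd eqxx => h1 /(lt_trans h1); rewrite ltxx.
  by case: c c' => -[]//= _; rewrite // setIC.
rewrite e1 e2 -[LHS](_ : set_int (\big[setU/set0]_(c : bool) F c) = _).
  rewrite set_int_bigU//; first by rewrite big_bool.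
  by move=> c _; exact: subset_trans abW.
apply/esym/set_int_null => //; first exact: lmeas_cbox.
- exact: lmeas_bigU.
- by rewrite FE => x [/(sF true)|/(sF false)].
rewrite FE; have fab := fin_meas_cbox ab.
have mo12 : lebesgue_measurable (o1 `|` o2) by apply: lmeasU; exact: lmeas_obox.
have := volume_split fab mo12.
(* The part outside both open halves is null: [volume_cbox_split], applied to the box itself, shows
   that the halves account for the whole volume. *)
have -> : volume (cbox a b) = volume (cbox a b `&` (o1 `|` o2)); last by lra.
rewrite -{1}[cbox a b]setIid (volume_cbox_split fab ab aimb) setIUr.
rewrite volumeU; first by rewrite !volumeI_box.
- by apply: fin_measI => //; exact: lmeas_obox.
- by apply: fin_measI => //; exact: lmeas_obox.
by rewrite setIACA (tF true false)// setI0.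
Qed.

End set_integral.

Section figure_perimeter.
Variables (R : realType) (d n : nat).
Local Notation rV := 'rV[R]_d.
Local Notation mu := (@lebesgue R d).
Local Notation index n := {ffun 'I_d -> 'I_(2 ^ n)}.
Local Notation h := ((2 ^+ n)^-1 : R).

(* One more layer of cells than [index n]: the layer of coordinate [2 ^ n], which
   lies outside the unit cube, also serves as the layer of coordinate [-1], so
   that neighbours are obtained by a cyclic shift. *)
Definition cyclic_index := {ffun 'I_d -> 'I_(2 ^ n).+1}.

Definition embed (k : index n) : cyclic_index := [ffun j => widen_ord (leqnSn _) (k j)].
Definition next (i : 'I_d) (t : cyclic_index) : cyclic_index :=
  [ffun j => if j == i then ordS (t j) else t j].
Definition previous (i : 'I_d) (t : cyclic_index) : cyclic_index :=
  [ffun j => if j == i then ord_pred (t j) else t j].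

Lemma nextK i : cancel (next i) (previous i).
Proof. by move=> t; apply/ffunP => j; rewrite !ffunE; case: eqP => // _; rewrite ordSK. Qed.

Lemma previousK i : cancel (previous i) (next i).
Proof. by move=> t; apply/ffunP => j; rewrite !ffunE; case: eqP => // _; rewrite ord_predK. Qed.

Definition cell_lo (t : cyclic_index) (j : 'I_d) : R := (t j)%:R / 2 ^+ n.
Definition cell_hi (t : cyclic_index) (j : 'I_d) : R := (t j).+1%:R / 2 ^+ n.
Definition cell t : set rV := cbox (cell_lo t) (cell_hi t).

Lemma cell_embed k : cell (embed k) = dcube k.
Proof.
rewrite dcubeE /cell; congr cbox; apply/funext => j;
  by rewrite /cell_lo /cell_hi ffunE.
Qed.

Lemma cell_le t j : cell_lo t j <= cell_hi t j.
Proof. exact: dyadic_le. Qed.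

Lemma sum_embed (c : pred cyclic_index) (F : cyclic_index -> R) :
  (forall t j, c t -> (t j < 2 ^ n)%N) ->
  \sum_(t | c t) F t = \sum_(k | c (embed k)) F (embed k).
Proof.
move=> cn; have p0 : (0 < 2 ^ n)%N by rewrite expn_gt0.
(* A left inverse of [embed]; the reduction modulo [2 ^ n] serves only to make it total. *)
pose trunc (t : cyclic_index) : index n := [ffun j => Ordinal (ltn_pmod (t j) p0)].
rewrite (reindex_onto embed trunc) => [|t ct]; last first.
  by apply/ffunP => j; apply/val_inj; rewrite !ffunE /= modn_small// cn.
apply: eq_bigl => k; rewrite andb_idr// => _.
by apply/eqP/ffunP => j; apply/val_inj; rewrite !ffunE /= modn_small.
Qed.

Lemma C1c_component (v : rV -> rV) (i : 'I_d) : C1c v -> (forall x, eucl_norm (v x) <= 1) ->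
  [/\ continuous (fun x => 'J v x i i),
      forall x, is_derive x (basis_vec R i) (fun x => v x ord0 i) ('J v x i i) &
      forall x, `|v x ord0 i| <= 1].
Proof.
move=> [dv cJ _] v1; split.
- move=> x; apply: (@continuous_comp _ _ _ (fun x => 'J v x) (fun M : 'M[R]_d => M i i)).
    exact: cJ.
  exact: coord_continuous.
- move=> x; have D := diff_derivable (v := basis_vec R i) (dv x).
  split; first by move/derivable_mxP : D; apply.
  by rewrite jacobian_entry// derive_mx// mxE.
- move=> x; apply: le_trans (v1 x).
  rewrite -sqrtr_sqr /eucl_norm ler_wsqrtr// (bigD1 i)//= lerDl.
  by apply: sumr_ge0 => j _; exact: sqr_ge0.
Qed.

Section one_direction.
Variables (i : 'I_d) (phi g : rV -> R).
Hypothesis cg : continuous g.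
Hypothesis dphi : forall x, is_derive x (basis_vec R i) phi (g x).
Hypothesis phi1 : forall x, `|phi x| <= 1.

Let hi1 (t : cyclic_index) := upd (cell_hi t) i 1.
(** A substitute for the flux through the lower [i]-face of the cell: the integral of [g] from that
    face up to [x_i = 1]. The far side cancels in differences of consecutive rays, and the flux
    bound for a ray does not depend on its length. For [t i = 2 ^ n] the ray is degenerate. *)
Let ray t : R := set_int g (cbox (cell_lo t) (hi1 t)).

Let p2 : 0 < 2 ^+ n :> R. Proof. by rewrite exprn_gt0. Qed.

Let lo_hi1 t j : cell_lo t j <= hi1 t j.
Proof.
rewrite /hi1 /upd; case: eqP => _; last exact: cell_le.
rewrite /cell_lo ler_pdivrMr// mul1r -natrX ler_nat -ltnS; exact: ltn_ord.
Qed.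

Let lo_ge0 t j : 0 <= cell_lo t j.
Proof. by rewrite divr_ge0// ltW. Qed.

Let hi_le2 t j : cell_hi t j <= 2.
Proof.
rewrite ler_pdivrMr// -natrX -natrM ler_nat.
have := ltn_ord (t j); have : (0 < 2 ^ n)%N by rewrite expn_gt0.
lia.
Qed.

Let cbox_window (a b : 'I_d -> R) : (forall j, 0 <= a j) -> (forall j, b j <= 2) ->
  cbox a b `<=` @window R d.
Proof.
move=> a0 b2 x /cboxP h; apply/cboxP => j; have /andP[h1 h2] := h j.
by rewrite (le_trans (a0 j) h1) (le_trans h2 (b2 j)).
Qed.

Let ray_le t : `|ray t| <= 2 * (h ^+ d / h).
Proof.
rewrite (le_trans (set_int_flux cg (lo_hi1 t) _ dphi phi1))//.
  apply: cbox_window => // j; rewrite /hi1 /upd; case: eqP => _; last exact: hi_le2.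
  by rewrite ler1n.
rewrite ler_wpM2l// le_eqVlt; apply/orP; left; apply/eqP.
have -> : h ^+ d = \prod_(j < d) h by rewrite prodr_const card_ord.
rewrite [in RHS](bigD1 i)//= mulrAC divff ?mul1r ?invr_neq0 ?gt_eqF//.
apply: eq_bigr => j /negbTE ji; rewrite /hi1 /upd ji /cell_hi /cell_lo natr_side.
by rewrite addrC addKr.
Qed.

Let cell_ray (t : cyclic_index) : (t i < 2 ^ n)%N -> set_int g (cell t) = ray t - ray (next i t).
Proof.
move=> ti; apply/eqP; rewrite eq_sym subr_eq; apply/eqP.
rewrite /ray (@set_int_split _ _ _ cg _ _ i (cell_hi t i)).
- congr (set_int g _ + set_int g _).
    by congr cbox; apply/funext => j; rewrite /hi1 /upd; case: eqP => // ->.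
  congr cbox; apply/funext => j; rewrite /hi1 /upd /cell_lo /cell_hi ffunE; case: eqP => // ->.
  by rewrite /= modn_small// ltnS.
- exact: lo_hi1.
- rewrite cell_le /hi1 /upd eqxx ler_pdivrMr// mul1r -natrX ler_nat//.
- apply: cbox_window => // j; rewrite /hi1 /upd; case: eqP => _; last exact: hi_le2.
  by rewrite ler1n.
Qed.

(** Summation by parts: each selected cell contributes [ray t - ray (next i t)], and a cyclic shift
    of the second sum leaves a ray only where the selection changes between [previous i t] and [t].
    Here [h ^+ d / h] is the area of a face. *)
Lemma set_int_figure_le (c : pred cyclic_index) : (forall t j, c t -> (t j < 2 ^ n)%N) ->
  set_int g (figure (fun k => c (embed k))) <=
  2 * (h ^+ d / h) * \sum_t (c t != c (previous i t))%:R.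
Proof.
move=> cn; pose S k := c (embed k).
have FW : figure S `<=` @window R d.
  move=> x /figure_sub_unit xu; apply/cboxP => j; have /andP[-> h2] := xu j.
  by rewrite (le_trans h2)// ler1n.
have oW k : ocube k `<=` @window R d.
  move=> x /obox_sub xk; have /dcube_sub_unit xu : dcube k x by rewrite dcubeE.
  by apply/cboxP => j; have /andP[-> h2] := xu j; rewrite (le_trans h2)// ler1n.
have dW k : dcube k `<=` @window R d.
  move=> x /dcube_sub_unit xu.
  by apply/cboxP => j; have /andP[-> h2] := xu j; rewrite (le_trans h2)// ler1n.
have -> : set_int g (figure S) = \sum_(k | S k) set_int g (dcube k).
  rewrite (@set_int_null _ _ _ cg _ (\big[setU/set0]_(k | S k) ocube k)) //; first last.
  - apply/eqP; rewrite eq_le volume_ge0 andbT.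
    rewrite -(volume_cover_cells n (@fin_meas_figure R d n S) (@figure_sub_unit R d n S)).
    apply: volume_le.
    + by apply: lmeasD; [exact: lmeas_figure|apply: lmeas_bigU => k _; exact: lmeas_ocube].
    + move=> x [Fx nx]; split=> //; rewrite -bigcup_seq => -[k _ kx].
      have : (figure S `&` ocube k) x by [].
      rewrite figureI_ocube; case: ifP => // Sk _; apply: nx.
      by rewrite -bigcup_seq_cond; exists k => //=; rewrite mem_index_enum.
    + apply: fin_measD; first exact: fin_meas_figure.
      by apply: lmeas_bigU => k _; exact: lmeas_ocube.
  - rewrite -bigcup_seq_cond => x [k /= /andP[_ Sk] kx]; apply/figureP; exists k => //.
    by rewrite dcubeE; exact: obox_sub.
  - by apply: lmeas_bigU => k _; exact: lmeas_ocube.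
  - exact: lmeas_figure.
  rewrite set_int_bigU//; [|exact: lmeas_ocube|exact: ocube_disjoint].
  apply: eq_bigr => k _; apply/esym/set_int_null => //.
  - exact: lmeas_dcube.
  - exact: lmeas_ocube.
  - by rewrite dcubeE; exact: obox_sub.
  - by rewrite dcubeE; apply: volume_bnd_box => j; exact: dyadic_le.
under eq_bigr do rewrite -cell_embed.
rewrite -(sum_embed (fun t => set_int g (cell t)) cn).
rewrite (eq_bigr (fun t => ray t - ray (next i t))); last first.
  by move=> t /cn ct; exact: cell_ray.
rewrite sumrB [X in _ - X](reindex (previous i)); last first.
  by exists (next i) => t _; [exact: previousK|exact: nextK].
rewrite big_mkcond [X in _ - X]big_mkcond /= -sumrB mulr_sumr; apply: ler_sum => t _.
rewrite previousK; have := ray_le t; rewrite ler_norml => /andP[r1 r2].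
by case: (c t); case: (c (previous i t)); rewrite ?mulr1 ?mulr0 ?subrr ?subr0 ?sub0r//; lra.
Qed.

End one_direction.

Lemma perimeter_figure_le (c : pred cyclic_index) : (forall t j, c t -> (t j < 2 ^ n)%N) ->
  (perimeter (@figure R d n (fun k => c (embed k))) <=
   (2 * (h ^+ d / h) * \sum_i \sum_t (c t != c (previous i t))%:R)%:E)%E.
Proof.
move=> cn; set S := fun k => c (embed k).
apply: ge_ereal_sup => _ [v [Cv v1] <-].
have FW : figure S `<=` @window R d.
  move=> x /figure_sub_unit xu; apply/cboxP => j; have /andP[-> h2] := xu j.
  by rewrite (le_trans h2)// ler1n.
have mF : lebesgue_measurable (@figure R d n S) by exact: lmeas_figure.
have -> : (\int[mu]_x (\1_(figure S) x * divergence v x)%:E =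
    \int[mu]_(x in figure S) (\sum_i ('J v x i i)%:E))%E.
  rewrite [RHS]integral_mkcond; apply: eq_integral => x _.
  rewrite /patch indicE /divergence /mxtrace sumEFin.
  by case: (x \in _); rewrite ?mul1r ?mul0r.
have comp i := C1c_component i Cv v1.
rewrite (@integral_sum _ _ R mu _ mF 'I_d (fun i x => ('J v x i i)%:E)); last first.
  by move=> i; have [cJ _ _] := comp i; exact: (window_integrable cJ mF FW).
rewrite mulr_sumr -sumEFin; apply: lee_sum => i _; have [cJ dJ J1] := comp i.
by rewrite (set_intE cJ mF FW) lee_fin; exact: set_int_figure_le dJ J1 _ cn.
Qed.

End figure_perimeter.

(** * Approximation by dyadic figures *)

Section dyadic_density.
Variables (R : realType) (d : nat).
Local Notation rV := 'rV[R]_d.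
Local Notation mu := (@lebesgue R d).
Local Notation T := (caratheodory_type ((@borel_lebesgue R d)^*)%mu).
Local Notation index n := {ffun 'I_d -> 'I_(2 ^ n)}.
Local Notation U := (@unit_cube R d).

Lemma dcube_children n (k : index n) :
  @dcube R d n k = figure (fun l : index n.+1 => parent l == k).
Proof.
apply/seteqP; split=> [x|x /figureP[l /eqP <-]]; last first.
  by rewrite -{1}(parentK l); exact: child_sub.
rewrite {1}dcubeE => /cboxP xk; apply/figureP.
pose a : {ffun 'I_d -> bool} := [ffun j => (k j)%:R / 2 ^+ n + (2 ^+ n)^-1 / 2 < x ord0 j].
exists (child k a); first by rewrite childK.
rewrite dcubeE; apply/cboxP => j; have := xk j; rewrite !natr_side child_lo sideS ffunE.
case: ltP; rewrite ?mul1r ?mul0r => h1 /andP[h2 h3]; apply/andP; split; lra.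
Qed.

Lemma figure_refine n (S : pred (index n)) :
  @figure R d n S = figure (fun l : index n.+1 => S (parent l)).
Proof.
apply/seteqP; split=> x /figureP.
  move=> [k Sk]; rewrite dcube_children => /figureP[l /eqP lk xl].
  by apply/figureP; exists l => //; rewrite lk.
move=> [l Sl xl]; apply/figureP; exists (parent l) => //.
by rewrite dcube_children; apply/figureP; exists l.
Qed.

Lemma figure_refine_le m n (S : pred (index m)) : (m <= n)%N ->
  exists S' : pred (index n), @figure R d m S = figure S'.
Proof.
move=> /subnKC <-; elim: (n - m)%N => [|p [S' IH]].
  by rewrite addn0; exists S.
by rewrite addnS; exists (fun l => S' (parent l)); rewrite IH figure_refine.
Qed.

(** The error splits into independent costs, one per cell, which allows selections to be compared
    cell by cell. *)
Lemma volume_symdiff_figure n (S : pred (index n)) B : fin_meas B -> B `<=` U ->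
  volume (B `+` figure S) = \sum_(k : index n)
    (if S k then (2 ^+ n)^-1 ^+ d - volume (B `&` dcube k) else volume (B `&` dcube k)).
Proof.
move=> fB BU; have fS : fin_meas (@figure R d n S) by exact: fin_meas_figure.
have fBS := fin_meas_symdiff fB fS.
have BSU : B `+` figure S `<=` U.
  by move=> x [[/BU]|[/figure_sub_unit]].
rewrite -(sum_volume_cells n fBS BSU); apply: eq_bigr => k _.
have fk : fin_meas (dcube k : set rV) by exact: fin_meas_dcube.
have fo : fin_meas (ocube k : set rV).
  apply: (fin_measS _ _ fk); first exact: lmeas_ocube.
  by rewrite dcubeE; exact: obox_sub.
rewrite -volumeI_ocube//; case: ifPn => Sk.
  have -> : (B `+` figure S) `&` ocube k = ocube k `\` B.
    apply/seteqP; split=> x [].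
      by move=> [[Bx nF] kx|[Fx nB] kx] //; exfalso; apply: nF; apply/figureP;
        exists k => //; rewrite dcubeE; exact: obox_sub.
    move=> kx nB; split=> //; right; split=> //; apply/figureP; exists k => //.
    by rewrite dcubeE; exact: obox_sub.
  have := volume_split fo fB.1; rewrite setIC volumeI_ocube//.
  have <- : volume (dcube k : set rV) = volume (ocube k : set rV).
    by rewrite -(setIid (dcube k)) -volumeI_ocube// setIidr// dcubeE; exact: obox_sub.
  by rewrite volume_dcube => ->; ring.
have -> : (B `+` figure S) `&` ocube k = B `&` ocube k.
  have nF (x : rV) : ocube k x -> ~ figure S x.
    move=> kx Fx; have : (figure S `&` ocube k) x by [].
    by rewrite figureI_ocube (negbTE Sk).
  apply/seteqP; split=> x [].
    by move=> [[Bx _] kx|[Fx _] kx] //; case: (nF _ kx).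
  by move=> Bx kx; split=> //; left; split=> //; exact: nF.
exact: volumeI_ocube.
Qed.

(** The sets with this property form a sigma-algebra containing the coordinate half-spaces, hence
    all Borel sets. Intersecting with [U] allows complements to be taken in the whole space. *)
Definition dyadic_approx (A : set rV) := lebesgue_measurable A /\
  forall e : R, 0 < e -> exists n (S : pred (index n)), volume ((A `&` U) `+` figure S) <= e.

Let fU : fin_meas U. Proof. exact: fin_meas_unit_cube. Qed.

Let fAU A : lebesgue_measurable A -> fin_meas (A `&` U).
Proof. by move=> mA; rewrite setIC; exact: fin_measI. Qed.

(** With the opposite selection, the error in each cell is unchanged. *)
Lemma dyadic_approxC A : dyadic_approx A -> dyadic_approx (~` A).
Proof.
move=> [mA hA]; have mCA : lebesgue_measurable (~` A) by exact: measurableC.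
split=> // e /hA[n [S h]]; exists n, (fun k => ~~ S k).
rewrite volume_symdiff_figure in h; [|exact: fAU|exact: subIsetr].
rewrite volume_symdiff_figure; [|exact: fAU|exact: subIsetr].
apply: le_trans h; rewrite le_eqVlt; apply/orP; left; apply/eqP; apply: eq_bigr => k _.
have fk : fin_meas (dcube k : set rV) by exact: fin_meas_dcube.
have kU (D : set rV) : D `&` U `&` dcube k = dcube k `&` D.
  apply/seteqP; split=> [x [[? _] ?]|x [kx ?]] //.
  by split=> //; split=> //; exact: dcube_sub_unit kx.
have := volume_split fk mA; rewrite !kU setDE volume_dcube.
by case: (S k) => /= ->; ring.
Qed.

Lemma dyadic_approxU A A' : dyadic_approx A -> dyadic_approx A' -> dyadic_approx (A `|` A').
Proof.
move=> [mA hA] [mA' hA']; have mAA' : lebesgue_measurable (A `|` A') by exact: lmeasU.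
split=> // e e0; have e2 : 0 < e / 2 by rewrite divr_gt0.
have [n [S hS]] := hA _ e2; have [n' [S' hS']] := hA' _ e2.
have [S1 E1] := figure_refine_le S (leq_maxl n n').
have [S2 E2] := figure_refine_le S' (leq_maxr n n').
rewrite E1 in hS; rewrite E2 in hS'.
exists (maxn n n'), (fun k => S1 k || S2 k).
have f1 : fin_meas (A `&` U `+` figure S1) by apply: fin_meas_symdiff; [exact: fAU|exact: fin_meas_figure].
have f2 : fin_meas (A' `&` U `+` figure S2) by apply: fin_meas_symdiff; [exact: fAU|exact: fin_meas_figure].
apply: (@le_trans _ _ (volume ((A `&` U `+` figure S1) `|` (A' `&` U `+` figure S2)))).
  apply: volume_le; last exact: fin_measU.
    by apply: (proj1 (fin_meas_symdiff _ _)); [exact: fAU|exact: fin_meas_figure].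
  move=> x; have F12 : figure (fun k => S1 k || S2 k) x <-> figure S1 x \/ figure S2 x.
    split=> [/figureP[k /orP[Sk|Sk] xk]|[|] /figureP[k Sk xk]].
    - by left; apply/figureP; exists k.
    - by right; apply/figureP; exists k.
    - by apply/figureP; exists k; rewrite ?Sk.
    - by apply/figureP; exists k; rewrite ?Sk ?orbT.
  have := F12; rewrite /setY /setU /setD /setI /=.
  by case: (pselect (figure S1 x)); case: (pselect (figure S2 x)); tauto.
rewrite (volume_split (fin_measU f1 f2) f1.1).
apply: (@le_trans _ _ (volume (A `&` U `+` figure S1) + volume (A' `&` U `+` figure S2))).
  apply: lerD; apply: volume_le => //.
  - by apply: lmeasI; [exact: (fin_measU f1 f2).1|exact: f1.1].
  - by apply: lmeasD; [exact: (fin_measU f1 f2).1|exact: f1.1].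
  - by move=> x [[|]].
by lra.
Qed.

Lemma dyadic_approx0 : dyadic_approx set0.
Proof.
split=> [|e e0]; first exact: lmeas0.
have f0 : fin_meas (set0 `&` U) by apply: fAU; exact: lmeas0.
exists 0%N, pred0; rewrite volume_symdiff_figure//.
by rewrite big1 ?ltW// => k _; rewrite /= !set0I volume0.
Qed.

Lemma dyadic_approx_bigcup (A : nat -> set rV) :
  (forall n, dyadic_approx (A n)) -> dyadic_approx (\bigcup_n A n).
Proof.
move=> hA; pose F m := \big[setU/set0]_(j < m) A j.
have hF m : dyadic_approx (F m).
  elim: m => [|m IH]; first by rewrite /F big_ord0; exact: dyadic_approx0.
  by rewrite /F big_ord_recr; exact: dyadic_approxU.
have mAA : lebesgue_measurable (\bigcup_n A n).
  by apply: (@bigcupT_measurable _ T) => n; exact: (hA n).1.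
split=> // e e0; have e2 : 0 < e / 2 by rewrite divr_gt0.
have UF : \bigcup_m (F m `&` U) = (\bigcup_n A n) `&` U.
  rewrite -setI_bigcupl; congr (_ `&` _); apply/seteqP; split=> [x [m _]|x [m _ Ax]].
    by rewrite /F -bigcup_mkord => -[j _ Ax]; exists j.
  by exists m.+1 => //; rewrite /F -bigcup_mkord; exists m => /=.
have cvF : mu \o (fun m => F m `&` U) @ \oo --> mu (\bigcup_m (F m `&` U)).
  apply: (@nondecreasing_cvg_mu _ T R mu).
  - by move=> m; exact: (fAU (hF m).1).1.
  - by rewrite UF; exact: (fAU mAA).1.
  - apply/nondecreasing_seqP => m; apply/subsetPset => x [Fx Ux]; split=> //.
    by rewrite /F big_ord_recr; left.
rewrite UF (volumeE (fAU mAA)) in cvF.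
have cvF' : (fun m => volume (F m `&` U)) @ \oo --> volume ((\bigcup_n A n) `&` U).
  exact: (fine_cvg cvF).
have /cvgrPdist_le/(_ _ e2)[m _ /(_ m (leqnn m))] := cvF'.
rewrite /= => hm.
have [n [S hS]] := (hF m).2 _ e2; exists n, S.
pose D := ((\bigcup_n A n) `&` U) `\` (F m `&` U).
have FA : F m `&` U `<=` (\bigcup_n A n) `&` U by rewrite -UF => x Fx; exists m.
have mF := (fAU (hF m).1).1; have fA := fAU mAA.
have fD : fin_meas D by exact: fin_measD.
have vD : volume D <= e / 2.
  have := volume_split fA mF; rewrite (setIidr FA) -/D => E.
  by apply: le_trans hm; rewrite E addrAC subrr add0r ler_norm.
have fFS : fin_meas (F m `&` U `+` figure S).
  by apply: fin_meas_symdiff; [exact: fAU (hF m).1|exact: fin_meas_figure].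
have fAS : fin_meas ((\bigcup_n A n) `&` U `+` figure S).
  by apply: fin_meas_symdiff => //; exact: fin_meas_figure.
rewrite (volume_split fAS fD.1) [e](_ : _ = e / 2 + e / 2); last by lra.
apply: lerD.
  by apply: le_trans vD; apply: volume_le => //; exact: lmeasI fAS.1 fD.1.
apply: le_trans hS; apply: volume_le => //; first exact: lmeasD fAS.1 fD.1.
move=> x [[[Ax nS]|[Sx nA]] nD].
  left; split=> //; apply: contrapT => nF; apply: nD; split=> //.
by right; split=> // /FA.
Qed.

Lemma dyadic_approx_halfspace (i : 'I_d) (c : R) :
  dyadic_approx [set x : rV | c < x ord0 i].
Proof.
set A := [set x | _]; have mA : lebesgue_measurable A.
  apply: borel_lebesgue_measurable.
  rewrite (_ : A = rV_coord i @^-1` `]c, +oo[%classic).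
    rewrite -[X in measurable X]setTI.
    exact: (@measurable_rV_coord R d i measurableT _ (measurable_itv `]c, +oo[)).
  by apply/seteqP; split=> x; rewrite /A /rV_coord /= in_itv/= andbT.
split=> // e e0.
have [n hn] : exists n, 2 * (2 ^+ n)^-1 <= e.
  have cv : (fun n => 2 * (2^-1 : R) ^+ n) @ \oo --> 0.
    by apply: cvg_geometric; rewrite ger0_norm ?invr_ge0// invf_lt1// ltr1n.
  have /cvgrPdist_le/(_ _ e0)[n _ /(_ n (leqnn n))] := cv.
  rewrite /= sub0r normrN => h; exists n; apply: le_trans h.
  by rewrite -exprVn ler_norm.
exists n, (fun k : index n => c < (k i)%:R / 2 ^+ n).
set F := figure _; pose h := (2 ^+ n)^-1 : R; have h0 : 0 < h by exact: side_gt0.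
(* Outside the null set [N], a point missed by the figure lies in an open cell whose lower face is
   at most [c], hence within [h] of the hyperplane. *)
pose slab : set rV := cbox (upd (fun=> 0) i (c - h)) (upd (fun=> 1) i (c + h)).
pose N := U `\` \big[setU/set0]_(k : index n) ocube k.
have ab j : upd (fun=> 0) i (c - h) j <= upd (fun=> 1) i (c + h) j.
  by rewrite /upd; case: eqP => // _; rewrite ?ler01//; lra.
have fs : fin_meas slab by exact: fin_meas_cbox.
have mO : lebesgue_measurable (\big[setU/set0]_(k : index n) (ocube k : set rV)).
  by apply: lmeas_bigU => k _; exact: lmeas_ocube.
have fN : fin_meas N by exact: fin_measD.
have fAF : fin_meas (A `&` U `+` F).
  by apply: fin_meas_symdiff; [exact: fAU|exact: fin_meas_figure].
apply: (@le_trans _ _ (volume (slab `|` N))).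
  apply: volume_le; [exact: fAF.1| |exact: fin_measU].
  move=> x [[[Ax Ux] nF]|[Fx nAU]]; last first.
    exfalso; apply: nAU; split; last exact: figure_sub_unit Fx.
    move/figureP : Fx => [k ck]; rewrite dcubeE => /cboxP/(_ i)/andP[h1 _].
    exact: lt_le_trans ck h1.
  have [[k kx]|nk] := pselect (exists k : index n, ocube k x); last first.
    right; split=> //; rewrite -bigcup_seq => -[k _ kx]; apply: nk; by exists k.
  left; apply/cboxP => j; rewrite /upd; case: eqP => [->|_]; last exact: Ux.
  have nck : (k i)%:R / 2 ^+ n <= c.
    rewrite leNgt; apply/negP => ck; apply: nF; apply/figureP; exists k => //.
    by rewrite dcubeE; exact: obox_sub.
  have near (lo y s : R) : lo <= c -> c < y -> lo < y < lo + s -> c - s <= y <= c + s.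
    by move=> ? ? /andP[? ?]; apply/andP; split; lra.
  by move/oboxP : kx => /(_ i); rewrite natr_side; exact: near.
rewrite (volume_split (fin_measU fs fN) fs.1) -[e]addr0; apply: lerD.
  apply: le_trans hn.
  apply: (@le_trans _ _ (volume slab)).
    by apply: volume_le => //; exact: lmeasI (fin_measU fs fN).1 fs.1.
  rewrite volume_cbox// (bigD1 i)//= big1; last first.
    by move=> j /negbTE ji; rewrite /upd ji subr0.
  by rewrite /upd eqxx -/h; lra.
rewrite -(volume_cover_cells n fU (@subset_refl _ U)) -/N; apply: volume_le => //.
  exact: lmeasD (fin_measU fs fN).1 fs.1.
by move=> x [[]].
Qed.

Lemma borel_dyadic_approx (A : set rV) : measurable A -> dyadic_approx A.
Proof.
suff : g_sigma_preimage (@rV_coord R d) `<=` dyadic_approx by apply.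
apply: smallest_sub.
  split.
  - exact: dyadic_approx0.
  - by move=> B hB; rewrite setTD; exact: dyadic_approxC.
  - exact: dyadic_approx_bigcup.
move=> B; rewrite -bigcup_seq => -[i _] [C mC <-] /=; rewrite setTI.
rewrite RGenOInfty.measurableE in mC.
have : <<s @RGenOInfty.G R >> `<=` [set C | dyadic_approx (rV_coord i @^-1` C)].
  apply: smallest_sub.
    split.
    - by rewrite /= preimage_set0; exact: dyadic_approx0.
    - by move=> D hD /=; rewrite setTD preimage_setC; exact: dyadic_approxC.
    - by move=> D hD /=; rewrite preimage_bigcup; exact: dyadic_approx_bigcup.
  move=> _ [c ->] /=.
  rewrite (_ : _ @^-1` _ = [set x : rV | c < x ord0 i]); first exact: dyadic_approx_halfspace.
  by apply/seteqP; split=> x; rewrite /rV_coord /= in_itv/= andbT.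
by apply.
Qed.

Lemma dyadic_dense (B : set rV) (e : R) : lebesgue_measurable B -> B `<=` U -> 0 < e ->
  exists n (S : pred (index n)), volume (B `+` figure S) <= e.
Proof.
move=> mB BU e0; have e2 : 0 < e / 2 by rewrite divr_gt0.
have fB : fin_meas B by exact: fin_measS mB BU fU.
have fin : mu B \is a fin_num by rewrite volumeE.
(* The outer measure is an infimum over countable Borel covers, so some Borel set [A] contains [B]
   with an excess of at most [e / 2]. *)
have [_ [C [mC BC] <-] hC] := lb_ereal_inf_adherent e2 fin.
pose A := \bigcup_k C k; have BA : B `<=` A by exact: BC.
have mA : measurable A by exact: bigcupT_measurable.
have lA := borel_lebesgue_measurable mA.
have muA : (mu A <= mu B + (e / 2)%:E)%E.
  apply: le_trans (ltW hC); rewrite lebesgueE//.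
  exact: measure_sigma_subadditive.
have fA : fin_meas A.
  by split=> //; apply: le_lt_trans muA _; rewrite volumeE// -EFinD ltry.
rewrite !volumeE// -EFinD lee_fin in muA.
have vAB : volume (A `\` B) <= e / 2.
  by have := volume_split fA mB; rewrite (setIidr BA) => E; lra.
have [n [S hS]] := (borel_dyadic_approx mA).2 _ e2; exists n, S.
have fS : fin_meas (@figure R d n S) by exact: fin_meas_figure.
have fAB : fin_meas (A `\` B) by exact: fin_measD.
have fBS := fin_meas_symdiff fB fS.
rewrite (volume_split fBS fAB.1) [e](_ : _ = e / 2 + e / 2); last by lra.
apply: lerD.
  by apply: le_trans vAB; apply: volume_le => //; exact: lmeasI fBS.1 fAB.1.
apply: le_trans hS; apply: volume_le; last exact: fin_meas_symdiff (fAU lA) fS.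
  exact: lmeasD fBS.1 fAB.1.
move=> x [[[Bx nS]|[Sx nB]] nAB].
  by left; split=> //; split; [exact: BC|exact: BU].
by right; split=> // -[Ax _]; apply: nAB.
Qed.

End dyadic_density.

(** * Choice of a threshold by averaging *)

Section threshold.
Variable R : realType.

(* A discrete coarea formula: integrating the left-hand side over all [t] gives at
   most [\sum_p `|a p - b p|]. *)
Lemma exists_threshold (I : finType) (a b : I -> R) :
  exists2 t : R, 4^-1 <= t <= 3 / 4 &
  \sum_p ((t < a p) != (t < b p))%:R <= 2 * \sum_p `|a p - b p| + 1.
Proof.
pose L := \sum_p `|a p - b p|; apply: contrapT => no.
(* The half-open interval of the [t] for which [t < a p] and [t < b p] disagree. *)
pose J p : set (measurableTypeR R) := `[Num.min (a p) (b p), Num.max (a p) (b p)[%classic.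
pose D : set (measurableTypeR R) := `[4^-1, 3 / 4]%classic.
have mJ p : measurable (J p) by exact: measurable_itv.
have mD : measurable D by exact: measurable_itv.
have L0 : 0 <= L by exact: sumr_ge0.
have low t : D t -> 2 * L + 1 <= \sum_p \1_(J p) t.
  rewrite /D /= in_itv /= => t13; rewrite leNgt; apply/negP => h; apply: no; exists t => //.
  apply: ltW; apply: le_lt_trans h; apply: ler_sum => p _.
  rewrite indicE ler_nat; case: (boolP (_ != _)) => // hne.
  rewrite mem_set// /J /= in_itv /=.
  move: hne; have [ta|ta] := ltP t (a p); have [tb|tb] := ltP t (b p); rewrite ?eqxx// => _.
    by rewrite ge_min tb orbT lt_max ta.
  by rewrite ge_min ta lt_max tb orbT.
(* [D] has length 1/2, so the left-hand side is [L + 1/2], while the integral is at most the sum [L]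
   of the lengths of the [J p]. Hence the factor 2 and the slack 1 of the statement. *)
have : ((2 * L + 1)%:E * lebesgue_measure D <=
    \int[@lebesgue_measure R]_(t in D) (\sum_p \1_(J p) t)%:E)%E.
  rewrite -integral_cst//; apply: ge0_le_integral => //.
  - by move=> t _; rewrite lee_fin; lra.
  - by apply/measurable_EFinP; apply: measurable_sum => p; exact: measurable_indic.
apply/negP; rewrite -ltNge.
have -> : (\int[@lebesgue_measure R]_(t in D) (\sum_p \1_(J p) t)%:E =
    \sum_p lebesgue_measure (J p `&` D))%E.
  under eq_integral do rewrite -sumEFin.
  rewrite ge0_integral_sum//.
  - by apply: eq_bigr => p _; rewrite integral_indic.
  - by move=> p; apply/measurable_EFinP; exact: measurable_indic.
apply: (@le_lt_trans _ _ L%:E).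
  rewrite /L -sumEFin; apply: lee_sum => p _.
  apply: (@le_trans _ _ (lebesgue_measure (J p))).
    by apply: le_measure; rewrite ?inE//; exact: measurableI.
  rewrite /J lebesgue_measure_itv /= lte_fin.
  case: ifPn => // _; rewrite -EFinB lee_fin.
  by rewrite /Num.max /Num.min; case: ltP => h; [rewrite distrC|]; rewrite ger0_norm//; lra.
rewrite /D lebesgue_measure_itv /= lte_fin ifT; last by lra.
by rewrite -EFinB -EFinM lte_fin; lra.
Qed.

End threshold.

(** * Quasi-optimal figures of controlled perimeter *)

Section figure_approximation.
Variables (R : realType) (d : nat).
Local Notation rV := 'rV[R]_d.
Local Notation mu := (@lebesgue R d).
Local Notation index n := {ffun 'I_d -> 'I_(2 ^ n)}.
Local Notation U := (@unit_cube R d).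

Lemma figure_BV n (S : pred (index n)) : BV_cube (@figure R d n S).
Proof.
have p0 : (0 < 2 ^ n)%N by rewrite expn_gt0.
split; last exact: figure_sub_unit.
split; first exact: lmeas_figure.
- have : bounded_set U by apply: compact_bounded; rewrite unit_cubeE; exact: compact_cbox.
  by apply: sub_boundedr => M MU x /figure_sub_unit; exact: MU.
pose trunc (t : cyclic_index d n) : index n := [ffun j => Ordinal (ltn_pmod (t j) p0)].
pose c (t : cyclic_index d n) := [forall j, (t j < 2 ^ n)%N] && S (trunc t).
have cn t j : c t -> (t j < 2 ^ n)%N by move=> /andP[/forallP].
apply: le_lt_trans (ltry _); apply: le_trans (perimeter_figure_le R cn).
rewrite (_ : figure S = figure (fun k => c (embed k)))//.
rewrite /figure; apply: eq_bigl => k; rewrite /c.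
have -> : [forall j, (embed k j < 2 ^ n)%N] by apply/forallP => j; rewrite ffunE /=.
congr (S _); apply/ffunP => j; apply/val_inj; rewrite !ffunE /= modn_small//.
Qed.

Section one_scale.
Variables (B : set rV) (P : R) (n : nat).
Hypothesis d1 : (1 <= d)%N.
Hypothesis fB : fin_meas B.
Hypothesis BU : B `<=` U.
Hypothesis PB : (perimeter B <= P%:E)%E.
Local Notation h := ((2 ^+ n)^-1 : R).

Let a (t : cyclic_index d n) : R := volume (B `&` @cell R d n t) / h ^+ d.
Let h0 : 0 < h. Proof. exact: side_gt0. Qed.
Let hd0 : 0 < h ^+ d. Proof. exact: exprn_gt0. Qed.

(** Such a cell meets the unit cube at most in its null face [x_j = 1]. *)
Let a_out (t : cyclic_index d n) (j : 'I_d) : (2 ^ n <= t j)%N -> volume (B `&` @cell R d n t) = 0.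
Proof.
move=> tj; apply/eqP; rewrite eq_le volume_ge0 andbT.
have tjE : (t j : nat) = (2 ^ n)%N by apply/eqP; rewrite eqn_leq tj -ltnS ltn_ord.
have lo1 : @cell_lo R d n t j = 1.
  by rewrite /cell_lo tjE natrX divff//; exact: exp2n_neq0.
have ab k : @cell_lo R d n t k <= upd (@cell_hi R d n t) j 1 k.
  by rewrite /upd; case: eqP => [->|_]; [rewrite lo1|exact: cell_le].
rewrite (_ : 0 = volume (cbox (@cell_lo R d n t) (upd (@cell_hi R d n t) j 1))).
  apply: volume_le; last exact: fin_meas_cbox.
    by apply: lmeasI; [exact: fB.1|exact: lmeas_cbox].
  move=> x [/BU xu /cboxP xc]; apply/cboxP => k; have /andP[h1 h2] := xc k.
  rewrite h1 /upd; case: eqP => [->|_] //; by have /andP[] := xu j.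
by rewrite volume_cbox// (bigD1 j)//= /upd eqxx lo1 subrr mul0r.
Qed.

(** Boxes of length [2 * h] along [i], shifted by [- h], have the cell [t] as right half and its
    predecessor as left half. For [t i = 0] the left half lies outside the unit cube, and the cyclic
    predecessor is in the extra layer: both volumes are 0. *)
Let left_volume (i : 'I_d) (t : cyclic_index d n) : volume (B `&` left_box h (fun j => if j == i then - h else 0)
    (fun j => if j == i then 2 * h else h) i t) = volume (B `&` @cell R d n (previous i t)).
Proof.
have [ti0|ti0] := posnP (t i).
  rewrite (@a_out _ i); last by rewrite ffunE eqxx /= ti0 add0n /= modn_small.
  rewrite (_ : _ `&` _ = set0) ?volume0//; apply/seteqP; split=> // x [/BU xu /(_ i)].
  have /andP[x0 _] := xu i.
  by rewrite eqxx /= in_itv /= /grid_lo eqxx ti0 mul0r addr0 => /andP[_]; lra.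
rewrite /cell -volumeI_box//; last by move=> j; exact: cell_le.
congr (volume (_ `&` box _)); apply/funext => j; rewrite /grid_lo /cell_lo /cell_hi natr_side ffunE.
case: eqP => [->|_]; last by rewrite add0r.
have -> : (ord_pred (t i) : nat) = (t i).-1.
  by rewrite /= -(prednK ti0) addSn /= modnDr modn_small// prednK// ltnW// ltn_ord.
have -> : (t i)%:R = (t i).-1%:R + 1 :> R by rewrite natr1 prednK.
have -> : - h + ((t i).-1%:R + 1) * h = (t i).-1%:R / 2 ^+ n by ring.
by rewrite mulrAC divff// mul1r.
Qed.

Let right_volume (i : 'I_d) (t : cyclic_index d n) : volume (B `&` right_box h (fun j => if j == i then - h else 0)
    (fun j => if j == i then 2 * h else h) i t) = volume (B `&` @cell R d n t).
Proof.
rewrite /cell -volumeI_box//; last by move=> j; exact: cell_le.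
congr (volume (_ `&` box _)); apply/funext => j; rewrite /grid_lo /cell_lo /cell_hi natr_side.
case: eqP => [->|_]; last by rewrite add0r.
rewrite [2 * h / 2]mulrAC divff// mul1r.
have -> : - h + (t i)%:R * h + h = (t i)%:R / 2 ^+ n by ring.
by have -> : - h + (t i)%:R * h + 2 * h = (t i)%:R / 2 ^+ n + h by ring.
Qed.

Let sum_a_le (i : 'I_d) :
  \sum_t `|a t - a (previous i t)| <= 4 ^+ d * (2 * h) * P / h ^+ d.
Proof.
have H := @grid_estimate R d B P fB PB (2 ^ n).+1 h (fun j => if j == i then - h else 0)
  (fun j => if j == i then 2 * h else h) i.
rewrite eqxx in H.
rewrite ler_pdivlMr// mulr_suml; apply: le_trans (H _ _).
- apply: ler_sum => t _; rewrite left_volume right_volume /a.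
  by rewrite -mulrBl normrM (gtr0_norm (_ : 0 < (h ^+ d)^-1)) ?invr_gt0// divfK ?gt_eqF// distrC.
- by move=> j; case: (j == i); rewrite ?mulr_gt0.
- by move=> j; case: (j == i) => //; rewrite ler_peMl ?(ltW h0)// ler1n.
Qed.

(** The constant is [2 h^(d - 1)] per face times the number of faces: twice the bound
    [d 4^d (2 h) P / h^d] on the sum of jumps, plus 1. The last term uses [h^(d - 1) <= 1]. *)
Lemma figure_approx : exists S : pred (index n),
  (perimeter (@figure R d n S) <= (8 * d%:R * 4 ^+ d * P + 2)%:E)%E /\
  forall G : pred (index n), volume (B `+` figure S) <= 3 * volume (B `+` figure G).
Proof.
have [t /andP[t1 t3] hN] := exists_threshold
  (fun p : 'I_d * cyclic_index d n => a p.2) (fun p => a (previous p.1 p.2)).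
pose c s := t < a s.
(* The threshold is positive, so the extra layer, where the density is 0, is never selected. *)
have cn s j : c s -> (s j < 2 ^ n)%N.
  move=> cs; rewrite ltnNge; apply/negP => /a_out v0.
  by move: cs; rewrite /c /a v0 mul0r; lra.
exists (fun k => c (embed k)); split.
  apply: le_trans (perimeter_figure_le R cn) _; rewrite lee_fin.
  rewrite (pair_bigA _ (fun i s => (c s != c (previous i s))%:R))/=.
  have hd1 : h ^+ d / h <= 1.
    rewrite -(prednK d1) exprS mulrC mulKf ?gt_eqF//.
    apply: exprn_ile1; first exact: ltW.
    by rewrite invf_le1 ?exprn_gt0// exprn_ege1// ler1n.
  have hdh0 : 0 <= h ^+ d / h by rewrite divr_ge0 ?ltW.
  have sumL : \sum_(p : 'I_d * cyclic_index d n) `|a p.2 - a (previous p.1 p.2)| <=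
      d%:R * (4 ^+ d * (2 * h) * P / h ^+ d).
    rewrite -(pair_bigA _ (fun i s => `|a s - a (previous i s)|))/=.
    rewrite (le_trans (ler_sum _ (fun i _ => sum_a_le i)))//.
    by rewrite sumr_const card_ord -[leLHS]mulr_natl.
  rewrite (le_trans (ler_wpM2l _ hN)) ?mulr_ge0//.
  rewrite mulrDr mulr1; apply: lerD; last by rewrite -[leRHS]mulr1 ler_wpM2l.
  rewrite (le_trans (ler_wpM2l _ (ler_wpM2l _ sumL))) ?mulr_ge0//.
  rewrite le_eqVlt; apply/orP; left; apply/eqP.
  move: (h ^+ d) hd0 (4 ^+ d) => x x0 y.
  by field; rewrite exp2n_neq0 gt_eqF.
(* In a selected cell [v > x / 4], so its cost [x - v] is at most [3 v]; in any other cell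
   [v <= 3 x / 4], so its cost [v] is at most [3 (x - v)]. Either choice of [G] is thus beaten up to
   the factor 3. *)
move=> G; rewrite !volume_symdiff_figure// mulr_sumr; apply: ler_sum => k _.
have v0 := volume_ge0 (B `&` dcube k).
have v1 : volume (B `&` dcube k) <= h ^+ d.
  rewrite -(volume_dcube R k); apply: volume_le; [|by move=> x []|exact: fin_meas_dcube].
  by apply: lmeasI; [exact: fB.1|exact: lmeas_dcube].
rewrite /c /a cell_embed ltr_pdivlMr//.
have hx : 0 < h ^+ d by [].
move: v0 v1 hx; move: (h ^+ d) (volume _) => x v v0 v1 x0.
by case: ltP => h1; case: (G k); nra.
Qed.

End one_scale.

End figure_approximation.

(** * Uniqueness *)

Section uniqueness.
Variables (R : realType) (d : nat).
Local Notation rV := 'rV[R]_d.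
Local Notation index n := {ffun 'I_d -> 'I_(2 ^ n)}.
Hypothesis d1 : (1 <= d)%N.

(** A figure [G] close to [B] at one generation is also a figure at all later ones, where
    quasi-optimality compares it with the selected figures. *)
Lemma figure_BV_cvg (B : set rV) : BV_cube B ->
  exists S : forall n, pred (index n), BV_cvg (fun n => figure (S n)) B.
Proof.
move=> hB; have fB := BV_cube_fin hB; have [[_ _ pB] BU] := hB.
have [P P0 PB] := lt_pinfty_bound pB.
have [S hS] : exists S : forall n, pred (index n), forall n,
    (perimeter (@figure R d n (S n)) <= (8 * d%:R * 4 ^+ d * P + 2)%:E)%E /\
    forall G : pred (index n), volume (B `+` figure (S n)) <= 3 * volume (B `+` figure G).
  exists (fun n => sval (cid (figure_approx n d1 fB BU PB))) => n.
  by case: cid.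
exists S; split.
  have vE n : lebesgue (figure (S n) `+` B) = (volume (figure (S n) `+` B))%:E.
    by apply: volumeE; apply: fin_meas_symdiff => //; exact: fin_meas_figure.
  under [X in X @ _]eq_fun do rewrite vE.
  apply: cvg_EFin; first exact: nearW.
  apply/cvgrPdist_le => e e0; have e3 : 0 < e / 3 by rewrite divr_gt0.
  have [m [G hG]] := dyadic_dense fB.1 BU e3.
  exists m => // n /= mn; rewrite sub0r normrN ger0_norm ?volume_ge0// setYC.
  have [G' EG] := figure_refine_le R G mn; rewrite EG in hG.
  by apply: le_trans ((hS n).2 G') _; lra.
apply: le_lt_trans (ltry (8 * d%:R * 4 ^+ d * P + 2)).
by apply: ge_ereal_sup => _ [n _ <-]; exact: (hS n).1.
Qed.

Lemma charge_set0 (omega : set rV -> R) : is_charge omega -> omega set0 = 0.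
Proof.
move=> [add _]; have b0 : BV_cube (@set0 rV).
  have := @figure_BV R d 0 pred0; rewrite /figure big_pred0_eq; exact.
have := add _ _ b0 b0; rewrite set0I set0U => /(_ (measure0 _)); lra.
Qed.

(** The cubes are added one at a time, each meeting the figure of the others in a null set. *)
Lemma charge_figure (omega : set rV -> R) n (S : pred (index n)) : is_charge omega ->
  omega (figure S) = \sum_(k | S k) omega (dcube k).
Proof.
move=> hw; have [add _] := hw.
have fig_seq (r : seq (index n)) : uniq r ->
    omega (figure (fun k => k \in r)) = \sum_(k <- r) omega (dcube k).
  elim: r => [_|k r IH /= /andP[kr ur]].
    by rewrite big_nil /figure big_pred0 ?charge_set0.
  rewrite big_cons -IH//.
  have E1 : dcube k = @figure R d n (pred1 k).
    by rewrite /figure big_pred1_eq.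
  have E2 : figure (fun l => l \in k :: r) = dcube k `|` @figure R d n (fun l => l \in r).
    apply/seteqP; split=> x.
      move=> /figureP[l]; rewrite inE => /orP[/eqP ->|lr] lx; first by left.
      by right; apply/figureP; exists l.
    case=> [kx|/figureP[l lr lx]]; apply/figureP.
      by exists k => //; rewrite inE eqxx.
    by exists l => //; rewrite inE lr orbT.
  rewrite E2 add//; [by rewrite E1; exact: figure_BV|exact: figure_BV|].
  rewrite volumeE; last by apply: fin_measI; [exact: fin_meas_dcube|exact: lmeas_figure].
  have := volumeI_figure (fun l => l \in r) k (fin_meas_dcube R k).
  by rewrite (negbTE kr) setIAC setIid => ->.
rewrite -big_enum -fig_seq ?enum_uniq//; congr omega.
by rewrite /figure; apply: eq_bigl => k; rewrite mem_enum.
Qed.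

Lemma charge_children (omega : set rV -> R) n (k : index n) : is_charge omega ->
  omega (dcube k) = \sum_a omega (dcube (child k a)).
Proof.
move=> hw; rewrite dcube_children charge_figure//.
exact: (sum_children k (fun l => omega (dcube l))).
Qed.

(** Passing to the [2^d] children multiplies the bound by [2^d * cratio^(1 + eps) = q < 1].
    Iterating this on a fixed cube forces the two charges to agree there, hence on figures, and
    BV-continuity carries equality to all BV-sets of the unit cube. *)
Lemma charge_eq_of_cubes (w w' : set rV -> R) (C eps : R) : 0 < eps ->
  is_charge w -> is_charge w' ->
  (forall K : dyadic_cube d, `|w (cube K) - w' (cube K)| <= C * vol R K `^ (1 + eps)) ->
  charge_eq w w'.
Proof.
move=> eps0 hw hw' wC; have cr0 := cratio_gt0 R d.
pose q := cratio R d `^ eps.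
have q0 : 0 <= q by exact: powR_ge0.
have q1 : q < 1 by exact: powR_cratio_lt1.
have dec N n (k : index n) : `|w (dcube k) - w' (dcube k)| <=
    C * q ^+ N * vol R (DyadicCube k) `^ (1 + eps).
  elim: N n k => [|N IH] n k; first by rewrite expr0 mulr1; exact: wC.
  rewrite !charge_children// -sumrB (le_trans (ler_norm_sum _ _ _))//.
  rewrite (le_trans (ler_sum _ (fun a _ => IH _ (child k a))))//.
  under eq_bigr do rewrite vol_dcube side_expE.
  rewrite sumr_const card_ffun card_bool card_ord -[leLHS]mulr_natl natrX.
  rewrite vol_dcube side_expE !powRD; last 2 first.
  - by rewrite expf_neq0 ?implybT// gt_eqF.
  - by rewrite expf_neq0 ?implybT// gt_eqF.
  rewrite !powRr1 ?exprn_ge0 ?(ltW cr0)// !powR_expn ?(ltW cr0)// -/q !exprS.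
  rewrite le_eqVlt; apply/orP; left; apply/eqP; rewrite /cratio.
  have := exp2n_neq0 R d; move: (2 ^+ d) => x x0.
  by field.
have cubes n (k : index n) : w (dcube k) = w' (dcube k).
  apply/eqP; rewrite -subr_eq0 -normr_le0.
  have cv : (fun N => C * q ^+ N * vol R (DyadicCube k) `^ (1 + eps)) @ \oo --> 0.
    rewrite (_ : 0 = 0 * vol R (DyadicCube k) `^ (1 + eps)); last by rewrite mul0r.
    by apply: cvgMl; apply: cvg_geometric; rewrite ger0_norm.
  by apply: (cvgr_to_ge cv); apply: nearW => N; exact: dec.
move=> B hB; have [S hS] := figure_BV_cvg hB.
have cv := hw.2 _ _ (fun n => figure_BV R (S n)) hB hS.
have cv' := hw'.2 _ _ (fun n => figure_BV R (S n)) hB hS.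
have E : (fun n => w (figure (S n))) = (fun n => w' (figure (S n))).
  by apply/funext => n; rewrite !charge_figure//; apply: eq_bigr => k _; exact: cubes.
by rewrite E in cv; exact: cvg_unique cv cv'.
Qed.

End uniqueness.

Theorem theorem7 (R : realType) (d : nat) (gamma : R)
    (eta : dyadic_cube d -> R) (kappa eps : R) :
  (1 <= d)%N ->
  (d%:R - 1) / d%:R < gamma -> gamma <= 1 ->
  0 <= kappa -> 0 < eps ->
  (forall K, `|eta K - children_sum eta K| <= kappa * vol R K `^ (1 + eps)) ->
  (forall K, `|eta K| <= kappa * vol R K `^ gamma) ->
  let close (theta : set 'rV[R]_d -> R) := exists2 C : R, 0 <= C &
    forall K, `|eta K - theta (cube K)| <= C * kappa * vol R K `^ (1 + eps) in
  exists theta : set 'rV[R]_d -> R,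
    [/\ sch gamma theta, close theta &
        forall theta' : set 'rV[R]_d -> R,
          sch gamma theta' -> close theta' -> charge_eq theta' theta].
Proof.
move=> d1 gamma_gt gamma_le1 kappa0 eps0 eta_add eta_le close.
have sch_theta := theta_sch d1 gamma_gt gamma_le1 kappa0 eps0 eta_add eta_le.
have close_theta : close (theta eta).
  exists (1 - cratio R d `^ eps)^-1.
    by rewrite invr_ge0 subr_ge0 ltW// powR_cratio_lt1.
  by move=> [m k0]; exact: theta_cube_close.
exists (theta eta); split=> // w [hw _] [C' C'0 hC'].
have [C C0 hC] := close_theta.
apply: (@charge_eq_of_cubes _ _ d1 _ _ ((C' + C) * kappa) eps) => //; first exact: sch_theta.1.
move=> K; have -> : w (cube K) - theta eta (cube K) =
    (eta K - theta eta (cube K)) - (eta K - w (cube K)) by ring.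
rewrite (le_trans (ler_normB _ _))// (le_trans (lerD (hC K) (hC' K)))//.
by rewrite le_eqVlt; apply/orP; left; apply/eqP; ring.
Qed.
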